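(* Let $N\ge1$, $p,q>0$, let $L_{\mathcal A}u=\operatorname{div}\mathcal A(x,u,\nabla u)$ be a weakly $m$-coercive operator ($m>1$), and let $K$ be a kernel satisfying the assumptions in the context with exponent $\beta$. Assume that $u_0\in L^1_{\rm loc}(\mathbb R^N)$, $u_0\ge 0$, and that for all $R>0$ large enough $$\int_{B_R}u_0(x)\,dx\ge c R^\nu$$ for some positive constant $c$ and an exponent $0\le\nu<N+\beta$, where $0<\beta<(m+\nu)/2$. If $$2\max\{1,m-1\}<p+q<m-1+\frac{N-\beta+m}{N+\beta-\nu},$$ then the problem $$\begin{cases} u_t-L_{\mathcal A}u\ge (K\ast u^p)u^q & \text{in } \mathbb R^N\times(0,\infty),\\ u(x,0)=u_0(x)\ge 0 & \text{in }\mathbb R^N\end{cases}$$ does not have nonnegative nontrivial (weak) solutions $u\in\mathcal S$.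
   Context: $B_R$ is the open ball of radius $R$ centered at the origin of $\mathbb R^N$. Operator: $\mathcal A:\mathbb R^N\times\mathbb R\times\mathbb R^N\to\mathbb R^N$ is a Carathéodory function with $\mathcal A(x,z,0)=0$ and $\mathcal A(x,z,\xi)\cdot\xi\ge 0$ for all $(x,z,\xi)\in\mathbb R^N\times[0,\infty)\times\mathbb R^N$. $L_{\mathcal A}$ is weakly $m$-coercive: there are a constant $c_0>0$ and an exponent $m>1$ such that $\mathcal A(x,z,\xi)\cdot\xi\ge c_0|\mathcal A(x,z,\xi)|^{m'}$ for all $(x,z,\xi)\in\mathbb R^N\times[0,\infty)\times\mathbb R^N$, where $m'=m/(m-1)$. $\nabla$ and $\operatorname{div}$ are with respect to $x$. Kernel: $K\in C(\mathbb R^N\setminus\{0\})$, $K>0$, $\liminf_{x\to0}K(x)>0$, and there exist $\rho>0$ and a positive constant $c_K$ such that $K(x)\ge c_K|x|^{-\beta}$ for all $|x|>\rho$. Convolution is in space only: $(K\ast u^p)(x,t)=\int_{\mathbb R^N}K(x-y)u^p(y,t)\,dy$. Nonnegative weak solutions (class $\mathcal S$): nonnegative functions $u\in W^{1,m}_{\rm loc}(\mathbb R^N\times(0,\infty))$ such that (i) $\mathcal A(x,u,\nabla u)\in[L^{m'}_{\rm loc}(\mathbb R^N\times(0,\infty))]^N$; (ii) $(K\ast u^p)u^q\in L^1_{\rm loc}(\mathbb R^N\times(0,\infty))$; and for any nonnegative test function $\varphi\in C^1_c(\mathbb R^N\times\mathbb R)$, $$\int_0^\infty\!\int_{\mathbb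 R^N}(K\ast u^p)u^q\varphi\,dx\,dt\le\int_0^\infty\!\int_{\mathbb R^N}u_t\,\varphi\,dx\,dt+\int_0^\infty\!\int_{\mathbb R^N}\mathcal A(x,u,\nabla u)\cdot\nabla\varphi\,dx\,dt,$$ or equivalently $$\int_0^\infty\!\int_{\mathbb R^N}(K\ast u^p)u^q\varphi\,dx\,dt\le-\int_{\mathbb R^N}u_0(x)\varphi(x,0)\,dx-\int_0^\infty\!\int_{\mathbb R^N}u\,\varphi_t\,dx\,dt+\int_0^\infty\!\int_{\mathbb R^N}\mathcal A(x,u,\nabla u)\cdot\nabla\varphi\,dx\,dt.$$ *)

(* Defs.v *)
From HB Require Import structures.
From mathcomp Require Import all_boot all_order all_algebra.
From mathcomp Require Import all_classical all_reals all_analysis.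
From mathcomp Require Import measurable_realfun.

Set Implicit Arguments.
Unset Strict Implicit.
Unset Printing Implicit Defensive.

Import Order.TTheory GRing.Theory Num.Theory.
Import numFieldNormedType.Exports.

Local Open Scope classical_set_scope.
Local Open Scope ring_scope.

Definition measure_matrix_display : measure_display -> measure_display.
Proof. exact. Qed.

Section measurable_matrix.
Context {d} {T : measurableType d}.
Variables m n : nat.

(* The sigma-algebra generated by the entries; for the reals it is the Borel
   sigma-algebra. *)
Definition mx_measurable : set (set 'M[T]_(m, n)) :=
  <<s [set A | exists i j, exists2 B : set T, measurable B &
               A = (fun M : 'M[T]_(m, n) => M i j) @^-1` B] >>.

Let mx_set0 : mx_measurable set0.
Proof. exact: sigma_algebra0. Qed.

Let mx_setC A : mx_measurable A -> mx_measurable (~` A).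
Proof. exact: sigma_algebraC. Qed.

Let mx_bigcup (F : _^nat) : (forall i, mx_measurable (F i)) ->
  mx_measurable (\bigcup_i (F i)).
Proof. exact: sigma_algebra_bigcup. Qed.

HB.instance Definition _ := @isMeasurable.Build (measure_matrix_display d)
  'M[T]_(m, n) mx_measurable mx_set0 mx_setC mx_bigcup.

End measurable_matrix.

Lemma measurable_coord d (T : measurableType d) m n i j :
  measurable_fun [set: 'M[T]_(m, n)] (fun M : 'M[T]_(m, n) => M i j).
Proof.
move=> _ B mB; rewrite setTI; apply: sub_sigma_algebra.
by exists i, j, B.
Qed.

Lemma measurable_fun_matrix d1 d2 (T1 : measurableType d1)
    (T2 : measurableType d2) m n (f : T1 -> 'M[T2]_(m, n)) :
  (forall i j, measurable_fun [set: T1] (fun x => f x i j)) ->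
  measurable_fun [set: T1] f.
Proof.
move=> mf; apply: (@measurability _ _ _ _ _ _
  [set A | exists i j, exists2 B : set T2, measurable B &
           A = (fun M : 'M[T2]_(m, n) => M i j) @^-1` B]) => //.
move=> _ [_ [i [j [B mB ->]]] <-].
exact: (mf i j).
Qed.

Section lebesgue_rV.
Context {R : realType}.

Definition consrV n (p : measurableTypeR R * 'rV[R]_n) : 'rV[R]_n.+1 := row_mx p.1%:M p.2.

Definition unconsrV n (x : 'rV[R]_n.+1) : measurableTypeR R * 'rV[R]_n :=
  (x 0 0, rsubmx (x : 'rV[R]_(1 + n))).

Lemma unconsrVK n : cancel (@unconsrV n) (@consrV n).
Proof.
move=> x; rewrite /consrV /unconsrV /=.
apply/rowP => j; rewrite mxE; case: splitP => k jk; rewrite !mxE.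
  rewrite ord1 eqxx mulr1n; congr (x _ _); apply/val_inj => /=.
  by rewrite jk ord1.
by congr (x _ _); apply/val_inj; rewrite /= jk.
Qed.

Lemma consrVK n : cancel (@consrV n) (@unconsrV n).
Proof.
move=> [a x]; rewrite /consrV /unconsrV /=; congr pair; last first.
  by rewrite row_mxKr.
transitivity (row_mx (a%:M : 'M[R]_1) x 0 (lshift n (0 : 'I_1))).
  by congr fun_of_matrix; exact/val_inj.
by rewrite row_mxEl mxE.
Qed.

Lemma consrV0 n p : @consrV n p 0 0 = p.1.
Proof. exact: (congr1 fst (consrVK p)). Qed.

Lemma consrVS n p i : @consrV n p 0 (rshift 1 i : 'I_n.+1) = p.2 0 i.
Proof. exact: (@row_mxEr R 1 1 n p.1%:M p.2 0 i). Qed.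

Lemma measurable_consrV n : measurable_fun [set: measurableTypeR R * 'rV[R]_n] (@consrV n).
Proof.
apply: measurable_fun_matrix => i j; rewrite /consrV.
case: (splitP (j : 'I_(1 + n))) => k jk.
- have -> : (fun x : measurableTypeR R * 'rV[R]_n => row_mx x.1%:M x.2 i j) = fst.
    apply/funext => x; rewrite (_ : j = lshift n k); last exact/val_inj.
    by rewrite row_mxEl mxE !ord1 eqxx mulr1n.
  exact: measurable_fst.
- have -> : (fun x : measurableTypeR R * 'rV[R]_n => row_mx x.1%:M x.2 i j) =
            (fun y : 'rV[R]_n => y i k) \o snd.
    apply/funext => x; rewrite (_ : j = rshift 1 k); last exact/val_inj.
    by rewrite row_mxEr.
  exact: measurableT_comp (measurable_coord _ _) measurable_snd.
Qed.

Lemma measurable_unconsrV n : measurable_fun [set: 'rV[R]_n.+1] (@unconsrV n).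
Proof.
apply/measurable_fun_pairP; split; first exact: measurable_coord.
apply: measurable_fun_matrix => i j.
rewrite (_ : (fun x => _) = (fun x : 'rV[R]_n.+1 => x i (rshift 1 j))).
  exact: measurable_coord.
by apply/funext => x /=; rewrite mxE.
Qed.

Section step.
Variables (n : nat) (mu : {sigma_finite_measure set 'rV[R]_n -> \bar R}).

Definition lebesgue_rVS : set 'rV[R]_n.+1 -> \bar R :=
  pushforward (lebesgue_measure \x mu)%E (@consrV n).

Let lebesgue_rVS0 : lebesgue_rVS set0 = 0%E.
Proof. by rewrite /lebesgue_rVS /pushforward preimage_set0 measure0. Qed.

Let lebesgue_rVS_ge0 A : (0 <= lebesgue_rVS A)%E.
Proof. by rewrite /lebesgue_rVS /pushforward measure_ge0. Qed.

Let mpre (A : set 'rV[R]_n.+1) : measurable A -> measurable (@consrV n @^-1` A).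
Proof.
by move=> mA; rewrite -[X in measurable X]setTI; exact: measurable_consrV.
Qed.

Let lebesgue_rVS_sigma_additive : semi_sigma_additive lebesgue_rVS.
Proof.
move=> F mF tF mUF; rewrite /lebesgue_rVS /pushforward preimage_bigcup.
apply: measure_semi_sigma_additive.
- by move=> k; exact: mpre.
- apply/trivIsetP => /= i j _ _ ij; rewrite -preimage_setI.
  by move/trivIsetP : tF => /(_ _ _ _ _ ij) ->//; rewrite preimage_set0.
- by rewrite -preimage_bigcup; exact: mpre.
Qed.

HB.instance Definition _ := isMeasure.Build _ _ _ lebesgue_rVS
  lebesgue_rVS0 lebesgue_rVS_ge0 lebesgue_rVS_sigma_additive.

Let lebesgue_rVS_sigma_finite : sigma_finite setT lebesgue_rVS.
Proof.
have [F FT Foo] : sigma_finite setT (@lebesgue_measure R \x mu)%E.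
  have /sigma_finiteP[F [TF ndF Foo]] := sigma_finiteT (@lebesgue_measure R).
  have /sigma_finiteP[G [TG ndG Goo]] := sigma_finiteT mu.
  exists (fun k => F k `*` G k).
    rewrite -setXTT TF TG predeqE => -[x y]; split.
      move=> [/= [i _ Fix] [k _ Gky]]; exists (maxn i k) => //; split.
      - by move: x Fix; exact/subsetPset/ndF/leq_maxl.
      - by move: y Gky; exact/subsetPset/ndG/leq_maxr.
    by move=> [i _ []/= ? ?]; split; exists i.
  move=> k; have [? ?] := Foo k; have [? ?] := Goo k.
  split; first exact: measurableX.
  by rewrite product_measure1E// lte_mul_pinfty// ge0_fin_numE.
exists (fun k => @unconsrV n @^-1` F k).
  rewrite -preimage_bigcup -FT; exact/esym/preimage_setT.
move=> k; have [mF Fk] := Foo k; split.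
  by rewrite -[X in measurable X]setTI; exact: measurable_unconsrV.
rewrite /lebesgue_rVS /pushforward.
rewrite (_ : @consrV n @^-1` (@unconsrV n @^-1` F k) = F k)//.
by apply/funext => x; rewrite /preimage /mkset consrVK.
Qed.

HB.instance Definition _ := @Measure_isSigmaFinite.Build _ _ _ lebesgue_rVS
  lebesgue_rVS_sigma_finite.

End step.

(* Lebesgue measure on R^n: a point mass for n = 0, then the image of
   (Lebesgue measure on R) x (Lebesgue measure on R^n) in R^(n+1). *)
Fixpoint lebesgue_rV n : {sigma_finite_measure set 'rV[R]_n -> \bar R} :=
  match n with
  | 0 => \d_(0 : 'rV[R]_0)
  | k.+1 => lebesgue_rVS (lebesgue_rV k)
  end.

Lemma lebesgue_rV_box n (a b : 'rV[R]_n) : (forall i, a 0 i <= b 0 i) ->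
  lebesgue_rV n [set x | forall i, a 0 i < x 0 i <= b 0 i] =
  (\prod_(i < n) (b 0 i - a 0 i))%:E.
Proof.
elim: n a b => [|n IHn] a b ab.
  rewrite big_ord0 /= diracE (_ : _ \in _ = true)//.
  by apply/mem_set => -[].
have ab' i : (unconsrV a).2 0 i <= (unconsrV b).2 0 i by rewrite !mxE.
have mbox : measurable [set x : 'rV[R]_n | forall i,
    (unconsrV a).2 0 i < x 0 i <= (unconsrV b).2 0 i].
  rewrite (_ : mkset _ = \bigcap_(i in [set: 'I_n]) [set x : 'rV[R]_n |
    (unconsrV a).2 0 i < x 0 i <= (unconsrV b).2 0 i]); last first.
    by apply/seteqP; split => [x xab i _|x xab i]; [exact: xab|exact: (xab i)].
  apply: fin_bigcap_measurable => // i _.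
  rewrite -[X in measurable X]setTI.
  rewrite (_ : [set x : 'rV[R]_n | _] = (fun x : 'rV[R]_n => x 0 i) @^-1`
    `](unconsrV a).2 0 i, (unconsrV b).2 0 i]%classic).
    exact: measurable_coord.
  by apply/funext => x; rewrite /preimage /mkset /= in_itv.
set B := (X in lebesgue_rV n.+1 X).
transitivity ((lebesgue_measure \x lebesgue_rV n)%E (@consrV n @^-1` B)) => //.
rewrite /B (_ : @consrV n @^-1` _ = `]a 0 0, b 0 0]%classic `*` [set x : 'rV[R]_n | forall i,
    (unconsrV a).2 0 i < x 0 i <= (unconsrV b).2 0 i]); last first.
  apply/seteqP; split => -[t x] /=.
  - move=> tx; split.
      by have := tx 0; rewrite in_itv/= consrV0.
    by move=> i; have := tx (rshift 1 i); rewrite consrVS !mxE.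
  - move=> [+ xab] i; rewrite in_itv/= => tab.
    case: (splitP (i : 'I_(1 + n))) => k ik.
      rewrite (_ : i = 0); last by apply/val_inj; rewrite /= ik ord1.
      by rewrite consrV0.
    rewrite (_ : i = rshift 1 k); last exact/val_inj.
    by have := xab k; rewrite consrVS !mxE.
rewrite product_measure1E//= IHn// lebesgue_measure_itv/= lte_fin.
rewrite big_ord_recl; under [in RHS]eq_bigr do rewrite -!rshift1.
under eq_bigr do rewrite !mxE.
have := ab 0; rewrite le_eqVlt => /orP[/eqP ->|->].
  by rewrite ltxx subrr mul0r mul0e.
by rewrite EFinM EFinB.
Qed.

End lebesgue_rV.


Section euclidean.
Context {R : realType} {n : nat}.

Definition dotv (x y : 'rV[R]_n) : R := \sum_i x 0 i * y 0 i.

(* The library norm `|x| on row vectors is the sup norm. *)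
Definition enorm (x : 'rV[R]_n) : R := Num.sqrt (dotv x x).

Definition eball (r : R) : set 'rV[R]_n := [set x | enorm x < r].

End euclidean.

(* Measurability for the completed sigma-algebra: [measurable_fun] alone means
   Borel measurability here. The library integral of a nonnegative function is
   the supremum over the measurable simple functions below it, so it agrees
   with the Lebesgue integral on all functions that are measurable in this
   sense. *)
Definition lebesgue_measurable (R : realType) d d' (T : measurableType d)
    (T' : measurableType d') (mu : set T -> \bar R) (D : set T) (f : T -> T') :=
  exists2 g : T -> T', measurable_fun D g &
    {ae mu, forall x, D x -> f x = g x}.

Section space_time.
Context {R : realType} {N : nat}.

Notation space := 'rV[R]_N.
Notation spacetime := ('rV[R]_N * R)%type.

Definition lebesgue_xt : set spacetime -> \bar R :=
  (lebesgue_rV N \x lebesgue_measure)%E.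

Definition upper : set spacetime := [set z | 0 < z.2].

Definition L1loc_space (f : space -> R) :=
  lebesgue_measurable (lebesgue_rV N) setT f /\
  forall C : set space, compact C ->
    (\int[lebesgue_rV N]_(x in C) `|f x|%:E < +oo)%E.

Definition Lloc (s : R) (W : set spacetime) (f : spacetime -> \bar R) :=
  lebesgue_measurable lebesgue_xt W f /\
  forall C : set spacetime, compact C -> C `<=` W ->
    (\int[lebesgue_xt]_(z in C) (`|f z| `^ s) < +oo)%E.

Definition C1 (phi : spacetime -> R) :=
  (forall z, differentiable phi z) /\ forall v, continuous ('D_v phi).

Definition C1c (W : set spacetime) (phi : spacetime -> R) :=
  C1 phi /\
  exists C : set spacetime,
    [/\ compact C, C `<=` W & forall z, ~ C z -> phi z = 0].

Definition dir_x (i : 'I_N) : spacetime := (delta_mx 0 i, 0).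
Definition dir_t : spacetime := (0, 1).

Definition grad_x (phi : spacetime -> R) (z : spacetime) : space :=
  \row_i 'D_(dir_x i) phi z.

Definition weak_derivative (W : set spacetime) (v : spacetime)
    (f g : spacetime -> R) :=
  Lloc 1 W (EFin \o g) /\
  forall phi, C1c W phi ->
    ((\int[lebesgue_xt]_(z in W) (f z * 'D_v phi z)%:E) =
     - (\int[lebesgue_xt]_(z in W) (g z * phi z)%:E))%E.

Definition W1loc (s : R) (W : set spacetime) (f : spacetime -> R) :=
  Lloc s W (EFin \o f) /\
  (forall i, exists2 g, weak_derivative W (dir_x i) f g &
                        Lloc s W (EFin \o g)) /\
  (exists2 g, weak_derivative W dir_t f g & Lloc s W (EFin \o g)).

Definition weak_grad_x (W : set spacetime) (f : spacetime -> R)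
    (F : spacetime -> space) :=
  forall i, weak_derivative W (dir_x i) f (fun z => F z 0 i).

Definition Caratheodory (A : space -> R -> space -> space) :=
  (forall w xi, lebesgue_measurable (lebesgue_rV N) setT
                  (fun x => A x w xi)) /\
  {ae lebesgue_rV N, forall x, continuous (fun p : R * space => A x p.1 p.2)}.

Definition admissible_operator (A : space -> R -> space -> space) :=
  [/\ Caratheodory A,
      forall x w, 0 <= w -> A x w 0 = 0 &
      forall x w xi, 0 <= w -> 0 <= dotv (A x w xi) xi].

Definition weakly_coercive (m : R) (A : space -> R -> space -> space) :=
  exists2 c0 : R, 0 < c0 &
    forall x w xi, 0 <= w ->
      c0 * enorm (A x w xi) `^ (m / (m - 1)) <= dotv (A x w xi) xi.

(* The value K 0 is irrelevant. *)
Definition admissible_kernel (beta : R) (K : space -> R) :=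
  [/\ forall x, x != 0 -> {for x, continuous K},
      forall x, x != 0 -> 0 < K x,
      (0 < limf_einf (EFin \o K) (dnbhs (0%R : space)))%E &
      exists rho cK : R, [/\ 0 < rho, 0 < cK &
        forall x, rho < enorm x -> cK * enorm x `^ (- beta) <= K x]].

Definition conv (K : space -> R) (f : spacetime -> R) (z : spacetime) : \bar R :=
  (\int[lebesgue_rV N]_y (K (z.1 - y) * f (y, z.2))%:E)%E.

Definition source (p q : R) (K : space -> R) (u : spacetime -> R)
    (z : spacetime) : \bar R :=
  (conv K (fun z' => (u z' `^ p)%R) z * (u z `^ q)%:E)%E.

Definition flux (A : space -> R -> space -> space) (u : spacetime -> R)
    (Du : spacetime -> space) (z : spacetime) : space :=
  A z.1 (u z) (Du z).

(* The weak inequality is the form that carries the initial datum [u0]. As test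
   functions need not vanish at t = 0 while the local spaces are those of the
   open set t > 0, absolute convergence of the two signed space-time integrals
   is part of the definition; the left-hand side always makes sense in
   [0, +oo]. The weak gradient [Du] is unique up to null sets. *)
Definition weak_solution (m p q : R) (A : space -> R -> space -> space)
    (K : space -> R) (u0 : space -> R) (u : spacetime -> R) :=
  W1loc m upper u /\
  {ae lebesgue_xt, forall z, upper z -> 0 <= u z} /\
  exists2 Du : spacetime -> space, weak_grad_x upper u Du &
  [/\ forall i, Lloc (m / (m - 1)) upper (fun z => (flux A u Du z 0 i)%:E),
      Lloc 1 upper (source p q K u) &
      forall phi, C1c setT phi -> (forall z, 0 <= phi z) ->
      [/\ (\int[lebesgue_xt]_(z in upper) `|u z * 'D_dir_t phi z|%:E < +oo)%E,
          (\int[lebesgue_xt]_(z in upper)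
             `|dotv (flux A u Du z) (grad_x phi z)|%:E < +oo)%E &
          ((\int[lebesgue_xt]_(z in upper) (source p q K u z * (phi z)%:E)) <=
           (- (\int[lebesgue_rV N]_x (u0 x * phi (x, 0))%:E))
           + (- (\int[lebesgue_xt]_(z in upper) (u z * 'D_dir_t phi z)%:E))
           + (\int[lebesgue_xt]_(z in upper)
                (dotv (flux A u Du z) (grad_x phi z))%:E))%E]].

End space_time.

(* Main.v *)
Require Import Defs.
From HB Require Import structures.
From mathcomp Require Import all_boot all_order all_algebra.
From mathcomp Require Import all_classical all_reals all_analysis.
From mathcomp Require Import measurable_realfun.
From mathcomp Require Import ring lra.

Set Implicit Arguments.
Unset Strict Implicit.
Unset Printing Implicit Defensive.

Import Order.TTheory GRing.Theory Num.Theory.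
Import numFieldNormedType.Exports.

Local Open Scope classical_set_scope.
Local Open Scope ring_scope.

(** The proof is a nonlinear capacity argument. Put k = p + q and s = k / 2; the
hypotheses give s > 1 and s > m - 1. Let u be a solution, R > 0 large (the
variable rr below), ep = R^(-kp) with kp = (N - beta + m) / (k - m + 1),
T = R^m ep^(2-m), w = u / ep, and
  phi(x,t) = eta^l,  eta = (1 - |x|^2 / (4 R^2))_+ (1 - t^2 / T^2)_+,
with a large integer l. Write F for the flux A(x, u, Du) and S for the integral
of the source times phi.

Testing with phi gives
  S + (int u0 phi(.,0)) <= int (u |phi_t| + |F| |grad phi|).
The flux is controlled by an energy estimate, the test of the inequality with
the bounded function (1 + w)^(-al) phi, al > 0 small, multiplied by a ramp in
time that removes the initial datum: weak coercivity gives
  int g |F|^m' phi <= C B,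
  B = int (u eta^(l-1) / T + g^(1-m) R^(-m) eta^(l-m)),
where g = - d/du (1 + u/ep)^(-al), and Young's inequality then bounds the whole
right-hand side by C B (lemmas energy and source_test). As the weak inequality
is only available for C^1 test functions, the energy estimate is obtained for
mollified solutions first: chain_test passes to the limit. This limit needs
continuity of translations in L^1 (L1near_id_xt), the L^m bound for mollified
gradients (mollify_Lp) and the rule that the product of a fixed L^m' function
and a sequence bounded in L^m and converging to 0 in L^1 converges to 0 in L^1.

The choice of T makes both terms of B multiples of ep / T, the first with
w eta^(l-1) and the second with (1 + w)^sig eta^(l-m), sig = (al + 1)(m - 1).
Both exponents, 1 and sig, are below s, so each is at most
de w^s eta^l + C(de) (cutoff_error_absorb). With
Y = int_t (int_x w^s phi)^2 dt, the inequality a <= b + a^2 / b gives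
int w^s phi <= R^N T + R^(-N) Y (time_amgm).

For the source, K >= c R^(-beta) on the relevant range (kernel_lower), hence
S >= c R^(-beta) int_t (int_x u^p phi)(int_x u^q phi) dt, and by symmetrization
the last integral is at least ep^k Y (source_lower). The exponent kp is the one
for which R^(-beta) ep^k = ep R^(-N) / T, so the Y term of the upper bound is
absorbed by S once de is small. What is left is
  int u0 phi(.,0) <= C R^N ep = C R^(N - kp).
The left-hand side is at least a multiple of R^nu, and the upper bound on p + q
says exactly that kp > N + beta - nu, so that nu > N - kp: a contradiction for
large R.

The solution, its weak gradient and its flux are only almost everywhere equal to
Borel functions; clean_data replaces them by Borel representatives, and the
comparison lemmas of the first section allow integrands that are not Borel. *)

(** * Integrals of functions that need not be measurable *)

Section nonmeasurable.
Local Open Scope ereal_scope.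
Context d (T : measurableType d) (R : realType).
Variable mu : {measure set T -> \bar R}.
Import HBNNSimple.

(** The integral of a nonnegative function is a supremum over the simple functions
below it, hence monotone whatever the measurability of the two functions. *)
Lemma ge0_le_integral_nm (f g : T -> \bar R) :
  (forall x, 0 <= f x) -> (forall x, f x <= g x) ->
  \int[mu]_x f x <= \int[mu]_x g x.
Proof.
move=> f0 fg.
have g0 x : 0 <= g x by exact: le_trans (fg x).
rewrite !ge0_integralTE//; apply: le_ereal_sup => _ [h hf <-].
by exists h => // x; exact: le_trans (fg x).
Qed.

(** A simple function below [f] stays below [g] and keeps its integral once it is
set to 0 on the exceptional null set. *)
Let ae_ge0_le (f g : T -> \bar R) :
  (forall x, 0 <= f x) -> (forall x, 0 <= g x) ->
  {ae mu, forall x, f x = g x} -> \int[mu]_x f x <= \int[mu]_x g x.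
Proof.
move=> f0 g0 [N [mN N0 sN]].
rewrite !ge0_integralTE//; apply: ge_ereal_sup => _ [h /= hf <-].
apply: ereal_sup_ubound; exists (proj_nnsfun h (measurableC mN)) => /=.
  move=> x; rewrite mindicE; have [xN|xN] := boolP (x \in ~` N).
    rewrite mulr1 (le_trans (hf x))//.
    suff -> : f x = g x by [].
    by apply: contrapT => fgx; move: xN; rewrite inE; apply; exact: sN.
  by rewrite mulr0.
rewrite -!integralT_nnsfun; apply: ge0_ae_eq_integral => //.
- exact/measurable_EFinP.
- exact/measurable_EFinP.
- by move=> x _; rewrite lee_fin.
- by move=> x _; rewrite lee_fin.
exists N; split => // x /=; apply: contra_notP => xN _ /=.
by rewrite mindicE mem_set// mulr1.
Qed.

Lemma ae_eq_integral_nm (D : set T) (f g : T -> \bar R) :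
  {ae mu, forall x, D x -> f x = g x} ->
  \int[mu]_(x in D) f x = \int[mu]_(x in D) g x.
Proof.
move=> fg; rewrite integral_mkcond [RHS]integral_mkcond.
have {fg} : {ae mu, forall x, (f \_ D) x = (g \_ D) x}.
  apply: filterS fg => x fg; rewrite !patchE; case: ifPn => // /set_mem.
  exact: fg.
move: (f \_ D) (g \_ D) => {}f {}g fg.
rewrite integralE [RHS]integralE; congr (_ - _).
  apply/eqP; rewrite eq_le; apply/andP; split; apply: ae_ge0_le => //;
    by apply: filterS fg => x fgx; rewrite !funeposE fgx.
apply/eqP; rewrite eq_le; apply/andP; split; apply: ae_ge0_le => //;
  by apply: filterS fg => x fgx; rewrite !funenegE fgx.
Qed.

Lemma ae_ge0_le_integral_nm (D : set T) (f g : T -> \bar R) :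
  (forall x, D x -> 0 <= f x) ->
  {ae mu, forall x, D x -> f x <= g x} ->
  \int[mu]_(x in D) f x <= \int[mu]_(x in D) g x.
Proof.
move=> f0 fg.
rewrite (@ae_eq_integral_nm D g (fun x => maxe (f x) (g x))); last first.
  by apply: filterS fg => x fg Dx; rewrite max_r// fg.
rewrite integral_mkcond [leRHS]integral_mkcond.
apply: ge0_le_integral_nm => x; rewrite !patchE; case: ifPn => //.
  by move=> /set_mem; exact: f0.
by rewrite le_max lexx.
Qed.

End nonmeasurable.

Section cvg_small.
Local Open Scope ereal_scope.
Context (R : realType).

(** Convergence to 0 of a nonnegative sequence, in a form that requires no proof
of finiteness. *)
Definition vanish (u : nat -> \bar R) :=
  forall e : R, (0 < e)%R -> \forall n \near \oo, u n <= e%:E.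

Lemma cvg0_vanish (u : nat -> \bar R) : u @ \oo --> 0 -> vanish u.
Proof.
move=> u0 e e0; have /fine_cvgP[ufin /cvgrPdist_le/(_ e e0)] := u0.
move=> ue; near=> n; have un : u n \is a fin_num by near: n.
have : (`|0 - fine (u n)| <= e)%R by near: n.
by rewrite sub0r normrN ler_norml -lee_fin => /andP[_]; rewrite -lee_fin fineK.
Unshelve. all: by end_near. Qed.

Lemma vanish_cvg0 (u : nat -> \bar R) : (forall n, 0 <= u n) -> vanish u ->
  u @ \oo --> 0.
Proof.
move=> u0 uv; have ufin : \forall n \near \oo, u n \is a fin_num.
  near=> n; rewrite ge0_fin_numE//; apply: (@le_lt_trans _ _ 1%:E); last exact: ltry.
  by near: n; exact: uv.
apply/fine_cvgP; split => //; apply/cvgrPdist_le => e e0.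
near=> n; have un : u n \is a fin_num by near: n.
rewrite sub0r normrN ger0_norm ?fine_ge0// -lee_fin fineK//.
by near: n; exact: uv.
Unshelve. all: by end_near. Qed.

Lemma vanishD (u v : nat -> \bar R) : vanish u -> vanish v ->
  vanish (fun n => u n + v n).
Proof.
move=> uu vv e e0; have e2 : (0 < e / 2)%R by rewrite divr_gt0.
near=> n; rewrite [e]splitr EFinD leeD//; near: n; [exact: uu|exact: vv].
Unshelve. all: by end_near. Qed.

Lemma le_vanish (u v : nat -> \bar R) : (\forall n \near \oo, u n <= v n) ->
  vanish v -> vanish u.
Proof.
move=> uv vv e e0; near=> n; apply: (@le_trans _ _ (v n)); near: n => //.
exact: vv.
Unshelve. all: by end_near. Qed.

Lemma vanishZl (k : R) (u : nat -> \bar R) : (0 <= k)%R -> (forall n, 0 <= u n) ->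
  vanish u -> vanish (fun n => k%:E * u n).
Proof.
move=> k0 u0 uv e e0; have k1 : (0 < k + 1)%R by lra.
near=> n; apply: (@le_trans _ _ ((k + 1)%:E * (e / (k + 1))%:E)).
  apply: lee_pmul => //; first by rewrite lee_fin; lra.
  by near: n; apply: uv; exact: divr_gt0.
by rewrite -EFinM mulrCA divff ?mulr1// gt_eqF.
Unshelve. all: by end_near. Qed.

End cvg_small.

Section lebR.
Context (R : realType).

(** Lebesgue measure on [R] for the canonical sigma-algebra of [R], which has
the same sets as the one on which [lebesgue_measure] is declared, but another
display. *)
Definition lebR : set R -> \bar R := @lebesgue_measure R.

Let lebR0 : lebR set0 = 0%E.
Proof. exact: (measure0 (@lebesgue_measure R)). Qed.

Let lebR_ge0 A : (0 <= lebR A)%E.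
Proof. exact: (measure_ge0 (@lebesgue_measure R)). Qed.

Let lebR_sigma_additive : semi_sigma_additive lebR.
Proof. exact: (@measure_semi_sigma_additive _ _ _ (@lebesgue_measure R)). Qed.

HB.instance Definition _ := isMeasure.Build _ _ _ lebR
  lebR0 lebR_ge0 lebR_sigma_additive.

Let lebR_sigma_finite : sigma_finite setT lebR.
Proof. exact: (sigma_finiteT (@lebesgue_measure R)). Qed.

HB.instance Definition _ := @Measure_isSigmaFinite.Build _ _ _ lebR
  lebR_sigma_finite.

Lemma measurable_idR : measurable_fun [set: measurableTypeR R]
  (id : measurableTypeR R -> R).
Proof. by move=> _ B mB; rewrite setTI. Qed.

Lemma ge0_integral_lebR (f : R -> \bar R) : measurable_fun [set: R] f ->
  (forall x, 0 <= f x)%E ->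
  (\int[lebR]_x f x = \int[@lebesgue_measure R]_(x in [set: measurableTypeR R]) f x)%E.
Proof.
move=> mf f0.
have := @ge0_integral_pushforward _ _ (measurableTypeR R) R R _ measurable_idR
  (@lebesgue_measure R) setT f measurableT.
rewrite preimage_setT => <- //.
Qed.

End lebR.

Section xt.
Context (R : realType) (N : nat).

Lemma lebesgue_xtE : @lebesgue_xt R N = (lebesgue_rV N \x (@lebR R))%E.
Proof. by []. Qed.

Let xt0 : @lebesgue_xt R N set0 = 0%E.
Proof. exact: (measure0 (lebesgue_rV N \x (@lebR R))%E). Qed.

Let xt_ge0 A : (0 <= @lebesgue_xt R N A)%E.
Proof. exact: (measure_ge0 (lebesgue_rV N \x (@lebR R))%E). Qed.

Let xt_sigma_additive : semi_sigma_additive (@lebesgue_xt R N).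
Proof. exact: (@measure_semi_sigma_additive _ _ _ (lebesgue_rV N \x (@lebR R))%E). Qed.

HB.instance Definition _ := isMeasure.Build _ _ _ (@lebesgue_xt R N)
  xt0 xt_ge0 xt_sigma_additive.

Let xt_sigma_finite : sigma_finite setT (@lebesgue_xt R N).
Proof.
have /sigma_finiteP[F [TF ndF Foo]] := sigma_finiteT (@lebesgue_rV R N).
have /sigma_finiteP[G [TG ndG Goo]] := sigma_finiteT (@lebR R).
exists (fun k => F k `*` G k).
  rewrite -setXTT TF TG predeqE => -[x y]; split.
    move=> [/= [i _ Fix] [k _ Gky]]; exists (maxn i k) => //; split.
    - by move: x Fix; exact/subsetPset/ndF/leq_maxl.
    - by move: y Gky; exact/subsetPset/ndG/leq_maxr.
  by move=> [i _ []/= ? ?]; split; exists i.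
move=> k; have [? ?] := Foo k; have [? ?] := Goo k.
split; first exact: measurableX.
rewrite lebesgue_xtE product_measure1E// lte_mul_pinfty// ge0_fin_numE//.
Qed.

HB.instance Definition _ := @Measure_isSigmaFinite.Build _ _ _ (@lebesgue_xt R N)
  xt_sigma_finite.

End xt.

(** * Translations in L^1: products and images of measures *)

Section L1_near_id.
Local Open Scope ereal_scope.
Context d (T : measurableType d) (R : realType).
Variable mu : {measure set T -> \bar R}.

(** The properties of the translations by a sequence tending to 0, without mention
of an addition: in this form they pass to product measures and to images of
measures, which is how the Lebesgue measure of space-time is built. *)
Definition L1near_id (tau : nat -> T -> T) :=
  [/\ forall n, measurable_fun setT (tau n),
      forall n (f : T -> \bar R), measurable_fun setT f -> (forall x, 0 <= f x) ->
        \int[mu]_x f (tau n x) = \int[mu]_x f x &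
      forall f : T -> R, measurable_fun setT f ->
        \int[mu]_x `|f x|%:E < +oo ->
        vanish (fun n => \int[mu]_x `|f (tau n x) - f x|%:E)].

End L1_near_id.

Section L1_near_id_prod.
Local Open Scope ereal_scope.
Context d1 d2 (T1 : measurableType d1) (T2 : measurableType d2) (R : realType).
Variables (m1 : {sigma_finite_measure set T1 -> \bar R})
  (m2 : {sigma_finite_measure set T2 -> \bar R}).

(** One factor moves at a time. When only the first variable moves, the inner
integral tends to 0 for almost every value of the second variable and is at most
twice the L^1 norm of the slice, which is integrable by Tonelli: dominated
convergence applies. *)
Lemma L1near_id_prod (t1 : nat -> T1 -> T1) (t2 : nat -> T2 -> T2) :
  L1near_id m1 t1 -> L1near_id m2 t2 ->
  L1near_id (m1 \x m2) (fun n z => (t1 n z.1, t2 n z.2)).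
Proof.
move=> [mt1 it1 ct1] [mt2 it2 ct2].
have mt n : measurable_fun setT (fun z : T1 * T2 => (t1 n z.1, t2 n z.2)).
  apply/measurable_fun_pairP; split => /=.
    exact: (measurableT_comp (mt1 n) measurable_fst).
  exact: (measurableT_comp (mt2 n) measurable_snd).
have mt1' n : measurable_fun setT (fun z : T1 * T2 => (t1 n z.1, z.2)).
  apply/measurable_fun_pairP; split => /=; last exact: measurable_snd.
  exact: (measurableT_comp (mt1 n) measurable_fst).
have mt2' n : measurable_fun setT (fun z : T1 * T2 => (z.1, t2 n z.2)).
  apply/measurable_fun_pairP; split => /=; first exact: measurable_fst.
  exact: (measurableT_comp (mt2 n) measurable_snd).
have int2 n (f : T1 * T2 -> \bar R) : measurable_fun setT f ->
    (forall z, 0 <= f z) ->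
    \int[m1 \x m2]_z f (z.1, t2 n z.2) = \int[m1 \x m2]_z f z.
  move=> mf f0.
  rewrite fubini_tonelli1//; last exact: measurableT_comp mf (mt2' n).
  rewrite (fubini_tonelli1 f mf f0); apply: eq_integral => x _.
  rewrite /fubini_F; apply: (it2 n (fun y => f (x, y))) => //.
  exact: measurableT_comp mf (pair1_measurable x).
split => //.
  move=> n f mf f0; rewrite fubini_tonelli2//; last exact: measurableT_comp mf (mt n).
  have mG : measurable_fun setT (fubini_G m1 f).
    exact: measurable_fun_fubini_tonelli_G.
  rewrite (fubini_tonelli2 f mf f0).
  have G0 y : 0 <= fubini_G m1 f y by exact: integral_ge0.
  apply: etrans (it2 n (fubini_G m1 f) mG G0); apply: eq_integral => y _.
  rewrite /fubini_G; apply: (it1 n (fun x => f (x, t2 n y))) => //.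
  exact: measurableT_comp mf (pair2_measurable _).
move=> f mf finf.
have mfm (g : T1 * T2 -> T1 * T2) : measurable_fun setT g ->
    measurable_fun setT (fun z => `|f (g z) - f z|%:E).
  move=> mg; apply/measurable_EFinP; apply: measurableT_comp => //.
  by apply: measurable_funB => //; exact: measurableT_comp mf mg.
have absf : measurable_fun setT (fun z => `|f z|%:E : \bar R).
  by apply/measurable_EFinP; exact: measurableT_comp.
apply: (@le_vanish _ _ (fun n =>
    \int[m1 \x m2]_z `|f (t1 n z.1, z.2) - f z|%:E
    + \int[m1 \x m2]_z `|f (z.1, t2 n z.2) - f z|%:E)).
  near=> n.
  rewrite -(int2 n (fun z => `|f (t1 n z.1, z.2) - f z|%:E)); last 2 first.
    exact: mfm (mt1' n).
    by move=> z; rewrite lee_fin.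
  have m3 : measurable_fun setT (fun z : T1 * T2 =>
      `|f (t1 n z.1, t2 n z.2) - f (z.1, t2 n z.2)|%:E).
    exact: measurableT_comp (mfm _ (mt1' n)) (mt2' n).
  rewrite -ge0_integralD//; try exact: mfm (mt2' n); try by move=> z _; rewrite lee_fin.
    apply: ge0_le_integral_nm => z; first by rewrite lee_fin.
    rewrite -EFinD lee_fin (le_trans _ (ler_normD _ _))//.
    by rewrite addrA subrK.
have fin1 : \int[m1]_x \int[m2]_y `|f (x, y)|%:E < +oo.
  by move: finf; rewrite fubini_tonelli1//= => z; rewrite lee_fin.
have fin2 : \int[m2]_y \int[m1]_x `|f (x, y)|%:E < +oo.
  by move: finf; rewrite fubini_tonelli2//= => z; rewrite lee_fin.
apply: vanishD.
  pose F n y := \int[m1]_x `|f (t1 n x, y) - f (x, y)|%:E.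
  pose G y := \int[m1]_x `|f (x, y)|%:E.
  have mG : measurable_fun setT G.
    exact: (measurable_fun_fubini_tonelli_G (m1 := m1) (fun z => `|f z|%:E)).
  have G0 y : 0 <= G y by apply: integral_ge0 => x _; rewrite lee_fin.
  have iG : m2.-integrable setT G.
    apply/integrableP; split => //.
    by rewrite (eq_integral G)// => y _; rewrite gee0_abs.
  have iGae : {ae m2, forall y, G y < +oo}.
    apply: filterS (integrable_ae measurableT iG) => y /(_ Logic.I).
    by rewrite ge0_fin_numE.
  have mfy y : measurable_fun setT (fun x => f (x, y)).
    exact: measurableT_comp mf (pair2_measurable y).
  have [] := @dominated_convergence _ _ _ m2 setT measurableT F (cst 0)
    (fun y => 2%:E * G y).
  - move=> n; exact: (measurable_fun_fubini_tonelli_G (m1 := m1)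
      (fun z => `|f (t1 n z.1, z.2) - f z|%:E) (mfm _ (mt1' n))).
  - exact: measurable_cst.
  - apply: filterS iGae => y Gy _; apply: vanish_cvg0.
      by move=> n; apply: integral_ge0 => x _; rewrite lee_fin.
    exact: (ct1 (fun x => f (x, y))).
  - exact: integrableZl.
  - apply: aeW => y n _; rewrite gee0_abs; last first.
      by apply: integral_ge0 => x _; rewrite lee_fin.
    have mft : measurable_fun setT (fun x => f (t1 n x, y)).
      exact: measurableT_comp (mfy y) (mt1 n).
    apply: (@le_trans _ _ (\int[m1]_x (`|f (t1 n x, y)|%:E + `|f (x, y)|%:E))).
      apply: ge0_le_integral_nm => x; first by rewrite lee_fin.
      by rewrite -EFinD lee_fin ler_normB.
    have mn (g : T1 -> R) : measurable_fun setT g ->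
        measurable_fun setT (fun x => `|g x|%:E : \bar R).
      by move=> mg; apply/measurable_EFinP; exact: measurableT_comp mg.
    rewrite ge0_integralD//; try exact: mn; try by move=> x _; rewrite lee_fin.
    rewrite (it1 n (fun x => `|f (x, y)|%:E)); last 2 first.
      exact: mn.
      by move=> x; rewrite lee_fin.
    by rewrite -[2%R]/(1 + 1)%R EFinD ge0_muleDl ?lee_fin// !mul1e.
  move=> _ + _; move=> /cvg0_vanish; apply: le_vanish.
  near=> n; rewrite fubini_tonelli2//=; last exact: mfm (mt1' n).
  rewrite /fubini_G.
  apply: ge0_le_integral_nm => y.
    by apply: integral_ge0 => x _; rewrite lee_fin.
  by rewrite sube0; exact: lee_abs.
pose F n x := \int[m2]_y `|f (x, t2 n y) - f (x, y)|%:E.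
pose G x := \int[m2]_y `|f (x, y)|%:E.
have mG : measurable_fun setT G.
  exact: (measurable_fun_fubini_tonelli_F (m2 := m2) (fun z => `|f z|%:E)).
have G0 y : 0 <= G y by apply: integral_ge0 => x _; rewrite lee_fin.
have iG : m1.-integrable setT G.
  apply/integrableP; split => //.
  by rewrite (eq_integral G)// => y _; rewrite gee0_abs.
have iGae : {ae m1, forall y, G y < +oo}.
  apply: filterS (integrable_ae measurableT iG) => y /(_ Logic.I).
  by rewrite ge0_fin_numE.
have mfx x : measurable_fun setT (fun y => f (x, y)).
  exact: measurableT_comp mf (pair1_measurable x).
have [] := @dominated_convergence _ _ _ m1 setT measurableT F (cst 0)
  (fun y => 2%:E * G y).
- move=> n; exact: (measurable_fun_fubini_tonelli_F (m2 := m2)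
    (fun z => `|f (z.1, t2 n z.2) - f z|%:E) (mfm _ (mt2' n))).
- exact: measurable_cst.
- apply: filterS iGae => y Gy _; apply: vanish_cvg0.
    by move=> n; apply: integral_ge0 => x _; rewrite lee_fin.
  exact: (ct2 (fun x => f (y, x))).
- exact: integrableZl.
- apply: aeW => x n _; rewrite gee0_abs; last first.
    by apply: integral_ge0 => y _; rewrite lee_fin.
  have mft : measurable_fun setT (fun y => f (x, t2 n y)).
    exact: measurableT_comp (mfx x) (mt2 n).
  apply: (@le_trans _ _ (\int[m2]_y (`|f (x, t2 n y)|%:E + `|f (x, y)|%:E))).
    apply: ge0_le_integral_nm => y; first by rewrite lee_fin.
    by rewrite -EFinD lee_fin ler_normB.
  have mn (g : T2 -> R) : measurable_fun setT g ->
      measurable_fun setT (fun x => `|g x|%:E : \bar R).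
    by move=> mg; apply/measurable_EFinP; exact: measurableT_comp mg.
  rewrite ge0_integralD//; try exact: mn; try by move=> y _; rewrite lee_fin.
  rewrite (it2 n (fun y => `|f (x, y)|%:E)); last 2 first.
    exact: mn.
    by move=> y; rewrite lee_fin.
  by rewrite -[2%R]/(1 + 1)%R EFinD ge0_muleDl ?lee_fin// !mul1e.
move=> _ + _; move=> /cvg0_vanish; apply: le_vanish.
near=> n; rewrite fubini_tonelli1//=; last exact: mfm (mt2' n).
rewrite /fubini_F.
apply: ge0_le_integral_nm => y.
  by apply: integral_ge0 => x _; rewrite lee_fin.
by rewrite sube0; exact: lee_abs.
Unshelve. all: by end_near. Qed.

End L1_near_id_prod.

Lemma L1near_id_pushforward d1 d2 (X : measurableType d1) (Y : measurableType d2)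
    (R : realType) (mu : {measure set X -> \bar R}) (nu : {measure set Y -> \bar R})
    (phi : X -> Y) (t : nat -> X -> X) (t' : nat -> Y -> Y) :
  measurable_fun setT phi -> (nu : set Y -> \bar R) = pushforward mu phi ->
  (forall n, measurable_fun setT (t' n)) ->
  (forall n x, phi (t n x) = t' n (phi x)) ->
  L1near_id mu t -> L1near_id nu t'.
Proof.
move=> mphi nuE mt' tt' [mt it ct].
have push (f : Y -> \bar R) : measurable_fun setT f -> (forall y, 0 <= f y)%E ->
    (\int[nu]_y f y = \int[mu]_x f (phi x))%E.
  by move=> mf f0; rewrite nuE ge0_integral_pushforward//.
have mn (f : Y -> R) : measurable_fun setT f ->
    measurable_fun setT (fun x => `|f x|%:E : \bar R).
  by move=> mf; apply/measurable_EFinP; exact: measurableT_comp.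
split => //.
  move=> n f mf f0; rewrite push//; last exact: measurableT_comp mf (mt' n).
  rewrite [RHS]push// -(it n (fun x => f (phi x)))//; last exact: measurableT_comp mf mphi.
  by apply: eq_integral => x _; rewrite tt'.
move=> f mf finf.
have mfn n : measurable_fun setT (fun y => f (t' n y) - f y).
  by apply: measurable_funB => //; exact: measurableT_comp mf (mt' n).
have /ct : measurable_fun setT (f \o phi) by exact: measurableT_comp.
rewrite -(push (fun x => `|f x|%:E)); [|exact: mn|by move=> y; rewrite lee_fin].
move=> /(_ finf); apply: le_vanish; near=> n.
rewrite push; [|exact: mn|by move=> y; rewrite lee_fin].
by under eq_integral do rewrite -tt'.
Unshelve. all: by end_near. Qed.

(** * Continuity of translations in L^1 *)

Section L1closure.
Local Open Scope ereal_scope.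
Context d (T : measurableType d) (R : realType).
Variable mu : {measure set T -> \bar R}.
Variable tau : nat -> T -> T.
Hypothesis mt : forall n, measurable_fun setT (tau n).
Hypothesis it : forall n (f : T -> \bar R), measurable_fun setT f ->
  (forall x, 0 <= f x) -> \int[mu]_x f (tau n x) = \int[mu]_x f x.

(** The transformations preserve the measure, so the integral of |f o tau - g o tau|
is that of |f - g|: a three-epsilon argument. *)
Lemma L1near_closure (f : T -> R) : measurable_fun setT f ->
  (forall e : R, (0 < e)%R -> exists g : T -> R, [/\ measurable_fun setT g,
     \int[mu]_x `|f x - g x|%:E <= e%:E &
     vanish (fun n => \int[mu]_x `|g (tau n x) - g x|%:E)]) ->
  vanish (fun n => \int[mu]_x `|f (tau n x) - f x|%:E).
Proof.
move=> mf H e e0; have e3 : (0 < e / 3)%R by rewrite divr_gt0.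
have [g [mg fg gv]] := H _ e3.
have mn (h : T -> R) : measurable_fun setT h ->
    measurable_fun setT (fun x => `|h x|%:E : \bar R).
  by move=> mh; apply/measurable_EFinP; exact: measurableT_comp mh.
have mfg : measurable_fun setT (fun x => `|f x - g x|%:E : \bar R).
  by apply: mn; exact: measurable_funB.
near=> n.
have mfgt : measurable_fun setT (fun x => `|f (tau n x) - g (tau n x)|%:E : \bar R).
  exact: (measurableT_comp mfg (mt n)).
have mgg : measurable_fun setT (fun x => `|g (tau n x) - g x|%:E : \bar R).
  by apply: mn; apply: measurable_funB => //; exact: measurableT_comp mg (mt n).
apply: (@le_trans _ _ (\int[mu]_x (`|f (tau n x) - g (tau n x)|%:E
    + (`|g (tau n x) - g x|%:E + `|f x - g x|%:E)))).
  apply: ge0_le_integral_nm => x; first by rewrite lee_fin.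
  rewrite -!EFinD lee_fin.
  have := ler_distD (g (tau n x)) (f (tau n x)) (f x).
  have := ler_distD (g x) (g (tau n x)) (f x).
  rewrite (distrC (g x) (f x)); lra.
rewrite ge0_integralD//; [|by move=> x _; rewrite adde_ge0// lee_fin|by apply: emeasurable_funD].
rewrite ge0_integralD//.
rewrite (it n (f := fun x => `|f x - g x|%:E))//.
rewrite (_ : e = e / 3 + (e / 3 + e / 3))%R; last lra.
rewrite !EFinD leeD// leeD//.
by near: n; exact: gv.
Unshelve. all: by end_near. Qed.

End L1closure.

Section L1_R.
Context (R : realType).
Local Notation mu := (@lebesgue_measure R).
Local Notation mR := (measurableTypeR R).

Lemma measurable_translate (h : R) : measurable_fun [set: mR] (fun x : mR => (x + h : mR)).
Proof. exact: measurable_funD. Qed.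

Let translateR (h : R) : {mfun mR >-> mR} :=
  HB.pack (fun x : mR => (x + h : mR))
    (isMeasurableFun.Build _ _ mR mR _ (measurable_translate h)).

Lemma lebesgue_measure_translate (h : R) (A : set mR) : measurable A ->
  mu A = pushforward mu (translateR h) A.
Proof.
move=> mA; apply: lebesgue_measure_unique => //= _ [[a b]] _ <-.
rewrite /pushforward (_ : translateR h @^-1` _ = `](a - h), (b - h)]%classic); last first.
  by apply/seteqP; split => x; rewrite /preimage/= !in_itv/= ?ltrBlDr ?lerBrDr.
rewrite !lebesgue_measure_itv/= !lte_fin ltrD2r; case: ifPn => // _.
by rewrite -!EFinB; congr EFin; lra.
Qed.

Lemma ge0_integral_translate (h : R) (f : mR -> \bar R) : measurable_fun setT f ->
  (forall x, 0 <= f x)%E ->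
  (\int[mu]_x f (x + h)%R = \int[mu]_x f x)%E.
Proof.
move=> mf f0.
have := ge0_integral_pushforward (measurable_translate h) mu measurableT mf (fun x _ => f0 x).
rewrite preimage_setT => /= <-.
rewrite [RHS](eq_measure_integral (pushforward mu (translateR h)))// => A mA _.
exact: lebesgue_measure_translate.
Qed.

(** By density it is enough to treat a continuous function cut to [-M, M], for
which dominated convergence applies: pointwise convergence fails at most at the
two end points. *)
Lemma L1near_id_R (h : nat -> R) : h @ \oo --> 0 ->
  L1near_id mu (fun n (x : mR) => (x + h n : mR)).
Proof.
move=> h0.
have mt n := measurable_translate (h n).
have it n := @ge0_integral_translate (h n).
split => // f mf finf; apply: L1near_closure => // e e0.
have e2 : 0 < e / 2 by rewrite divr_gt0.
have mn (g : mR -> R) : measurable_fun setT g ->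
    measurable_fun setT (fun x => `|g x|%:E : \bar R).
  by move=> mg; apply/measurable_EFinP; exact: measurableT_comp mg.
have mI (M : R) : measurable (`[- M, M]%classic : set mR) by exact: measurable_itv.
have mind (M : R) : measurable_fun [set: mR] (\1_(`[- M, M]%classic) : mR -> R).
  exact: measurable_indic.
have [M M0 fM] : exists2 M : R, 0 < M & 
    (\int[mu]_x `|f x - f x * \1_(`[- M, M]%classic) x|%:E <= (e / 2)%:E)%E.
  have [] := @dominated_convergence _ mR _ mu setT measurableT
    (fun n x => (f x * \1_(`[- n.+1%:R, n.+1%:R]%classic) x)%:E) (EFin \o f) (fun x => `|f x|%:E).
  - by move=> n; apply/measurable_EFinP; exact: measurable_funM.
  - exact/measurable_EFinP.
  - apply: aeW => x _; apply: cvg_near_cst; near=> n.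
    rewrite /= indicE mem_set ?mulr1//= in_itv/= -ler_norml.
    near: n; exists (Num.truncn `|x|) => // n /= xn.
    by rewrite (le_trans (ltW (truncnS_gt _)))// ler_nat.
  - by apply/integrableP; split; [exact: mn|by under eq_integral do rewrite /= normr_id].
  - apply: aeW => x n _; rewrite lee_fin normrM ler_piMr// indicE.
    by case: (_ \in _); rewrite ?normr1 ?normr0.
  move=> _ /cvg0_vanish/(_ _ e2)[n _ /(_ n (leqnn n)) +] _.
  by exists n.+1%:R => //; under eq_integral do rewrite distrC.
have [g0 [cg0 ig0 fg0]] := @approximation_continuous_integrable R `[- M, M]%classic f (mI M)
   ltac:(by rewrite /= lebesgue_measure_itv/=; case: ifP => // _; rewrite -EFinB ltry)
   ltac:(apply/integrableP; split; [exact/measurable_EFinP/measurable_funTS|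
     apply: le_lt_trans finf; apply: ge0_subset_integral => //; exact: mn]).
have /cvg0_vanish/(_ _ e2)[n _ /(_ n (leqnn n))] := fg0.
move: (g0 n) (cg0 n) => {cg0 ig0 fg0}g cg fg.
have mg : measurable_fun [set: mR] g.
  exact: continuous_measurable_fun.
pose g1 : mR -> R := fun x => g x * \1_(`[- M, M]%classic) x.
have mg1 : measurable_fun setT g1 by exact: measurable_funM.
exists g1; split => //.
  have m1 : measurable_fun setT (fun x => f x - f x * \1_(`[- M, M]%classic) x).
    by apply: measurable_funB => //; exact: measurable_funM.
  have m2 : measurable_fun setT (fun x => f x * \1_(`[- M, M]%classic) x - g1 x).
    by apply: measurable_funB => //; exact: measurable_funM.
  apply: (@le_trans _ _ (\int[mu]_x (`|f x - f x * \1_(`[- M, M]%classic) x|%:E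
    + `|f x * \1_(`[- M, M]%classic) x - g1 x|%:E))%E).
    apply: ge0_le_integral_nm => x; first by rewrite lee_fin.
    by rewrite -EFinD lee_fin; exact: ler_distD.
  rewrite ge0_integralD//; [|exact: mn|exact: mn].
  rewrite [e]splitr EFinD leeD//.
  rewrite integral_mkcond in fg; apply: le_trans fg.
  apply: ge0_le_integral_nm => x; first by rewrite lee_fin.
  rewrite patchE /g1 indicE; case: (x \in _); first by rewrite !mulr1.
  by rewrite !mulr0 subr0 normr0.
have [H [H0 hH]] : exists H : R, 0 <= H /\ forall n, `|h n| <= H.
  have /cvg_seq_bounded[H [_ hH]] : cvgn h by apply/cvg_ex; exists 0.
  exists (`|H| + 1); split; first by rewrite addr_ge0.
  move=> k; apply: hH => //.
  by rewrite (le_lt_trans (ler_norm H))// ltrDl.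
have [C C0 gC] : exists2 C : R, 0 <= C & forall x, `|g1 x| <= C.
  have [c _ hc] := EVT_max (ltac:(lra) : - M <= M)
    (ltac:(apply: continuous_subspaceT => x; apply: continuous_comp; [exact: cg|exact: norm_continuous])
       : {within `[- M, M], continuous (fun x => `|g x|)}).
  exists `|g c| => // x; rewrite /g1 indicE; have [/set_mem xM|_] := boolP (x \in _).
    by rewrite mulr1 hc.
  by rewrite mulr0 normr0.
have [] := @dominated_convergence _ mR _ mu setT measurableT
    (fun n x => `|g1 (x + h n) - g1 x|%:E) (cst 0%E)
    (fun x => (2 * C * \1_(`[- (M + H), M + H]%classic) x)%:E).
- move=> k; apply: mn; apply: measurable_funB => //.
  exact: (measurableT_comp mg1 (mt k)).
- exact: measurable_cst.
- exists [set - M; M]; split.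
  + exact: measurableU.
  + by rewrite measureU0//; exact: lebesgue_measure_set1.
  move=> x /= xM; have [->|/eqP xM1] := eqVneq x (- M); first by left.
  have [->|/eqP xM2] := eqVneq x M; first by right.
  exfalso; apply: xM => _.
  apply: vanish_cvg0 => [n0|e1 e10]; first by rewrite lee_fin.
  have small (d : R) : 0 < d -> \forall k \near \oo, `|h k| < d.
    move=> d0; move/cvgrPdist_lt : h0 => /(_ d d0).
    by apply: filterS => k; rewrite sub0r normrN.
  have [xltM|] := ltP `|x| M.
    have /cvgrPdist_lt/(_ _ e10)/nbhs_ballP[d /= d0 hd] := cg x.
    near=> k; rewrite lee_fin /g1 !indicE !mem_set/=.
    + rewrite !mulr1 ltW// distrC; apply: hd => /=.
      rewrite /ball/= opprD addrA subrr sub0r normrN.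
      by near: k; exact: small.
    + by rewrite in_itv/= -ler_norml ltW.
    + rewrite in_itv/= -ler_norml (le_trans (ler_normD _ _))// -lerBrDl ltW//.
      by near: k; apply: small; rewrite subr_gt0.
  rewrite le_eqVlt => /orP[/eqP xM|Mltx].
    have : `|x| == M by rewrite xM.
    by rewrite eqr_norml => /andP[/orP[]/eqP].
  near=> k; rewrite lee_fin /g1 !indicE !memNset/=.
  + by rewrite !mulr0 subr0 normr0 ltW.
  + by rewrite in_itv/= -ler_norml => /(lt_le_trans Mltx); rewrite ltxx.
  + rewrite in_itv/= -ler_norml => xk.
    have : `|h k| < `|x| - M by near: k; apply: small; rewrite subr_gt0.
    have := ler_normB (x + h k) (h k); rewrite addrK; lra.
- have := @integrable_indic_itv R (- (M + H)) (M + H) true false.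
  move=> /(@integrableZl _ _ _ mu setT measurableT (2 * C)).
  by apply: eq_integrable => // x _; rewrite /= EFinM.
- apply: aeW => x n0 _; rewrite gee0_abs; last by rewrite lee_fin.
  rewrite lee_fin indicE.
  have [xI|/negP xI] := boolP (x \in _).
    rewrite mulr1 (le_trans (ler_normB _ _))//.
    by have := gC (x + h n0); have := gC x; lra.
  rewrite mulr0 /g1 !indicE !memNset ?mulr0 ?subr0 ?normr0//=.
  + move=> xM; apply: xI; rewrite inE/=; move: xM; rewrite !in_itv/=; lra.
  + move=> xM; apply: xI; rewrite inE/=; move: xM; rewrite !in_itv/= => /andP[].
    by have := hH n0; rewrite ler_norml => /andP[]; lra.
move=> _ /cvg0_vanish + _; apply: le_vanish; near=> k.
apply: ge0_le_integral_nm => x; first by rewrite lee_fin.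
by rewrite [cst _ _]/(0%E) sube0 lee_abs.
Unshelve. all: by end_near. Qed.

End L1_R.

Section L1_xt.
Context (R : realType).

Lemma L1near_id_lebR (h : nat -> R) : h @ \oo --> 0 ->
  L1near_id (@lebR R) (fun n x => x + h n).
Proof.
move=> h0; refine (@L1near_id_pushforward _ _ (measurableTypeR R) R R lebesgue_measure
  (@lebR R) _ _ _ (@measurable_idR R) _ _ _ (L1near_id_R h0)) => //.
by move=> n; exact: measurable_funD.
Qed.

Lemma measurable_translate_rV n (h : 'rV[R]_n) :
  measurable_fun [set: 'rV[R]_n] (fun x => x + h).
Proof.
apply: measurable_fun_matrix => i j.
rewrite (_ : (fun x : 'rV[R]_n => _) = (fun x : 'rV[R]_n => x i j + h i j)); last first.
  by apply/funext => x; rewrite mxE.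
by apply: measurable_funD => //; exact: measurable_coord.
Qed.

Lemma L1near_id_rV n (h : nat -> 'rV[R]_n) :
  (forall i, (fun k => h k 0 i) @ \oo --> 0) ->
  L1near_id (lebesgue_rV n) (fun k x => x + h k).
Proof.
elim: n h => [|n IH] h h0.
  have E k (x : 'rV[R]_0) : x + h k = x by rewrite (thinmx0 (x + h k)) -(thinmx0 x).
  split => [k|k f _ _|f _ _ e e0].
  - exact: measurable_translate_rV.
  - by under eq_integral do rewrite E.
  - near=> k; under eq_integral do rewrite E subrr normr0.
    by rewrite integral0 lee_fin ltW.
have h1 := L1near_id_R (h0 0).
have h2 : forall i, (fun k => rsubmx (h k : 'rV[R]_(1 + n)) 0 i) @ \oo --> 0.
  move=> i; have := h0 (rshift 1 i : 'I_n.+1); apply: cvg_trans.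
  by apply: near_eq_cvg; near=> k; rewrite mxE.
have h3 := L1near_id_prod h1 (IH _ h2).
apply: (L1near_id_pushforward (@measurable_consrV R n) _ _ _ h3) => //.
- by move=> k; exact: measurable_translate_rV.
- move=> k [s x]; apply: (can_inj (@unconsrVK R n)); rewrite consrVK /unconsrV /=.
  congr pair; first by rewrite mxE consrV0.
  apply/rowP => i; rewrite [LHS]mxE [RHS]mxE [RHS]mxE [X in _ + X = _]mxE.
  by congr (_ + _); exact/esym/(consrVS (s, x)).
Unshelve. all: by end_near. Qed.

Lemma L1near_id_xt N (h : nat -> 'rV[R]_N * R) :
  (forall i, (fun k => (h k).1 0 i) @ \oo --> 0) ->
  (fun k => (h k).2) @ \oo --> 0 ->
  L1near_id (@lebesgue_xt R N) (fun k z => z + h k).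
Proof. by move=> h1 h2; exact: (L1near_id_prod (L1near_id_rV h1) (L1near_id_lebR h2)). Qed.

(** A counterexample to uniform smallness would give a sequence of translations
tending to 0 along which the L^1 distance does not vanish. *)
Lemma L1_translate_small N (f : 'rV[R]_N * R -> R) : measurable_fun setT f ->
  (\int[lebesgue_xt]_z `|f z|%:E < +oo)%E -> forall e : R, 0 < e ->
  exists2 dl : R, 0 < dl & forall h : 'rV[R]_N * R,
    (forall i, `|h.1 0 i| <= dl) -> `|h.2| <= dl ->
    (\int[lebesgue_xt]_z `|f (z + h) - f z|%:E <= e%:E)%E.
Proof.
move=> mf fi e e0; apply: contrapT => /forall2NP H.
have {}H n : exists h : 'rV[R]_N * R, [/\ forall i, `|h.1 0 i| <= n.+1%:R^-1,
    `|h.2| <= n.+1%:R^-1 &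
    ~ (\int[lebesgue_xt]_z `|f (z + h) - f z|%:E <= e%:E)%E].
  have [|] := H n.+1%:R^-1; first by move=> /(_ ltac:(by rewrite invr_gt0)).
  move=> /existsNP[h /not_implyP[h1 /not_implyP[h2 h3]]]; by exists h.
have [h hP] := choice H.
have to0 (u : nat -> R) : (forall n, `|u n| <= n.+1%:R^-1) -> u @ \oo --> 0.
  move=> u0; apply: norm_cvg0; apply: (@squeeze_cvgr _ _ _ _ (cst 0) (fun n => n.+1%:R^-1)).
  - by near=> n; rewrite normr_ge0 u0.
  - exact: cvg_cst.
  - exact: cvg_harmonic.
have [||_ _ /(_ f mf fi e e0)[n _ /(_ n (leqnn n))]] := @L1near_id_xt N h.
- by move=> i; apply: to0 => n; have [] := hP n.
- by apply: to0 => n; have [] := hP n.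
by have [_ _] := hP n.
Unshelve. all: by end_near. Qed.

(** Translation invariance is part of [L1near_id]; any vector is the first term of a
sequence tending to 0. *)
Lemma ge0_integral_xt_translate N (h : 'rV[R]_N * R) (f : 'rV[R]_N * R -> \bar R) :
  measurable_fun setT f -> (forall z, 0 <= f z)%E ->
  (\int[lebesgue_xt]_z f (z + h)%R = \int[lebesgue_xt]_z f z)%E.
Proof.
(* Only the first term of the sequence matters. *)
pose hh n : 'rV[R]_N * R := if n is 0%N then h else 0.
have c0 (u : 'rV[R]_N * R -> R) : u 0 = 0 -> (fun k => u (hh k)) @ \oo --> (0 : R).
  move=> u0; apply: cvg_near_cst; near=> n; rewrite /hh.
  by have /prednK <- : (0 < n)%N by near: n; exact: nbhs_infty_gt.
have [] := @L1near_id_xt N hh _ _.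
- by move=> i; apply: (c0 (fun z => z.1 0 i)); rewrite mxE.
- exact: (c0 (fun z => z.2)).
by move=> _ /(_ 0%N f) + _; exact.
Unshelve. all: by end_near. Qed.

End L1_xt.

(** * Topology and measurability on space-time *)

Section diff_remainder.
Context (R : realType) (V : normedModType R).

(** A quadratic bound for the remainder spares all little-o computations. *)
Lemma is_diff_sqr_remainder (f L : V -> R) (x : V) (C d : R) :
  (forall a u v, L (a *: u + v) = a * L u + L v) ->
  (forall h, `|L h| <= C * `|h|) -> 0 < d ->
  (forall h, `|h| < d -> `|f (h + x) - f x - L h| <= C * `|h| ^+ 2) ->
  is_diff x f L.
Proof.
move=> linL bL d0 H.
pose l : {linear V -> R} := HB.pack L (GRing.isLinear.Build R V R _ L linL).
have C1 : 0 < `|C| + 1 by have := normr_ge0 C; lra.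
have C1C : C <= `|C| + 1 by have := ler_norm C; lra.
have cl : continuous l.
  move=> y; apply/cvgrPdist_le => e e0; near=> z.
  rewrite -linearB/= (le_trans (bL _))//.
  rewrite (@le_trans _ _ ((`|C| + 1) * `|y - z|))// ?ler_wpM2r//.
  rewrite mulrC -ler_pdivlMr//; near: z.
  by apply: cvgr_dist_le => //; rewrite divr_gt0.
have E : f \o shift x = cst (f x) + l +o_ 0 id.
  apply/eqaddoP => _/posnumP[e]; near=> h.
  have hd : `|h| < d by near: h; exact: nbhs0_lt.
  rewrite !fctE /= opprD addrA (le_trans (H _ hd))// expr2 mulrA ler_wpM2r//.
  rewrite (@le_trans _ _ ((`|C| + 1) * `|h|))// ?ler_wpM2r//.
  by rewrite mulrC -ler_pdivlMr//; near: h; apply: nbhs0_le; rewrite divr_gt0.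
have D : 'd f x = l :> (V -> R) by exact: diff_unique.
by apply: DiffDef => //; apply/diff_locallyP; rewrite D.
Unshelve. all: by end_near. Qed.

Lemma continuous_lip (f : V -> R) (x : V) (C d : R) : 0 < d ->
  (forall h, `|h| < d -> `|f (h + x) - f x| <= C * `|h|) -> {for x, continuous f}.
Proof.
move=> d0 H.
have C1 : 0 < `|C| + 1 by have := normr_ge0 C; lra.
have C1C : C <= `|C| + 1 by have := ler_norm C; lra.
apply/cvgrPdist_le => e e0; near=> y.
have yd : `|y - x| < d by rewrite distrC; near: y; exact: cvgr_dist_lt.
have := H _ yd; rewrite subrK distrC => /le_trans; apply.
rewrite (@le_trans _ _ ((`|C| + 1) * `|y - x|))// ?ler_wpM2r//.
rewrite mulrC -ler_pdivlMr// distrC; near: y.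
by apply: cvgr_dist_le => //; rewrite divr_gt0.
Unshelve. all: by end_near. Qed.

End diff_remainder.

Section spacetime_topology.
Context (R : realType) (N : nat).
Local Notation V := ('rV[R]_N * R)%type.

Lemma ler_coord_rV (x : 'rV[R]_N) i : `|x 0 i| <= `|x|.
Proof.
by rewrite [leRHS]/Num.norm /= mx_normrE; apply/bigmax_geP; right => /=; exists (0, i).
Qed.

Lemma ler_coord1 (z : V) i : `|z.1 0 i| <= `|z|.
Proof. by rewrite (le_trans (ler_coord_rV z.1 i))// prod_normE le_max lexx. Qed.

Lemma ler_coord2 (z : V) : `|z.2| <= `|z|.
Proof. by rewrite prod_normE le_max lexx orbT. Qed.

Lemma ltr_norm_xt (z : V) d : 0 < d -> (forall i, `|z.1 0 i| < d) -> `|z.2| < d ->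
  `|z| < d.
Proof.
move=> d0 z1 z2; rewrite prod_normE gt_max z2 andbT.
by rewrite [ltLHS]/Num.norm /= mx_normrE; apply/bigmax_ltP; split => //= -[i j] _; rewrite (ord1 i).
Qed.

Lemma ler_norm_xt (z : V) d : 0 <= d -> (forall i, `|z.1 0 i| <= d) -> `|z.2| <= d ->
  `|z| <= d.
Proof.
move=> d0 z1 z2; rewrite prod_normE ge_max z2 andbT.
by rewrite [leLHS]/Num.norm /= mx_normrE; apply/bigmax_leP; split => //= -[i j] _; rewrite (ord1 i).
Qed.

Lemma measurable_coord1 i : measurable_fun setT (fun z : V => z.1 0 i).
Proof. exact: measurableT_comp (measurable_coord _ _) measurable_fst. Qed.

Lemma measurable_coord2 : measurable_fun setT (fun z : V => z.2).
Proof. exact: measurable_snd. Qed.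

Lemma measurable_ball_xt (a : V) (r : R) : measurable [set z : V | `|z - a| < r].
Proof.
have [r0|r0] := leP r 0.
  rewrite (_ : mkset _ = set0)//; apply/seteqP; split => // z /= zr.
  by have := normr_ge0 (z - a); lra.
rewrite (_ : mkset _ = (\bigcap_(i in [set: 'I_N]) [set z : V | `|z.1 0 i - a.1 0 i| < r])
   `&` [set z | `|z.2 - a.2| < r]); last first.
  apply/seteqP; split => [z /= zr|z /= [z1 z2]].
    split => [i _ /=|].
      by rewrite (le_lt_trans _ zr)//; have := ler_coord1 (z - a) i; rewrite !mxE.
    by rewrite (le_lt_trans _ zr)//; exact: (ler_coord2 (z - a)).
  by apply: ltr_norm_xt => // i; have := z1 i Logic.I; rewrite /= !mxE.
have mlt (g : V -> R) : measurable_fun setT g -> measurable [set z | `|g z| < r].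
  move=> mg; rewrite -[X in measurable X]setTI.
  rewrite (_ : [set z | _] = (fun z => `|g z|) @^-1` `]-oo, r[%classic); last first.
    by apply/seteqP; split => z; rewrite /preimage/= in_itv.
  by apply: (measurableT_comp _ mg) => //.
apply: measurableI.
  apply: fin_bigcap_measurable => // i _; apply: (mlt (fun z => z.1 0 i - a.1 0 i)).
  by apply: measurable_funB => //; exact: measurable_coord1.
by apply: (mlt (fun z => z.2 - a.2)); apply: measurable_funB.
Qed.

(** The sigma-algebra is generated by the coordinates, so an open set has to be
written as a countable union of balls with rational data. *)
Lemma measurable_open_xt (O : set V) : open O -> measurable O.
Proof.
move=> oO.
pose q (p : 'rV[rat]_N * rat * nat) : V := (map_mx ratr p.1.1, ratr p.1.2).
pose B p : set V := if `[< [set z | `|z - q p| < p.2.+1%:R^-1] `<=` O >]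
  then [set z | `|z - q p| < p.2.+1%:R^-1] else set0.
rewrite (_ : O = \bigcup_p B p).
  apply: countable_bigcupT_measurable => // p; rewrite /B; case: asboolP => // _.
  exact: measurable_ball_xt.
apply/seteqP; split => [z Oz|z [p _]]; last first.
  by rewrite /B; case: asboolP => // pO; exact: pO.
have /nbhs_ballP[e /= e0 eO] : nbhs z O by exact: open_nbhs_nbhs.
have [k ke] : exists k : nat, k.+1%:R^-1 < e / 2.
  exists (Num.truncn (e / 2)^-1).
  by rewrite invf_plt ?posrE ?divr_gt0// truncnS_gt.
have rk (x : R) : exists r : rat, `|x - ratr r| < k.+1%:R^-1.
  have /rat_in_itvoo[r] : x - k.+1%:R^-1 < x + k.+1%:R^-1.
    by rewrite ltrBlDr -addrA ltrDl addr_gt0 ?invr_gt0.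
  rewrite in_itv /= => /andP[r1 r2]; exists r.
  by rewrite distrC ltr_distl r1 r2.
have [r1 r1P] := choice (fun i => rk (z.1 0 i)).
have [r2 r2P] := rk z.2.
pose p : 'rV[rat]_N * rat * nat := ((\row_i r1 i, r2), k).
have zp : `|z - q p| < k.+1%:R^-1.
  by apply: ltr_norm_xt => // i; rewrite !mxE.
exists p => //; rewrite /B; case: asboolP => // -[] y /= yp.
apply: eO; rewrite -ball_normE /=.
rewrite (le_lt_trans (ler_distD (q p) z y))// (distrC (q p)) [e]splitr.
by rewrite ltrD// (lt_trans _ ke).
Qed.

Lemma measurable_closed_xt (O : set V) : closed O -> measurable O.
Proof.
move=> cO; rewrite -(setCK O); apply: measurableC; apply: measurable_open_xt.
exact: closed_openC.
Qed.

Lemma continuous_measurable_xt (f : V -> R) : continuous f -> measurable_fun setT f.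
Proof.
move=> /continuousP cf; apply: (measurability _ (RGenOpens.measurableE R)).
move=> _ [_ [a [b ->] <-]]; rewrite setTI; apply: measurable_open_xt.
exact/cf/interval_open.
Qed.

Definition closed_box (M : R) : set V := [set z | `|z| <= M].

Lemma closed_box_compact M : compact (closed_box M).
Proof.
have -> : closed_box M = [set x : 'rV[R]_N | `|x| <= M] `*` `[- M, M]%classic.
  apply/seteqP; split => -[x t] /=; rewrite /closed_box/= prod_normE/= ge_max in_itv/= -ler_norml.
    by move=> /andP.
  by move=> [-> ->].
apply: compact_setX; last exact: segment_compact.
apply: bounded_closed_compact.
  exists M; split; first exact: num_real.
  by move=> M' MM' x /= xM; rewrite (le_trans xM)// ltW.
rewrite (_ : mkset _ = (fun x : 'rV[R]_N => `|x|) @^-1` [set t | t <= M])//.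
by apply: preimage_closed => [x _|]; [exact: norm_continuous|exact: closed_le].
Qed.

End spacetime_topology.

(** * Coordinates and the regularizing kernel *)

Section coords.
Context (R : realType) (N : nat).
Local Notation V := ('rV[R]_N * R)%type.

(** Index [None] stands for the time coordinate, [Some i] for a space coordinate. *)
Definition xt_coord (k : option 'I_N) (z : V) : R := if k is Some i then z.1 0 i else z.2.
Definition xt_dir (k : option 'I_N) : V := if k is Some i then dir_x i else dir_t.

Lemma xt_coordD k a b : xt_coord k (a + b) = xt_coord k a + xt_coord k b.
Proof. by case: k => [i|] //=; rewrite mxE. Qed.
Lemma xt_coordN k a : xt_coord k (- a) = - xt_coord k a.
Proof. by case: k => [i|] //=; rewrite mxE. Qed.
Lemma xt_coordZ k c a : xt_coord k (c *: a) = c * xt_coord k a.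
Proof. by case: k => [i|] //=; rewrite mxE. Qed.
Lemma xt_coord_dir k j : xt_coord k (xt_dir j) = (k == j)%:R.
Proof.
case: k j => [i|] [j|] //=; rewrite ?mxE ?eqxx//=.
Qed.
Lemma ler_xt_coord k z : `|xt_coord k z| <= `|z|.
Proof. by case: k => [i|]; [exact: ler_coord1|exact: ler_coord2]. Qed.
Lemma ler_norm_xt_coord (z : V) d : 0 <= d -> (forall k, `|xt_coord k z| <= d) -> `|z| <= d.
Proof. by move=> d0 H; apply: ler_norm_xt => // [i|]; [exact: (H (Some i))|exact: (H None)]. Qed.
Lemma measurable_xt_coord k : measurable_fun setT (xt_coord k).
Proof. by case: k => [i|]; [exact: measurable_coord1|exact: measurable_coord2]. Qed.

Lemma measurable_fun_xt d (T : measurableType d) (f : T -> V) :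
  (forall k, measurable_fun setT (fun x => xt_coord k (f x))) -> measurable_fun setT f.
Proof.
move=> mf; apply/measurable_fun_pairP; split; last exact: (mf None).
by apply: measurable_fun_matrix => i j; rewrite (ord1 i); exact: (mf (Some j)).
Qed.

Definition lincomb (c : option 'I_N -> R) (v : V) : R := \sum_k xt_coord k v * c k.

Lemma lincomb_linear c a u v : lincomb c (a *: u + v) = a * lincomb c u + lincomb c v.
Proof.
rewrite /lincomb mulr_sumr -big_split/=; apply: eq_bigr => k _.
by rewrite xt_coordD xt_coordZ mulrDl mulrA.
Qed.

Lemma lincomb_dir c k : lincomb c (xt_dir k) = c k.
Proof.
rewrite /lincomb (bigD1 k)//= xt_coord_dir eqxx mul1r big1 ?addr0// => j jk.
by rewrite xt_coord_dir (negbTE jk) mul0r.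
Qed.

Lemma lincomb_bound c v : `|lincomb c v| <= (\sum_k `|c k|) * `|v|.
Proof.
rewrite /lincomb (le_trans (ler_norm_sum _ _ _))// mulr_suml ler_sum// => k _.
by rewrite normrM mulrC ler_wpM2l// ler_xt_coord.
Qed.

Definition sqnorm (z : V) : R := \sum_k xt_coord k z ^+ 2.
Definition xt_dim : R := #|{: option 'I_N}|%:R.

Lemma xt_dim_ge1 : 1 <= xt_dim.
Proof. by rewrite ler1n card_option. Qed.

Lemma sqnorm_ge0 z : 0 <= sqnorm z.
Proof. by apply: sumr_ge0 => k _; exact: sqr_ge0. Qed.

Lemma sqnorm_le z : sqnorm z <= xt_dim * `|z| ^+ 2.
Proof.
rewrite /xt_dim -sum1_card natr_sum mulr_suml ler_sum// => k _.
by rewrite mul1r -real_normK ?num_real// lerXn2r// ?nnegrE// ler_xt_coord.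
Qed.

Lemma xt_coord_sqnorm k z : xt_coord k z ^+ 2 <= sqnorm z.
Proof.
by rewrite /sqnorm (bigD1 k)//= lerDl; apply: sumr_ge0 => j _; exact: sqr_ge0.
Qed.

Lemma sqnormD a h : sqnorm (h + a) = sqnorm a + 2 * lincomb (xt_coord^~ a) h + sqnorm h.
Proof.
rewrite /sqnorm /lincomb mulr_sumr -!big_split/=; apply: eq_bigr => k _.
by rewrite xt_coordD; ring.
Qed.

Lemma sqnormD_bound (a h : V) M : `|a| <= M -> `|h| <= 1 ->
  `|sqnorm (h + a) - sqnorm a| <= xt_dim * (2 * M + 1) * `|h|.
Proof.
move=> aM h1; rewrite sqnormD (_ : _ + _ + _ - _ = 2 * lincomb (xt_coord^~ a) h + sqnorm h); last ring.
rewrite (le_trans (ler_normD _ _))// normrM (ger0_norm (sqnorm_ge0 h)) ger0_norm//.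
have n1 := xt_dim_ge1.
have hh : sqnorm h <= xt_dim * `|h|.
  rewrite (le_trans (sqnorm_le h))// ler_wpM2l ?(le_trans ler01)//.
  by rewrite expr2 ler_piMl.
have : `|lincomb (xt_coord^~ a) h| <= xt_dim * M * `|h|.
  rewrite (le_trans (lincomb_bound _ _))// ler_wpM2r//.
  rewrite /xt_dim -sum1_card natr_sum mulr_suml ler_sum// => k _.
  by rewrite mul1r (le_trans (ler_xt_coord _ _)).
move: hh; move: (lincomb _ _) (sqnorm h) => A B; rewrite (_ : xt_dim * (2 * M + 1) * `|h| = 2 * (xt_dim * M * `|h|) + xt_dim * `|h|); last ring.
lra.
Qed.

Lemma measurable_sqnorm : measurable_fun setT sqnorm.
Proof.
apply: measurable_sum => k; apply: measurable_funX; exact: measurable_xt_coord.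
Qed.

Definition pos_part (s : R) : R := Num.max s 0.

Lemma pos_ge0 s : 0 <= pos_part s. Proof. by rewrite /pos_part le_max lexx orbT. Qed.

Lemma pos_lip s k : `|pos_part (s + k) - pos_part s| <= `|k|.
Proof.
by rewrite /pos_part; case: (leP (s + k) 0); case: (leP s 0);
  case: (ger0P k) => *; rewrite ler_norml; apply/andP; split; lra.
Qed.

Lemma pos_sqr s k : `|pos_part (s + k) ^+ 2 - pos_part s ^+ 2 - 2 * pos_part s * k| <= k ^+ 2.
Proof.
by rewrite /pos_part; case: (leP (s + k) 0); case: (leP s 0) => *;
  rewrite ler_norml; apply/andP; split; nra.
Qed.

(** The kernel (d^2 - |z|^2)_+^2 is C^1 with explicit uniform Taylor remainders,
so that convolutions can be differentiated without dominated convergence. *)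
Definition kern (d : R) (z : V) : R := pos_part (d ^+ 2 - sqnorm z) ^+ 2.
Definition dkern (d : R) (k : option 'I_N) (z : V) : R :=
  - 4 * pos_part (d ^+ 2 - sqnorm z) * xt_coord k z.

Lemma pos_kern_le d z : pos_part (d ^+ 2 - sqnorm z) <= d ^+ 2.
Proof. by rewrite /pos_part ge_max sqr_ge0 andbT; have := sqnorm_ge0 z; lra. Qed.

Lemma kern_ge0 d z : 0 <= kern d z. Proof. exact: sqr_ge0. Qed.

Lemma kern_le d z : kern d z <= d ^+ 4.
Proof.
rewrite /kern (_ : 4 = 2 * 2)%N// exprM lerXn2r ?nnegrE ?pos_ge0 ?sqr_ge0//.
exact: pos_kern_le.
Qed.

Lemma kern_supp d z : 0 <= d -> kern d z != 0 -> `|z| <= d.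
Proof.
move=> d0 bz; apply: ler_norm_xt_coord => // k.
rewrite -ler_sqr ?nnegrE// real_normK ?num_real//.
rewrite (le_trans (xt_coord_sqnorm k z))// leNgt; apply: contra bz => h.
by rewrite /kern /pos_part max_r ?expr0n// subr_le0 ltW.
Qed.

Lemma measurable_pos_kern d : measurable_fun setT (fun z => pos_part (d ^+ 2 - sqnorm z)).
Proof.
apply: measurable_maxr => //; apply: measurable_funB => //; exact: measurable_sqnorm.
Qed.

Lemma measurable_kern d : measurable_fun setT (kern d).
Proof. apply: measurable_funX; exact: measurable_pos_kern. Qed.

Lemma measurable_dkern d k : measurable_fun setT (dkern d k).
Proof.
apply: measurable_funM; last exact: measurable_xt_coord.
by apply: measurable_funM => //; exact: measurable_pos_kern.
Qed.

Lemma dkern_bound d k z M : `|z| <= M -> `|dkern d k z| <= 4 * d ^+ 2 * M.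
Proof.
move=> zM; rewrite /dkern (_ : _ * _ = - (4 * (pos_part (d ^+ 2 - sqnorm z) * xt_coord k z))); last ring.
rewrite normrN normrM (ger0_norm (ler0n _ 4)) -mulrA ler_wpM2l// normrM.
rewrite ler_pM//; last exact: le_trans (ler_xt_coord _ _) zM.
by rewrite (ger0_norm (pos_ge0 _)) pos_kern_le.
Qed.

Lemma dkern_lip d k a h M : `|a| <= M -> `|h| <= 1 ->
  `|dkern d k (h + a) - dkern d k a| <=
    4 * (xt_dim * (2 * M + 1) * (M + 1) + d ^+ 2) * `|h|.
Proof.
move=> aM h1; have M0 : 0 <= M by rewrite (le_trans _ aM).
rewrite /dkern xt_coordD.
set s := d ^+ 2 - sqnorm a; set s' := d ^+ 2 - sqnorm (h + a).
have : `|pos_part s' - pos_part s| <= xt_dim * (2 * M + 1) * `|h|.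
  rewrite (le_trans _ (sqnormD_bound aM h1))//.
  have := pos_lip s (s' - s); rewrite (addrC s) subrK => /le_trans; apply.
  rewrite (_ : s' - s = sqnorm a - sqnorm (h + a)); first by rewrite distrC.
  by rewrite /s /s'; ring.
have ca : `|xt_coord k a| <= M by rewrite (le_trans (ler_xt_coord _ _)).
have ch := ler_xt_coord k h.
have p0 := pos_ge0 s; have pd : pos_part s <= d ^+ 2 := pos_kern_le d a.
have p0' := pos_ge0 s'.
move=> H; rewrite (_ : _ - _ = - (4 * ((pos_part s' - pos_part s) * (xt_coord k h + xt_coord k a) + pos_part s * xt_coord k h))); last ring.
rewrite normrN normrM (ger0_norm (ler0n _ 4)) -mulrA ler_wpM2l// [leRHS]mulrDl (le_trans (ler_normD _ _))// lerD//.
  rewrite normrM mulrAC ler_pM// (le_trans (ler_normD _ _))// addrC lerD//.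
  by rewrite (le_trans ch).
by rewrite normrM ler_pM// ger0_norm.
Qed.

(** The composition of (.)_+^2 and z |-> d^2 - |z|^2, each with a quadratic remainder. *)
Lemma kern_remainder d a h M : `|a| <= M -> `|h| <= 1 ->
  `|kern d (h + a) - kern d a - lincomb (dkern d ^~ a) h| <=
    ((xt_dim * (2 * M + 1)) ^+ 2 + 2 * d ^+ 2 * xt_dim) * `|h| ^+ 2.
Proof.
move=> aM h1; rewrite /kern.
set s := d ^+ 2 - sqnorm a; set s' := d ^+ 2 - sqnorm (h + a).
have sk : s' = s + (sqnorm a - sqnorm (h + a)) by rewrite /s /s'; ring.
have -> : lincomb (dkern d ^~ a) h = - 4 * pos_part s * lincomb (xt_coord^~ a) h.
  by rewrite /lincomb mulr_sumr; apply: eq_bigr => k _; rewrite /dkern -/s; ring.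
rewrite (_ : _ - _ = (pos_part s' ^+ 2 - pos_part s ^+ 2 - 2 * pos_part s * (s' - s)) - 2 * pos_part s * sqnorm h); last first.
  by rewrite sk sqnormD; ring.
rewrite (le_trans (ler_normB _ _))// [leRHS]mulrDl lerD//.
  have := pos_sqr s (s' - s); rewrite (addrC s) subrK => /le_trans; apply.
  rewrite -exprMn -real_normK ?num_real// lerXn2r ?nnegrE//.
    have M0 : 0 <= M := le_trans (normr_ge0 _) aM.
    have n1 := xt_dim_ge1; apply: mulr_ge0 => //; apply: mulr_ge0; lra.
  by rewrite distrC (le_trans _ (sqnormD_bound aM h1))// sk opprD addrA subrr sub0r opprB.
rewrite !normrM ger0_norm// (ger0_norm (pos_ge0 _)) (ger0_norm (sqnorm_ge0 _)).
rewrite -(mulrA 2 (pos_part s)) -(mulrA (2 * d ^+ 2)) -(mulrA 2 (d ^+ 2)) ler_wpM2l//.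
by apply: ler_pM; rewrite ?pos_ge0 ?sqnorm_ge0 ?sqnorm_le ?pos_kern_le.
Qed.

End coords.
Arguments xt_dir {R N} k.
Arguments kern {R N} d z.
Arguments dkern {R N} d k z.
Arguments lincomb {R N} c v.
Arguments sqnorm {R N} z.
Arguments xt_coord {R N} k z.

(** * Functions with a continuous gradient, boxes *)

Section hasgrad.
Context (R : realType) (N : nat).
Local Notation V := ('rV[R]_N * R)%type.
Implicit Types (F : V -> R) (G : V -> option 'I_N -> R).

(** C^1 regularity with named partial derivatives: the differential at [z] is the
linear form with coefficients [G z]. *)
Definition hasgrad F G := (forall z, is_diff z F (lincomb (G z))) /\
  (forall k, continuous (G^~ k)).

Lemma hasgrad_derive F G z v : hasgrad F G -> 'D_v F z = lincomb (G z) v.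
Proof.
move=> [dF _]; rewrite deriveE; last by have [] := dF z.
by have [_ ->] := dF z.
Qed.

Lemma hasgrad_dir F G z k : hasgrad F G -> 'D_(xt_dir k) F z = G z k.
Proof. by move=> FG; rewrite (hasgrad_derive _ _ FG) lincomb_dir. Qed.

Lemma hasgrad_continuous F G : hasgrad F G -> continuous F.
Proof. by move=> [dF _] z; apply: differentiable_continuous; have [] := dF z. Qed.

Lemma hasgrad_C1 F G : hasgrad F G -> C1 F.
Proof.
move=> FG; split; first by move=> z; have [/(_ z) []] := FG.
move=> v; rewrite (_ : 'D_v F = fun z => lincomb (G z) v); last first.
  by apply/funext => z; exact: hasgrad_derive.
have [_ cG] := FG; move=> z.
move: z; apply: (@continuous_big _ _ _ _ _ _ _ _ (fun k z => xt_coord k v * G z k)).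
  exact: add_continuous.
by move=> k _ z; apply: cvgMl_tmp; exact: cG.
Qed.

Lemma hasgradM F1 G1 F2 G2 : hasgrad F1 G1 -> hasgrad F2 G2 ->
  hasgrad (fun z => F1 z * F2 z) (fun z k => F1 z * G2 z k + F2 z * G1 z k).
Proof.
move=> h1 h2; have c1 := hasgrad_continuous h1; have c2 := hasgrad_continuous h2.
have [[d1 g1] [d2 g2]] := (h1, h2); split => [z|k z].
  have := @is_diffM _ _ _ _ _ _ _ (d1 z) (d2 z).
  have -> // : F1 z *: lincomb (G2 z) + F2 z *: lincomb (G1 z) =
    lincomb (fun k => F1 z * G2 z k + F2 z * G1 z k).
  apply/funext => v; rewrite -[LHS]/(F1 z * lincomb (G2 z) v + F2 z * lincomb (G1 z) v).
  rewrite /lincomb !mulr_sumr -big_split/=.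
  by apply: eq_bigr => k _; ring.
by apply: cvgD; apply: cvgM; [exact: c1|exact: g2|exact: c2|exact: g1].
Qed.

Lemma hasgrad_comp F G (g dg : R -> R) : hasgrad F G ->
  (forall z, is_derive (F z) 1 g (dg (F z))) ->
  (forall z, {for F z, continuous dg}) ->
  hasgrad (fun z => g (F z)) (fun z k => dg (F z) * G z k).
Proof.
move=> h hg cg; have c := hasgrad_continuous h; have [d gc] := h; split => [z|k z].
  have dgz : is_diff (F z) g ( *:%R^~ (dg (F z))).
    have [e1 e2] := hg z; split; first exact/derivable1_diffP.
    by rewrite deriv1E// derive1E e2.
  have := @is_diff_comp _ _ _ _ _ _ _ _ _ (d z) dgz.
  have -> // : *:%R^~ (dg (F z)) \o lincomb (G z) = lincomb (fun k => dg (F z) * G z k).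
  apply/funext => v; rewrite -[LHS]/(lincomb (G z) v * dg (F z)) /lincomb mulr_suml.
  by apply: eq_bigr => k _; ring.
by apply: cvgM; [apply: continuous_comp; [exact: c|exact: cg]|exact: gc].
Qed.

Lemma hasgrad_kern d a : hasgrad (fun y => kern d (y - a)) (fun y k => dkern d k (y - a)).
Proof.
split => [z|k z].
  pose A := \sum_k `|dkern d k (z - a)|.
  pose B := (xt_dim R N * (2 * `|z - a| + 1)) ^+ 2 + 2 * d ^+ 2 * xt_dim R N.
  have A0 : 0 <= A by apply: sumr_ge0.
  have n0 : 0 <= xt_dim R N by rewrite (le_trans ler01)// xt_dim_ge1.
  have B0 : 0 <= B by rewrite addr_ge0 ?sqr_ge0// mulr_ge0// mulr_ge0// sqr_ge0.
  apply: (@is_diff_sqr_remainder _ _ _ _ _ (A + B) 1) => //.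
  - exact: lincomb_linear.
  - by move=> h; rewrite (le_trans (lincomb_bound _ _))// ler_wpM2r// lerDl.
  - move=> h h1; have := kern_remainder d (lexx `|z - a|) (ltW h1).
    by rewrite addrA => /le_trans; apply; rewrite ler_wpM2r ?sqr_ge0// lerDr.
apply: (@continuous_lip _ _ _ _ _ 1) => // h h1.
by have := dkern_lip d k (lexx `|z - a|) (ltW h1); rewrite addrA; exact.
Qed.

Lemma measurable_subr_xt (a : V) : measurable_fun setT (fun y : V => y - a).
Proof.
apply: measurable_fun_xt => k.
rewrite (_ : (fun y : V => _) = (fun y => xt_coord k y - xt_coord k a)); last first.
  by apply/funext => y; rewrite xt_coordD xt_coordN.
by apply: measurable_funB => //; exact: measurable_xt_coord.
Qed.

End hasgrad.

Section box_measure.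
Context (R : realType) (N : nat).
Local Notation V := ('rV[R]_N * R)%type.

Lemma lebR_itv (a b : R) : a <= b -> lebR `]a, b]%classic = (b - a)%:E.
Proof.
move=> ab; rewrite /lebR lebesgue_measure_itv/= lte_fin; move: ab.
by rewrite le_eqVlt => /orP[/eqP ->|->]; rewrite ?ltxx ?subrr// EFinB.
Qed.

Lemma measurable_box_rV (a b : 'rV[R]_N) :
  measurable [set x : 'rV[R]_N | forall i, a 0 i < x 0 i <= b 0 i].
Proof.
rewrite (_ : mkset _ = \bigcap_(i in [set: 'I_N]) [set x : 'rV[R]_N |
    a 0 i < x 0 i <= b 0 i]); last first.
  by apply/seteqP; split => [x xab i _|x xab i]; [exact: xab|exact: (xab i)].
apply: fin_bigcap_measurable => // i _.
rewrite -[X in measurable X]setTI.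
rewrite (_ : [set x : 'rV[R]_N | _] = (fun x : 'rV[R]_N => x 0 i) @^-1`
    `]a 0 i, b 0 i]%classic).
  exact: measurable_coord.
by apply/funext => x; rewrite /preimage /mkset /= in_itv.
Qed.

Definition half_open_box (r : R) : set 'rV[R]_N := [set x | forall i, - r < x 0 i <= r].

Lemma measurable_half_open_box r : measurable (half_open_box r).
Proof.
have := @measurable_box_rV (\row_i (- r)) (\row_i r).
by rewrite (_ : mkset _ = half_open_box r)//; apply/seteqP; split => x H i; have := H i; rewrite !mxE.
Qed.

Lemma half_open_box_measure r : 0 <= r -> lebesgue_rV N (half_open_box r) = ((2 * r) ^+ N)%:E.
Proof.
move=> r0.
have -> : half_open_box r = [set x | forall i, (\row_i (- r) : 'rV[R]_N) 0 i < x 0 i <= (\row_i r : 'rV[R]_N) 0 i].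
  by apply/seteqP; split => x H i; have := H i; rewrite !mxE.
rewrite lebesgue_rV_box => [|i]; last by rewrite !mxE; lra.
congr EFin; rewrite (eq_bigr (fun=> 2 * r)) => [|i _]; last by rewrite !mxE; lra.
by rewrite prodr_const card_ord.
Qed.

Lemma xt_half_open_box_measure (r a b : R) : 0 <= r -> a <= b ->
  lebesgue_xt (half_open_box r `*` `]a, b]%classic) = ((2 * r) ^+ N * (b - a))%:E.
Proof.
move=> r0 ab; rewrite lebesgue_xtE.
transitivity (lebesgue_rV N (half_open_box r) * lebR `]a, b]%classic)%E.
  by apply: product_measure1E => //; exact: measurable_half_open_box.
by rewrite half_open_box_measure// lebR_itv.
Qed.

Lemma measurable_closed_box M : measurable (closed_box M : set V).
Proof. by apply: measurable_closed_xt; apply: compact_closed; [exact: norm_hausdorff|exact: closed_box_compact]. Qed.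

Lemma closed_box_fin (M : R) : (lebesgue_xt (closed_box M : set V) < +oo)%E.
Proof.
have M1 : 0 <= `|M| + 1 by rewrite addr_ge0.
apply: (@le_lt_trans _ _ (lebesgue_xt (half_open_box (`|M| + 1) `*` `]- (`|M| + 1), `|M| + 1]%classic))); last first.
  by rewrite xt_half_open_box_measure ?ltry//; lra.
apply: le_measure; rewrite ?inE; [exact: measurable_closed_box| |].
  by apply: measurableX => //; exact: measurable_half_open_box.
move=> z zM; have H k : - (`|M| + 1) < xt_coord k z <= `|M| + 1.
  have := ler_xt_coord k z; have := ler_norm M; move: zM; rewrite /closed_box/= ler_norml.
  by move=> ? ? /andP[]; lra.
by split; [move=> i; exact: (H (Some i))|rewrite /= in_itv/=; exact: (H None)].
Qed.

Lemma integral_cst_xt (D : set V) (r : R) : measurable D ->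
  (\int[lebesgue_xt]_(y in D) r%:E = r%:E * lebesgue_xt D)%E.
Proof. by move=> mD; exact: (integral_cst lebesgue_xt mD r%:E). Qed.

Lemma kern_int_fin d : 0 < d -> (\int[lebesgue_xt]_y (kern d (y : V))%:E < +oo)%E.
Proof.
move=> d0.
apply: (@le_lt_trans _ _ (\int[lebesgue_xt]_(y in (closed_box d : set V)) (d ^+ 4)%:E)%E); last first.
  rewrite integral_cst_xt; last exact: measurable_closed_box.
  by rewrite lte_mul_pinfty ?lee_fin ?exprn_ge0 ?(ltW d0)//; exact: closed_box_fin.
rewrite [leRHS]integral_mkcond; apply: ge0_le_integral_nm => y.
  by rewrite lee_fin kern_ge0.
rewrite patchE; case: ifPn => [_|]; first by rewrite lee_fin kern_le.
apply: contraNT; rewrite inE /closed_box /= -ltNge => b0; apply: kern_supp; first exact: ltW.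
by rewrite gt_eqF//; rewrite lte_fin in b0.
Qed.

Lemma kern_int_gt0 d : 0 < d -> (0 < \int[lebesgue_xt]_y (kern d (y : V))%:E)%E.
Proof.
move=> d0; have n1 := xt_dim_ge1 R N.
(* On the box of side [2 r] the kernel is at least [(d^2 / 2)^2]. *)
pose r := d / (2 * xt_dim R N).
have r0 : 0 < r by rewrite divr_gt0// mulr_gt0//; lra.
pose D : set V := half_open_box r `*` `](- r), r]%classic.
have mD : measurable D by apply: measurableX => //; exact: measurable_half_open_box.
apply: (@lt_le_trans _ _ (\int[lebesgue_xt]_(y in D) ((d ^+ 2 / 2) ^+ 2)%:E)%E).
  rewrite integral_cst_xt// /D xt_half_open_box_measure; [|exact: ltW|lra].
  rewrite -EFinM lte_fin mulr_gt0 ?exprn_gt0 ?divr_gt0 ?exprn_gt0//.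
  by rewrite mulr_gt0 ?exprn_gt0//; lra.
rewrite [leLHS]integral_mkcond; apply: ge0_le_integral_nm => y.
  by rewrite patchE; case: ifPn => // _; rewrite lee_fin sqr_ge0.
rewrite patchE; case: ifPn => [/set_mem[y1 y2]|_]; last by rewrite lee_fin kern_ge0.
rewrite lee_fin /kern lerXn2r// ?nnegrE ?pos_ge0 ?divr_ge0 ?sqr_ge0//.
rewrite /pos_part le_max; apply/orP; left.
have yr : `|y| <= r.
  apply: ler_norm_xt_coord => [|[i|]]; first exact: ltW.
    by have /andP[] := y1 i; rewrite ler_norml /=; lra.
  by move: y2; rewrite /= in_itv/= ler_norml; lra.
have : sqnorm y <= xt_dim R N * r ^+ 2.
  rewrite (le_trans (sqnorm_le y))// ler_wpM2l ?(le_trans ler01)//.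
  by rewrite lerXn2r ?nnegrE// ltW.
have -> : xt_dim R N * r ^+ 2 = d ^+ 2 / (4 * xt_dim R N) by rewrite /r; field; lra.
have : d ^+ 2 / (4 * xt_dim R N) <= d ^+ 2 / 4.
  rewrite ler_wpM2l ?sqr_ge0// lef_pV2 ?posrE; lra.
have := sqr_ge0 d; lra.
Qed.

End box_measure.

(** * Pairing an integrable function with a test function *)

Section convolution.
Context (R : realType) (N : nat).
Local Notation V := ('rV[R]_N * R)%type.
Local Notation mu := (@lebesgue_xt R N).

Lemma integral_xt_translate (h : V) (f : V -> \bar R) :
  measurable_fun setT f ->
  (\int[mu]_z f (z + h)%R = \int[mu]_z f z)%E.
Proof.
move=> mf; rewrite integralE [RHS]integralE; congr (_ - _)%E.
  rewrite -(ge0_integral_xt_translate h (f := f^\+%E))//; last exact: measurable_funepos.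
  by apply: eq_integral => z _; rewrite !funeposE.
rewrite -(ge0_integral_xt_translate h (f := f^\-%E))//; last exact: measurable_funeneg.
by apply: eq_integral => z _; rewrite !funenegE.
Qed.

Lemma measurable_add_xt : measurable_fun setT (fun p : V * V => p.1 + p.2).
Proof.
apply: measurable_fun_xt => k.
rewrite (_ : (fun p : V * V => _) = (fun p => xt_coord k p.1 + xt_coord k p.2)); last first.
  by apply/funext => p; rewrite xt_coordD.
by apply: measurable_funD;
  [exact: (measurableT_comp (measurable_xt_coord k) measurable_fst)
  |exact: (measurableT_comp (measurable_xt_coord k) measurable_snd)].
Qed.

Lemma measurable_normE d (T : measurableType d) (f : T -> R) :
  measurable_fun setT f -> measurable_fun setT (fun x => `|f x|%:E).
Proof. by move=> mf; apply/measurable_EFinP; exact: measurableT_comp. Qed.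

Section pairing_f.
Variables (f : V -> R) (M : R).
Hypothesis mf : measurable_fun setT f.
Hypothesis fi : (\int[mu]_z `|f z|%:E < +oo)%E.
Hypothesis fM : forall y, M < `|y| -> f y = 0.

(** The action of [f] as a distribution. *)
Definition pairing (th : V -> R) : R := Rintegral mu setT (fun y => f y * th y).

(** The functions that can be paired with any integrable [f] supported in the
ball of radius [M]. *)
Definition bounded_test (th : V -> R) := measurable_fun setT th /\
  exists B, forall y, `|y| <= M -> `|th y| <= B.

Lemma pairing_integrable th : bounded_test th ->
  mu.-integrable setT (EFin \o (fun y => f y * th y)).
Proof.
move=> [mth [B hB]].
have fint : mu.-integrable setT (EFin \o f).
  by apply/integrableP; split; [exact/measurable_EFinP|].
have := integrableZl measurableT B fint; apply: le_integrable => //.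
  by apply/measurable_EFinP; exact: measurable_funM.
move=> y _; rewrite /= lee_fin !normrM.
have [yM|/fM ->] := leP `|y| M; last by rewrite normr0 mul0r mulr0.
by rewrite mulrC ler_wpM2r// (le_trans (hB _ yM))// ler_norm.
Qed.

Lemma bounded_testB th1 th2 : bounded_test th1 -> bounded_test th2 ->
  bounded_test (fun y => th1 y - th2 y).
Proof.
move=> [m1 [B1 h1]] [m2 [B2 h2]]; split; first exact: measurable_funB.
by exists (B1 + B2) => y yM; rewrite (le_trans (ler_normB _ _))// lerD ?h1 ?h2.
Qed.

Lemma bounded_testZ c th : bounded_test th -> bounded_test (fun y => c * th y).
Proof.
move=> [m1 [B1 h1]]; split; first exact: measurable_funM.
by exists (`|c| * B1) => y yM; rewrite normrM ler_wpM2l// h1.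
Qed.

Lemma pairingB th1 th2 : bounded_test th1 -> bounded_test th2 ->
  pairing (fun y => th1 y - th2 y) = pairing th1 - pairing th2.
Proof.
move=> h1 h2; rewrite /pairing -RintegralB//; [|exact: pairing_integrable|exact: pairing_integrable].
by apply: eq_Rintegral => y _; rewrite mulrBr.
Qed.

Lemma pairingZ c th : bounded_test th -> pairing (fun y => c * th y) = c * pairing th.
Proof.
move=> h1; rewrite /pairing -RintegralZl//; last exact: pairing_integrable.
by apply: eq_Rintegral => y _; rewrite mulrCA.
Qed.

Lemma pairingB_sum (I : Type) (s : seq I) (th : V -> R) (c : I -> R) (D : I -> V -> R) :
  bounded_test th -> (forall k, bounded_test (D k)) ->
  bounded_test (fun y => th y - \sum_(k <- s) c k * D k y) /\
  pairing (fun y => th y - \sum_(k <- s) c k * D k y) =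
    pairing th - \sum_(k <- s) c k * pairing (D k).
Proof.
move=> ht hD; elim: s => [|k s [IH1 IH2]].
  under [in X in X /\ _]eq_fun do rewrite big_nil subr0.
  by under [in X in _ /\ X]eq_fun do rewrite big_nil subr0; rewrite big_nil subr0.
rewrite (_ : (fun y => th y - _) = (fun y => (th y - \sum_(k <- s) c k * D k y) - c k * D k y)).
  split; first exact/bounded_testB/bounded_testZ.
  by rewrite pairingB//; [rewrite IH2 pairingZ// big_cons; ring|exact: bounded_testZ].
by apply/funext => y; rewrite big_cons; ring.
Qed.

Let L1 := Rintegral mu setT (fun y => `|f y|).

Lemma pairing_bound (th : V -> R) (B : R) : 0 <= B -> measurable_fun setT th ->
  (forall y, `|y| <= M -> `|th y| <= B) -> `|pairing th| <= B * L1.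
Proof.
move=> B0 mth hB.
have ft : bounded_test th by split => //; exists B.
have fint : mu.-integrable setT (EFin \o (fun y => `|f y|)).
  apply/integrableP; split; first exact: measurable_normE.
  by under eq_integral do rewrite /= normr_id.
rewrite /L1 -RintegralZl// (le_trans (le_normr_Rintegral _ (pairing_integrable ft)))//.
apply: le_Rintegral => //.
- by have := integrable_norm (pairing_integrable ft).
- exact: (integrableZl measurableT B fint).
move=> y _; rewrite normrM.
have [yM|/fM ->] := leP `|y| M; last by rewrite normr0 mul0r mulr0.
by rewrite mulrC ler_wpM2r// (le_trans (hB _ yM))// ler_norm.
Qed.

Lemma L1_ge0 : 0 <= L1.
Proof. by apply: Rintegral_ge0 => y _. Qed.

Lemma bounded_test_kern d z : bounded_test (fun y => kern d (y - z)).
Proof.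
split; first exact: (measurableT_comp (measurable_kern d) (measurable_subr_xt z)).
by exists (d ^+ 4) => y _; rewrite ger0_norm ?kern_ge0// kern_le.
Qed.

Lemma ler_subr_norm (y z : V) : `|y| <= M -> `|y - z| <= M + `|z|.
Proof. by move=> yM; rewrite (le_trans (ler_normB _ _))// lerD2r. Qed.

Lemma bounded_test_dkern d k z : bounded_test (fun y => dkern d k (y - z)).
Proof.
split; first exact: (measurableT_comp (measurable_dkern d k) (measurable_subr_xt z)).
by exists (4 * d ^+ 2 * (M + `|z|)) => y /(ler_subr_norm z); exact: dkern_bound.
Qed.

(** The Taylor estimates of the kernel are uniform in the integration variable
over the support of [f]; integrated against [f] they are Taylor estimates of the
convolution. *)
Lemma pairing_kern_hasgrad d : 0 <= M ->
  hasgrad (fun z => pairing (fun y => kern d (y - z)))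
          (fun z k => - pairing (fun y => dkern d k (y - z))).
Proof.
move=> M0.
have n0 : 0 <= xt_dim R N by rewrite (le_trans ler01)// xt_dim_ge1.
have MM (z : V) : 0 <= M + `|z| by rewrite addr_ge0.
have M2 (z : V) : 0 <= 2 * (M + `|z|) + 1 by have := MM z; lra.
split => [z|k z].
  pose B := ((xt_dim R N * (2 * (M + `|z|) + 1)) ^+ 2 + 2 * d ^+ 2 * xt_dim R N).
  have B0 : 0 <= B.
    by rewrite addr_ge0 ?sqr_ge0// mulr_ge0// mulr_ge0// sqr_ge0.
  pose A := \sum_k `|- pairing (fun y => dkern d k (y - z))|.
  have A0 : 0 <= A by apply: sumr_ge0.
  apply: (@is_diff_sqr_remainder _ _ _ _ _ (A + B * L1) 1) => //.
  - exact: lincomb_linear.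
  - by move=> h; rewrite (le_trans (lincomb_bound _ _))// ler_wpM2r// lerDl mulr_ge0// L1_ge0.
  - move=> h h1.
    have [ft] := @pairingB_sum _ (index_enum _) (fun y : V => kern d (y - (h + z)) - kern d (y - z))
      (fun k => - xt_coord k h) (fun k y => dkern d k (y - z))
      (bounded_testB (bounded_test_kern _ _) (bounded_test_kern _ _)) (fun k => bounded_test_dkern d k z).
    rewrite (pairingB (bounded_test_kern d (h + z)) (bounded_test_kern d z)).
    set X := pairing (fun y => kern d (y - (h + z))); set Y := pairing (fun y => kern d (y - z)).
    rewrite (_ : \sum_(k <- _) - xt_coord k h * pairing _ =
      lincomb (fun k => - pairing (fun y => dkern d k (y - z))) h); last first.
      by apply: eq_bigr => k _; rewrite mulNr mulrN.
    move=> <-; rewrite (@le_trans _ _ (B * `|h| ^+ 2 * L1))//; last first.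
      by rewrite mulrAC ler_wpM2r ?sqr_ge0// lerDr.
    apply: pairing_bound; [by rewrite mulr_ge0 ?sqr_ge0|by have [] := ft|].
    move=> y /(ler_subr_norm z) yz.
    have := kern_remainder d yz (h := - h); rewrite normrN => /(_ (ltW h1)).
    rewrite (_ : - h + (y - z) = y - (h + z)); last by rewrite opprD addrCA addrA.
    rewrite (_ : lincomb _ _ = \sum_k - xt_coord k h * dkern d k (y - z))//.
    by apply: eq_bigr => k _; rewrite xt_coordN.
apply: (@continuous_lip _ _ _ _ (4 * (xt_dim R N * (2 * (M + `|z|) + 1) * (M + `|z| + 1) + d ^+ 2) * L1) 1) => // h h1.
rewrite -opprD normrN -(pairingB (bounded_test_dkern d k (h + z)) (bounded_test_dkern d k z)).
rewrite mulrAC; apply: pairing_bound.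
- rewrite mulr_ge0// mulr_ge0// addr_ge0 ?sqr_ge0// mulr_ge0 ?mulr_ge0//.
  by rewrite addr_ge0.
- by have [] := bounded_testB (bounded_test_dkern d k (h + z)) (bounded_test_dkern d k z).
move=> y /(ler_subr_norm z) yz.
have := dkern_lip d k yz (h := - h); rewrite normrN => /(_ (ltW h1)).
by rewrite (_ : - h + (y - z) = y - (h + z))//; rewrite opprD addrCA addrA.
Qed.

End pairing_f.

End convolution.

(** * Mollification *)

(** The tangent line at [a] lies below the convex function [b |-> b^m]. Integrated,
it gives Jensen's inequality for the mollification. *)
Lemma young_tangent (R : realType) (m a b : R) : 1 < m -> 0 <= a -> 0 <= b ->
  m * a `^ (m - 1) * b <= b `^ m + (m - 1) * a `^ m.
Proof.
move=> m1 a0 b0; have m0 : 0 < m by lra.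
have mm : 0 < m / (m - 1) by rewrite divr_gt0// subr_gt0.
have := conjugate_powR b0 (powR_ge0 a (m - 1)) m0 mm.
rewrite -powRrM (_ : (m - 1) * (m / (m - 1)) = m); last by field; lra.
rewrite (_ : m^-1 + _ = 1); last by field; lra.
move=> /(_ erefl) /(ler_wpM2l (ltW m0)).
rewrite mulrDr (_ : m * (b `^ m / m) = b `^ m); last by field; lra.
rewrite (_ : m * (a `^ m / (m / (m - 1))) = (m - 1) * a `^ m); last by field; lra.
by rewrite (mulrC b) mulrA.
Qed.

Section ge0_real.
Context d (T : measurableType d) (R : realType).
Variable mu : {measure set T -> \bar R}.

Lemma ge0_integralZ (c : R) (g : T -> R) : 0 <= c -> measurable_fun setT g ->
  (forall x, 0 <= g x) ->
  (\int[mu]_x (c * g x)%:E = c%:E * \int[mu]_x (g x)%:E)%E.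
Proof.
move=> c0 mg g0; under eq_integral do rewrite EFinM.
by rewrite ge0_integralZl_EFin//; [move=> x _; rewrite lee_fin|exact/measurable_EFinP].
Qed.

Lemma ge0_integralDr (g1 g2 : T -> R) : measurable_fun setT g1 -> measurable_fun setT g2 ->
  (forall x, 0 <= g1 x) -> (forall x, 0 <= g2 x) ->
  (\int[mu]_x (g1 x + g2 x)%:E = \int[mu]_x (g1 x)%:E + \int[mu]_x (g2 x)%:E)%E.
Proof.
move=> m1 m2 h1 h2; under eq_integral do rewrite EFinD.
rewrite ge0_integralD//; try (by move=> x _; rewrite lee_fin); exact/measurable_EFinP.
Qed.

End ge0_real.

Section mollifier.
Context (R : realType) (N : nat).
Local Notation V := ('rV[R]_N * R)%type.
Local Notation mu := (@lebesgue_xt R N).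

Definition kern_mass (d : R) : R := fine (\int[mu]_y (kern d y)%:E).

Lemma kern_massE d : 0 < d -> (kern_mass d)%:E = (\int[mu]_y (kern d y)%:E)%E.
Proof.
move=> d0; rewrite /kern_mass fineK// ge0_fin_numE ?kern_int_fin//.
by rewrite ltW// kern_int_gt0.
Qed.

Lemma kern_mass_gt0 d : 0 < d -> 0 < kern_mass d.
Proof. by move=> d0; rewrite -lte_fin kern_massE// kern_int_gt0. Qed.

Definition mollify (d : R) (f : V -> R) (z : V) : R :=
  (kern_mass d)^-1 * pairing f (fun y => kern d (y - z)).

Lemma measurable_translate_xt (a : V) : measurable_fun setT (fun y : V => y + a).
Proof.
by have := @measurable_subr_xt R N (- a); rewrite opprK.
Qed.

Lemma measurable_add_xtC : measurable_fun setT (fun p : V * V => p.2 + p.1).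
Proof.
rewrite (_ : (fun p : V * V => _) = fun p => p.1 + p.2); first exact: measurable_add_xt.
by apply/funext => p; rewrite addrC.
Qed.

Section mollify_f.
Variables (f : V -> R) (M : R).
Hypothesis mf : measurable_fun setT f.
Hypothesis fi : (\int[mu]_z `|f z|%:E < +oo)%E.
Hypothesis fM : forall y, M < `|y| -> f y = 0.
Hypothesis M0 : 0 <= M.
Variable d : R.
Hypothesis d0 : 0 < d.

Lemma mollify_hasgrad : hasgrad (mollify d f)
  (fun z k => (kern_mass d)^-1 * - pairing f (fun y => dkern d k (y - z))).
Proof.
have [h1 h2] := pairing_kern_hasgrad mf fi fM d M0; split => [z|k z].
  have := @is_diffZ _ _ _ _ _ (kern_mass d)^-1 _ (h1 z).
  rewrite (_ : (kern_mass d)^-1 *: lincomb _ = lincomb (fun k => (kern_mass d)^-1 * - pairing f (fun y => dkern d k (y - z))))//.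
  apply/funext => v; rewrite -[LHS]/((kern_mass d)^-1 * lincomb _ v) /lincomb mulr_sumr.
  by apply: eq_bigr => k _; rewrite mulrCA.
by apply: cvgMl_tmp; exact: h2.
Qed.

Lemma measurable_mollify : measurable_fun setT (mollify d f).
Proof. by apply: continuous_measurable_xt; exact: hasgrad_continuous mollify_hasgrad. Qed.

Lemma mollify_ge0 z : (forall y, 0 <= f y) -> 0 <= mollify d f z.
Proof.
move=> f0; rewrite mulr_ge0 ?invr_ge0 ?(ltW (kern_mass_gt0 d0))//.
by apply: Rintegral_ge0 => y _; rewrite mulr_ge0// kern_ge0.
Qed.

Let fk_int z : mu.-integrable setT (EFin \o (fun h => f (h + z) * kern d h)).
Proof.
have /integrableP[_] := pairing_integrable mf fi fM (bounded_test_kern M d z).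
rewrite -(integral_xt_translate z); last first.
  apply: measurableT_comp => //; apply/measurable_EFinP; apply: measurable_funM => //.
  exact: (measurableT_comp (measurable_kern d) (measurable_subr_xt z)).
move=> H; apply/integrableP; split.
  apply/measurable_EFinP; apply: measurable_funM; last exact: measurable_kern.
  exact: (measurableT_comp mf (measurable_translate_xt z)).
by move: H; under eq_integral do rewrite /= addrK.
Qed.

Lemma pairing_translate z : pairing f (fun y => kern d (y - z)) =
  Rintegral mu setT (fun h => f (h + z) * kern d h).
Proof.
rewrite /pairing /Rintegral; congr fine; rewrite -(integral_xt_translate z).
  by apply: eq_integral => y _; rewrite addrK.
apply/measurable_EFinP; apply: measurable_funM => //.
exact: (measurableT_comp (measurable_kern d) (measurable_subr_xt z)).
Qed.

Lemma mollify_sub_le z : (`|mollify d f z - f z|%:E <=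
  (kern_mass d)^-1%:E * \int[mu]_h (`|f (h + z) - f z| * kern d h)%:E)%E.
Proof.
have kd := kern_mass_gt0 d0.
have ik : mu.-integrable setT (EFin \o kern d).
  apply/integrableP; split; first by apply/measurable_EFinP; exact: measurable_kern.
  rewrite (eq_integral (fun y => (kern d y)%:E)); first exact: kern_int_fin.
  by move=> y _; rewrite /= ger0_norm// kern_ge0.
have ifk : mu.-integrable setT (EFin \o (fun h => f z * kern d h)).
  exact: (integrableZl measurableT (f z) ik).
have -> : mollify d f z - f z =
    (kern_mass d)^-1 * Rintegral mu setT (fun h => (f (h + z) - f z) * kern d h).
  have -> : Rintegral mu setT (fun h => (f (h + z) - f z) * kern d h) =
      pairing f (fun y => kern d (y - z)) - f z * kern_mass d.
    rewrite pairing_translate -[kern_mass d]/(Rintegral mu setT (kern d)) -RintegralZl//.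
    rewrite -RintegralB//.
    by apply: eq_Rintegral => h _; rewrite mulrBl.
  by rewrite mulrBr /mollify mulrCA mulVf ?mulr1// gt_eqF.
have im : mu.-integrable setT (EFin \o (fun h => (f (h + z) - f z) * kern d h)).
  apply: eq_integrable (integrableB measurableT (fk_int z) ifk) => // h _.
  by rewrite /= -EFinB mulrBl.
rewrite normrM gtr0_norm ?invr_gt0// EFinM lee_wpmul2l ?lee_fin ?invr_ge0 ?(ltW kd)//.
rewrite EFin_normr_Rintegral// (le_trans (le_abse_integral _ _ _))//.
  by case/integrableP : im.
rewrite le_eqVlt; apply/orP; left; apply/eqP; apply: eq_integral => h _.
by rewrite /= normrM (ger0_norm (kern_ge0 _ _)).
Qed.

(** Jensen's inequality: [young_tangent] with [a] the value of the mollification. *)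
Lemma mollify_pow_le m z : 1 < m -> ((`|mollify d f z| `^ m)%:E <=
  (kern_mass d)^-1%:E * \int[mu]_h (`|f (h + z)| `^ m * kern d h)%:E)%E.
Proof.
move=> m1; have kd := kern_mass_gt0 d0.
set a := `|mollify d f z|; have a0 : 0 <= a by rewrite normr_ge0.
set Y := (\int[mu]_h _)%E.
have mfz : measurable_fun setT (fun h : V => f (h + z)).
  exact: (measurableT_comp mf (measurable_translate_xt z)).
have mk := @measurable_kern R N d.
have mabs : measurable_fun setT (fun h : V => `|f (h + z)|) by exact: measurableT_comp.
have mpow : measurable_fun setT (fun h : V => `|f (h + z)| `^ m).
  exact: (measurableT_comp (measurable_powR m) mabs).
have Y0 : (0 <= Y)%E.
  by apply: integral_ge0 => h _; rewrite lee_fin mulr_ge0 ?powR_ge0 ?kern_ge0.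
have aX : (a%:E <= (kern_mass d)^-1%:E * \int[mu]_h (`|f (h + z)| * kern d h)%:E)%E.
  rewrite /a /mollify normrM gtr0_norm ?invr_gt0// EFinM lee_wpmul2l ?lee_fin ?invr_ge0 ?(ltW kd)//.
  rewrite pairing_translate EFin_normr_Rintegral// (le_trans (le_abse_integral _ _ _))//.
    by case/integrableP : (fk_int z).
  rewrite le_eqVlt; apply/orP; left; apply/eqP; apply: eq_integral => h _.
  by rewrite /= normrM (ger0_norm (kern_ge0 _ _)).
have c0 : 0 <= m * a `^ (m - 1) by rewrite mulr_ge0 ?powR_ge0//; lra.
have m10 : 0 <= m - 1 by lra.
have H : (\int[mu]_h ((m * a `^ (m - 1)) * (`|f (h + z)| * kern d h))%:E <=
   Y + ((m - 1) * a `^ m)%:E * (kern_mass d)%:E)%E.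
  have k0 := @kern_ge0 R N d.
  have f0 (h : V) : 0 <= `|f (h + z)| `^ m * kern d h by rewrite mulr_ge0 ?powR_ge0.
  have ma : 0 <= (m - 1) * a `^ m by rewrite mulr_ge0 ?powR_ge0.
  rewrite kern_massE// -ge0_integralZ// -ge0_integralDr//; last 3 first.
  - exact: measurable_funM.
  - exact: measurable_funM.
  - by move=> h; rewrite mulr_ge0.
  apply: ge0_le_integral_nm => h.
    by rewrite lee_fin mulr_ge0// mulr_ge0.
  rewrite lee_fin mulrA -mulrDl ler_wpM2r ?kern_ge0//.
  exact: young_tangent.
have [->|Yfin] := eqVneq Y +oo%E.
  by rewrite gt0_muley ?leey// lte_fin invr_gt0.
have {}Yfin : Y \is a fin_num by rewrite ge0_fin_numE// lt_neqAle Yfin leey.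
have {}H : (((m * a `^ (m - 1)) * a * kern_mass d)%:E <= Y + ((m - 1) * a `^ m)%:E * (kern_mass d)%:E)%E.
  apply: le_trans H; rewrite ge0_integralZ//; last 2 first.
  - exact: measurable_funM.
  - by move=> h; rewrite mulr_ge0 ?kern_ge0.
  rewrite -mulrA EFinM lee_wpmul2l ?lee_fin//.
  move: aX; set X := (\int[mu]_h _)%E => aX.
  by rewrite mulrC EFinM -lee_pdivlMl// -EFinM; move: aX; rewrite lee_pdivlMl.
move: H; rewrite -(fineK Yfin) -EFinM -EFinD !lee_fin.
have -> : m * a `^ (m - 1) * a = m * a `^ m.
  have [->|an0] := eqVneq a 0; first by rewrite mulr0 powR0 ?mulr0//; lra.
  rewrite -mulrA; congr (_ * _); rewrite -{2}(powRr1 a0) -powRD ?subrK//.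
  by rewrite an0 implybT.
move=> H; rewrite mulrC ler_pdivlMr//; lra.
Qed.

(** Jensen's inequality, Tonelli and translation invariance. *)
Lemma mollify_Lp m : 1 < m ->
  (\int[mu]_z (`|mollify d f z| `^ m)%:E <= \int[mu]_z (`|f z| `^ m)%:E)%E.
Proof.
move=> m1; have kd := kern_mass_gt0 d0.
have mpow : measurable_fun setT (fun y : V => `|f y| `^ m).
  by apply: (measurableT_comp (measurable_powR m)); exact: measurableT_comp.
pose F (p : V * V) : \bar R := (`|f (p.2 + p.1)| `^ m * kern d p.2)%:E.
have mF : measurable_fun setT F.
  apply/measurable_EFinP; apply: measurable_funM.
    exact: (measurableT_comp mpow measurable_add_xtC).
  exact: (measurableT_comp (@measurable_kern R N d) measurable_snd).
have F0 p : (0 <= F p)%E by rewrite lee_fin mulr_ge0 ?powR_ge0 ?kern_ge0.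
apply: (@le_trans _ _ (\int[mu]_z ((kern_mass d)^-1%:E * \int[mu]_h F (z, h)))%E).
  apply: ge0_le_integral_nm => z; first by rewrite lee_fin powR_ge0.
  exact: mollify_pow_le.
rewrite ge0_integralZl_EFin//; last 3 first.
- by move=> z _; apply: integral_ge0 => h _; exact: F0.
- exact: (measurable_fun_fubini_tonelli_F (m2 := mu) F mF).
- by rewrite invr_ge0 ltW.
rewrite (fubini_tonelli (m1 := mu) (m2 := mu) F mF F0).
rewrite lee_pdivrMl// kern_massE// muleC.
rewrite -ge0_integralZl//; last 3 first.
- by apply/measurable_EFinP; exact: measurable_kern.
- by move=> z _; rewrite lee_fin kern_ge0.
- by apply: integral_ge0 => z _; rewrite lee_fin powR_ge0.
apply: ge0_le_integral_nm => h.
  by apply: integral_ge0 => z _; exact: F0.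
rewrite muleC -ge0_integralZ ?kern_ge0//.
rewrite -(ge0_integral_xt_translate h (f := fun z => (kern d h * `|f z| `^ m)%:E)).
- apply: ge0_le_integral_nm => z; first exact: F0.
  by rewrite /F/= mulrC addrC.
- by apply/measurable_EFinP; exact: measurable_funM.
- by move=> z; rewrite lee_fin mulr_ge0 ?powR_ge0 ?kern_ge0.
Qed.

End mollify_f.

(** The mollification is an average of translates by vectors of norm at most [d]. *)
Lemma mollify_L1 (f : V -> R) (M e : R) : measurable_fun setT f ->
  (\int[mu]_z `|f z|%:E < +oo)%E -> (forall y, M < `|y| -> f y = 0) -> 0 < e ->
  exists2 dl, 0 < dl & forall d, 0 < d <= dl ->
    (\int[mu]_z `|mollify d f z - f z|%:E <= e%:E)%E.
Proof.
move=> mf fi fM e0; have [dl dl0 H] := L1_translate_small mf fi e0.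
exists dl => // d /andP[d0 ddl]; have kd := kern_mass_gt0 d0.
pose F (p : V * V) : \bar R := (`|f (p.2 + p.1) - f p.1| * kern d p.2)%:E.
have mF : measurable_fun setT F.
  apply/measurable_EFinP; apply: measurable_funM.
    apply: measurableT_comp => //; apply: measurable_funB.
      exact: (measurableT_comp mf measurable_add_xtC).
    exact: (measurableT_comp mf measurable_fst).
  exact: (measurableT_comp (@measurable_kern R N d) measurable_snd).
have F0 p : (0 <= F p)%E by rewrite lee_fin mulr_ge0 ?kern_ge0.
apply: (@le_trans _ _ (\int[mu]_z ((kern_mass d)^-1%:E * \int[mu]_h F (z, h)))%E).
  apply: ge0_le_integral_nm => z; first by rewrite lee_fin.
  exact: (mollify_sub_le mf fi fM d0).
rewrite ge0_integralZl_EFin//; last 3 first.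
- by move=> z _; apply: integral_ge0 => h _; exact: F0.
- exact: (measurable_fun_fubini_tonelli_F (m2 := mu) F mF).
- by rewrite invr_ge0 ltW.
rewrite (fubini_tonelli (m1 := mu) (m2 := mu) F mF F0).
rewrite lee_pdivrMl// kern_massE// muleC.
rewrite -ge0_integralZl_EFin ?(ltW e0)//; last 2 first.
- by move=> z _; rewrite lee_fin kern_ge0.
- by apply/measurable_EFinP; exact: measurable_kern.
apply: ge0_le_integral_nm => h.
  by apply: integral_ge0 => z _; exact: F0.
have [k0|k0] := eqVneq (kern d h) 0.
  rewrite k0 mule0 (eq_integral (cst 0%E)) ?integral0// => z _.
  by rewrite /F/= k0 mulr0.
have hd := kern_supp (ltW d0) k0.
have mfh : measurable_fun setT (fun z : V => `|f (z + h) - f z|).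
  apply: measurableT_comp => //; apply: measurable_funB => //.
  exact: (measurableT_comp mf (measurable_translate_xt h)).
rewrite (eq_integral (fun z : V => (kern d h * `|f (z + h) - f z|)%:E)); last first.
  by move=> z _; rewrite /F/= mulrC (addrC h).
rewrite ge0_integralZ ?kern_ge0//.
rewrite muleC lee_wpmul2r ?lee_fin ?kern_ge0//; apply: H.
  by move=> i; rewrite (le_trans (ler_coord1 h i))// (le_trans hd).
by rewrite (le_trans (ler_coord2 h))// (le_trans hd).
Qed.

End mollifier.

(** * Limits of products, integrals of time derivatives *)

Section truncation.
Context d (T : measurableType d) (R : realType).
Variable mu : {measure set T -> \bar R}.

Definition tail_ind (H : T -> R) (n : nat) (x : T) : R := if n%:R < `|H x| then 1 else 0.

Lemma tail_ind_ge0 H n x : 0 <= tail_ind H n x.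
Proof. by rewrite /tail_ind; case: ifP. Qed.

Lemma measurable_tail_ind H n : measurable_fun setT H -> measurable_fun setT (tail_ind H n).
Proof.
move=> mH; have mHn : measurable_fun setT (fun x => `|H x|) by exact: measurableT_comp.
have mS : measurable [set x | n%:R < `|H x|].
  have := mHn measurableT `]n%:R, +oo[%classic (measurable_itv _); rewrite setTI.
  by rewrite (_ : _ @^-1` _ = [set x | n%:R < `|H x|])//;
    apply/seteqP; split => x; rewrite /preimage /= in_itv/= andbT.
have : measurable_fun setT (\1_[set x | n%:R < `|H x|] : T -> R) by exact: measurable_indic.
rewrite (_ : \1_ _ = tail_ind H n)//.
apply/funext => x; rewrite indicE /tail_ind; case: ifPn => h.
  by rewrite mem_set.
by rewrite memNset//=; apply/negP.
Qed.

Lemma vanish_tail (H P : T -> R) : measurable_fun setT H -> measurable_fun setT P ->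
  (forall x, 0 <= P x) -> (\int[mu]_x (P x)%:E < +oo)%E ->
  vanish (fun n => \int[mu]_x (P x * tail_ind H n x)%:E)%E.
Proof.
move=> mH mP P0 Pi.
have mb n := measurable_tail_ind n mH.
have [] := @dominated_convergence _ _ _ mu setT measurableT
  (fun n x => (P x * tail_ind H n x)%:E) (cst 0%E) (fun x => (P x)%:E).
- by move=> n; apply/measurable_EFinP; exact: measurable_funM.
- exact: measurable_cst.
- apply: aeW => x _; apply: cvg_near_cst; near=> n.
  rewrite /tail_ind ifF ?mulr0//; apply/negbTE; rewrite -leNgt.
  near: n; exists (Num.truncn `|H x|).+1 => // n /= xn.
  by rewrite (le_trans (ltW (truncnS_gt _)))// ler_nat.
- apply/integrableP; split; first exact/measurable_EFinP.
  by rewrite (eq_integral (fun x => (P x)%:E))// => x _; rewrite /= ger0_norm.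
- apply: aeW => x n _; rewrite gee0_abs ?lee_fin; last by rewrite mulr_ge0// tail_ind_ge0.
  by rewrite /tail_ind; case: ifP; rewrite ?mulr1 ?mulr0.
move=> _ /cvg0_vanish + _; apply: le_vanish; near=> n.
apply: ge0_le_integral_nm => x; first by rewrite lee_fin mulr_ge0// tail_ind_ge0.
by rewrite [cst _ _]/(0%E) sube0 lee_abs.
Unshelve. all: by end_near. Qed.

(** Truncation: where [|H| <= A] the product is at most [A |w n|], elsewhere it is
at most [C |H|], whose integral is small when [A] is large. *)
Lemma vanish_prod_bounded (H : T -> R) (w : nat -> T -> R) (C : R) :
  measurable_fun setT H -> (forall n, measurable_fun setT (w n)) ->
  (\int[mu]_x `|H x|%:E < +oo)%E -> 0 <= C -> (forall n x, `|w n x| <= C) ->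
  vanish (fun n => \int[mu]_x `|w n x|%:E)%E ->
  vanish (fun n => \int[mu]_x (`|H x| * `|w n x|)%:E)%E.
Proof.
move=> mH mw Hi C0 wC wv e e0.
have mHn : measurable_fun setT (fun x => `|H x|) by exact: measurableT_comp.
have mwn n : measurable_fun setT (fun x => `|w n x|) by exact: measurableT_comp.
have e2 : 0 < e / 2 by rewrite divr_gt0.
have t0 n : (0 <= \int[mu]_x (`|H x| * tail_ind H n x)%:E)%E.
  by apply: integral_ge0 => x _; rewrite lee_fin mulr_ge0// tail_ind_ge0.
have [A _ /(_ A (leqnn A)) hA] :=
  vanishZl C0 t0 (vanish_tail mH mHn (fun x => normr_ge0 _) Hi) e2.
have mA : measurable_fun setT (fun x => `|H x| * tail_ind H A x).
  apply: measurable_funM => //.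
  exact: measurable_tail_ind.
near=> n.
apply: (@le_trans _ _ (\int[mu]_x (A%:R * `|w n x| + C * (`|H x| * tail_ind H A x))%:E)%E).
  apply: ge0_le_integral_nm => x; first by rewrite lee_fin mulr_ge0.
  rewrite lee_fin /tail_ind; have [HA|HA] := ltP A%:R `|H x|.
    rewrite mulr1 (le_trans (y := C * `|H x|))// ?lerDr ?mulr_ge0//.
    by rewrite mulrC ler_wpM2r.
  by rewrite !mulr0 addr0 ler_wpM2r.
have m1 : measurable_fun setT (fun x => A%:R * `|w n x|) by exact: measurable_funM.
have m2 : measurable_fun setT (fun x => C * (`|H x| * tail_ind H A x)) by exact: measurable_funM.
have p1 x : 0 <= A%:R * `|w n x| by rewrite mulr_ge0.
have p2 x : 0 <= `|H x| * tail_ind H A x by rewrite mulr_ge0// tail_ind_ge0.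
have p3 x : 0 <= C * (`|H x| * tail_ind H A x) by rewrite mulr_ge0.
rewrite ge0_integralDr// !ge0_integralZ//.
rewrite [e]splitr EFinD leeD//.
near: n; apply: (vanishZl (ler0n _ A)) => // n.
by apply: integral_ge0 => x _; rewrite lee_fin.
Unshelve. all: by end_near. Qed.

Lemma young_scaled (m a b tau : R) : 1 < m -> 0 <= a -> 0 <= b -> 0 < tau ->
  a * b <= (tau^-1 * a) `^ (m / (m - 1)) + tau `^ m * b `^ m.
Proof.
move=> m1 a0 b0 t0; have m0 : 0 < m by lra.
have mm : 1 < m / (m - 1) by rewrite ltr_pdivlMr ?mul1r//; lra.
have -> : a * b = (tau^-1 * a) * (tau * b) by field; rewrite gt_eqF.
have := @conjugate_powR _ (tau^-1 * a) (tau * b) (m / (m - 1)) m.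
rewrite !mulr_ge0 ?invr_ge0 ?(ltW t0)// => /(_ erefl erefl) H.
apply: le_trans (H _ _ _) _; [lra|lra|by field; lra|].
rewrite -powRM ?(ltW t0)// lerD// ler_pdivrMr//; try lra.
  by rewrite ler_peMr ?powR_ge0// ltW.
by rewrite ler_peMr ?powR_ge0// ltW.
Qed.

(** Truncation again; where [|H| > A], Young's inequality with a small parameter
in front of the bounded quantity [|w n|^m] replaces the uniform bound. *)
Lemma vanish_prod_Lp (m B : R) (H : T -> R) (w : nat -> T -> R) : 1 < m ->
  measurable_fun setT H -> (forall n, measurable_fun setT (w n)) ->
  (\int[mu]_x (`|H x| `^ (m / (m - 1)))%:E < +oo)%E -> 0 <= B ->
  (forall n, \int[mu]_x (`|w n x| `^ m)%:E <= B%:E)%E ->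
  vanish (fun n => \int[mu]_x `|w n x|%:E)%E ->
  vanish (fun n => \int[mu]_x (`|H x| * `|w n x|)%:E)%E.
Proof.
move=> m1 mH mw Hi B0 wB wv e e0; have m0 : 0 < m by lra.
have mHn : measurable_fun setT (fun x => `|H x|) by exact: measurableT_comp.
have mwn n : measurable_fun setT (fun x => `|w n x|) by exact: measurableT_comp.
have mwm n : measurable_fun setT (fun x => `|w n x| `^ m).
  exact: (measurableT_comp (measurable_powR m)).
have mHm : measurable_fun setT (fun x => `|H x| `^ (m / (m - 1))).
  exact: (measurableT_comp (measurable_powR _)).
have e3 : 0 < e / 3 by rewrite divr_gt0.
(* [tau] is chosen so that [tau^m B <= e / 3]. *)
pose tau := (e / 3 / (B + 1)) `^ m^-1.
have B1 : 0 < B + 1 by lra.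
have t0 : 0 < tau by rewrite powR_gt0 ?divr_gt0.
have taum : tau `^ m = e / 3 / (B + 1).
  by rewrite /tau -powRrM mulVf ?gt_eqF// powRr1// ltW// divr_gt0.
pose C := tau^-1 `^ (m / (m - 1)).
have C0 : 0 <= C by exact: powR_ge0.
have mb A := measurable_tail_ind A mH.
have tail0 n : (0 <= \int[mu]_x (`|H x| `^ (m / (m - 1)) * tail_ind H n x)%:E)%E.
  by apply: integral_ge0 => x _; rewrite lee_fin mulr_ge0 ?powR_ge0// tail_ind_ge0.
have [A _ /(_ A (leqnn A)) hA] :=
  vanishZl C0 tail0 (vanish_tail mH mHm (fun x => powR_ge0 _ _) Hi) e3.
near=> n.
apply: (@le_trans _ _ (\int[mu]_x (A%:R * `|w n x| +
   (C * (`|H x| `^ (m / (m - 1)) * tail_ind H A x) + tau `^ m * `|w n x| `^ m))%:E)%E).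
  apply: ge0_le_integral_nm => x; first by rewrite lee_fin mulr_ge0.
  rewrite lee_fin /tail_ind; have [HA|HA] := ltP A%:R `|H x|.
    rewrite mulr1 (le_trans (y := C * `|H x| `^ (m / (m - 1)) + tau `^ m * `|w n x| `^ m))//.
      rewrite (_ : C * _ = (tau^-1 * `|H x|) `^ (m / (m - 1))); first exact: young_scaled.
      by rewrite powRM ?invr_ge0 ?(ltW t0).
    by rewrite lerDr mulr_ge0.
  by rewrite !mulr0 add0r (le_trans (y := A%:R * `|w n x|)) ?ler_wpM2r// lerDl mulr_ge0 ?powR_ge0.
have m2 : measurable_fun setT (fun x => C * (`|H x| `^ (m / (m - 1)) * tail_ind H A x)).
  by apply: measurable_funM => //; exact: measurable_funM.
have p2 x : 0 <= `|H x| `^ (m / (m - 1)) * tail_ind H A x.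
  by rewrite mulr_ge0 ?powR_ge0// tail_ind_ge0.
have p2' x : 0 <= C * (`|H x| `^ (m / (m - 1)) * tail_ind H A x) by rewrite mulr_ge0.
have p3 x : 0 <= tau `^ m * `|w n x| `^ m by rewrite mulr_ge0 ?powR_ge0.
have p1 x : 0 <= A%:R * `|w n x| by rewrite mulr_ge0.
have m3 : measurable_fun setT (fun x => tau `^ m * `|w n x| `^ m) by exact: measurable_funM.
have m1' : measurable_fun setT (fun x => A%:R * `|w n x|) by exact: measurable_funM.
rewrite ge0_integralDr//; [|exact: measurable_funD|by move=> x; rewrite addr_ge0].
rewrite ge0_integralDr//.
rewrite ge0_integralZ// ge0_integralZ//; last exact: measurable_funM.
rewrite ge0_integralZ ?powR_ge0//.
rewrite (_ : e = e / 3 + (e / 3 + e / 3)); last lra.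
rewrite !EFinD leeD//.
  near: n; apply: (vanishZl (ler0n _ A)) => // n.
  by apply: integral_ge0 => x _; rewrite lee_fin.
rewrite leeD// taum (le_trans (y := ((e / 3 / (B + 1))%:E * B%:E)%E))//.
  by rewrite lee_wpmul2l// lee_fin ltW// divr_gt0.
rewrite -EFinM lee_fin mulrAC ler_pdivrMr// ler_wpM2l//; first exact: ltW.
by rewrite lerDl.
Unshelve. all: by end_near. Qed.

End truncation.

Section ftc_xt.
Context (R : realType) (N : nat).
Local Notation V := ('rV[R]_N * R)%type.
Local Notation mu := (@lebesgue_xt R N).

Lemma integral_lebR (f : R -> \bar R) : measurable_fun [set: R] f ->
  (\int[lebR (R:=R)]_x f x = \int[@lebesgue_measure R]_(x in [set: measurableTypeR R]) f x)%E.
Proof.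
move=> mf; rewrite integralE [RHS]integralE; congr (_ - _)%E; apply: ge0_integral_lebR => //.
  exact: measurable_funepos.
exact: measurable_funeneg.
Qed.

Lemma hasgrad_line (h : V -> R) dh x (t : R) : hasgrad h dh ->
  is_derive t 1 (fun s => h (x, s)) (dh (x, t) None).
Proof.
move=> [dfh _].
have d2 : is_diff t (fun s : R => (x, s) : V) (fun s => (0, s)).
  exact: (is_diff_pair (is_diff_cst x t) (is_diff_id t)).
have := @is_diff_comp _ _ _ _ _ _ _ _ _ d2 (dfh (x, t)).
move=> [e1 e2]; apply: DeriveDef; first exact/derivable1_diffP.
rewrite deriveE// e2 /= -[in RHS](lincomb_dir (dh (x, t)) None) /= /dir_t.
by congr (lincomb _ (_, _)).
Qed.

(** The fundamental theorem of calculus on each vertical line. *)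
Lemma integral_dt_eq0 (h : V -> R) dh M : hasgrad h dh ->
  (forall z, M < `|z| -> h z = 0) -> (forall z, M < `|z| -> dh z None = 0) ->
  mu.-integrable setT (fun z => (dh z None)%:E) ->
  (\int[mu]_z (dh z None)%:E = 0)%E.
Proof.
move=> hh hM dM ih.
have cd : continuous (fun z => dh z None) by have [_] := hh; exact.
have := @integral12_prod_meas1 _ _ _ _ _ (lebesgue_rV N) (@lebR R) (fun z => (dh z None)%:E) ih.
move=> <-; rewrite (eq_integral (cst 0%E)) ?integral0// => x _.
rewrite /fubini_F integral_lebR; last first.
  apply/measurable_EFinP; apply: (measurableT_comp (f := fun z => dh z None)).
    exact: continuous_measurable_xt.
  exact: pair1_measurable.
pose L : R := `|M| + 1.
have L0 : 0 < L by rewrite /L; have := normr_ge0 M; lra.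
have out (t : R) : L <= `|t| -> M < `|(x, t)|.
  move=> tL; rewrite (lt_le_trans _ (ler_coord2 _))//= (lt_le_trans _ tL)//.
  by rewrite /L (le_lt_trans (ler_norm M))// ltrDl.
have cl (t : R) : {for t, continuous (fun s => h (x, s))}.
  apply: differentiable_continuous; apply/derivable1_diffP.
  by have [] := hasgrad_line x t hh.
pose S : set R := `[- L, L]%classic.
transitivity (\int[@lebesgue_measure R]_(t in S) (dh (x, t) None)%:E)%E.
  rewrite [RHS]integral_mkcond; apply: eq_integral => t _; rewrite patchE.
  case: ifPn => //; rewrite notin_setE/= /S /= in_itv/= -ler_norml => /negP.
  by rewrite -ltNge => /ltW /out /dM ->.
rewrite (@continuous_FTC2 _ (fun t => dh (x, t) None) (fun t => h (x, t))); first last.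
- by move=> t _; rewrite derive1E; have [_ ->] := hasgrad_line x t hh.
- split.
  + by move=> t _; have [] := hasgrad_line x t hh.
  + by apply: cvg_at_right_filter; exact: cl.
  + by apply: cvg_at_left_filter; exact: cl.
- apply: continuous_subspaceT => t.
  apply: (@continuous_comp _ _ _ (fun s : R => (x, s) : V) (fun z => dh z None)); last exact: cd.
  have [d2 _] : is_diff t (fun s : R => (x, s) : V) (fun s => (0, s)).
    exact: (is_diff_pair (is_diff_cst x t) (is_diff_id t)).
  exact: differentiable_continuous.
- lra.
rewrite !hM ?subee//; apply: out; first by rewrite normrN ler_norm.
exact: ler_norm.
Qed.

End ftc_xt.

(** * Sequences converging in L^1 *)

Section L1_vanishing.
Context d (T : measurableType d) (R : realType).
Variable mu : {measure set T -> \bar R}.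

Definition L1_vanish (u : nat -> T -> R) := (forall n, measurable_fun setT (u n)) /\
  vanish (fun n => \int[mu]_x `|u n x|%:E)%E.

Lemma L1_vanish_le (u v : nat -> T -> R) : (forall n, measurable_fun setT (u n)) ->
  (forall n x, `|u n x| <= `|v n x|) -> L1_vanish v -> L1_vanish u.
Proof.
move=> mu' uv [mv vv]; split => //; apply: le_vanish vv; near=> n.
by apply: ge0_le_integral_nm => x; rewrite lee_fin.
Unshelve. all: by end_near. Qed.

Lemma L1_vanishD (u v : nat -> T -> R) : L1_vanish u -> L1_vanish v -> L1_vanish (fun n x => u n x + v n x).
Proof.
move=> [mu' uu] [mv vv]; split => [n|]; first exact: measurable_funD.
apply: le_vanish (vanishD uu vv); near=> n.
rewrite -ge0_integralDr//; [|exact: measurableT_comp|exact: measurableT_comp].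
by apply: ge0_le_integral_nm => x; rewrite lee_fin// ler_normD.
Unshelve. all: by end_near. Qed.

Lemma L1_vanishMb (u b : nat -> T -> R) (C : R) : (forall n, measurable_fun setT (b n)) ->
  (forall n x, `|b n x| <= C) -> L1_vanish u -> L1_vanish (fun n x => u n x * b n x).
Proof.
move=> mb bC [mu' uu]; split => [n|]; first exact: measurable_funM.
have C0 : 0 <= `|C| by [].
have u0 n : (0 <= \int[mu]_x `|u n x|%:E)%E.
  by apply: integral_ge0 => x _; rewrite lee_fin.
apply: le_vanish (vanishZl C0 u0 uu).
near=> n; rewrite -ge0_integralZ//; last exact: measurableT_comp.
apply: ge0_le_integral_nm => x; rewrite lee_fin// normrM mulrC ler_wpM2r//.
by rewrite (le_trans (bC _ _))// ler_norm.
Unshelve. all: by end_near. Qed.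

Lemma L1_vanish_sum (I : Type) (s : seq I) (u : I -> nat -> T -> R) :
  (forall i, L1_vanish (u i)) -> L1_vanish (fun n x => \sum_(i <- s) u i n x).
Proof.
move=> uv; elim: s => [|i s IH].
  split => [n|e e0].
    rewrite (_ : (fun x => _) = cst 0); first exact: measurable_cst.
    by apply/funext => x; rewrite big_nil.
  near=> n; rewrite (eq_integral (cst 0%E)) ?integral0 ?lee_fin ?ltW// => x _.
  by rewrite big_nil normr0.
have := L1_vanishD (uv i) IH; rewrite (_ : (fun n x => _ + _) = (fun n x => \sum_(i <- i :: s) u i n x))//.
by apply/funext => n; apply/funext => x; rewrite big_cons.
Unshelve. all: by end_near. Qed.

Lemma L1_vanishM_bounded (H : T -> R) (w : nat -> T -> R) (C : R) :
  measurable_fun setT H -> (\int[mu]_x `|H x|%:E < +oo)%E -> 0 <= C ->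
  (forall n x, `|w n x| <= C) -> L1_vanish w -> L1_vanish (fun n x => H x * w n x).
Proof.
move=> mH Hi C0 wC [mw wv]; split => [n|]; first exact: measurable_funM.
apply: le_vanish (vanish_prod_bounded mH mw Hi C0 wC wv); near=> n.
by apply: ge0_le_integral_nm => x; rewrite lee_fin// normrM.
Unshelve. all: by end_near. Qed.

Lemma L1_vanishM_Lp (m B : R) (H : T -> R) (w : nat -> T -> R) : 1 < m ->
  measurable_fun setT H ->
  (\int[mu]_x (`|H x| `^ (m / (m - 1)))%:E < +oo)%E -> 0 <= B ->
  (forall n, \int[mu]_x (`|w n x| `^ m)%:E <= B%:E)%E ->
  L1_vanish w -> L1_vanish (fun n x => H x * w n x).
Proof.
move=> m1 mH Hi B0 wB [mw wv]; split => [n|]; first exact: measurable_funM.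
apply: le_vanish (vanish_prod_Lp m1 mH mw Hi B0 wB wv); near=> n.
by apply: ge0_le_integral_nm => x; rewrite lee_fin// normrM.
Unshelve. all: by end_near. Qed.

Lemma integrable_Lp_prod (m : R) (H w : T -> R) : 1 < m ->
  measurable_fun setT H -> measurable_fun setT w ->
  (\int[mu]_x (`|H x| `^ (m / (m - 1)))%:E < +oo)%E ->
  (\int[mu]_x (`|w x| `^ m)%:E < +oo)%E ->
  (\int[mu]_x `|H x * w x|%:E < +oo)%E.
Proof.
move=> m1 mH mw Hi wi.
have mH' : measurable_fun setT (fun x => `|H x| `^ (m / (m - 1))).
  by apply: (measurableT_comp (measurable_powR _)); exact: measurableT_comp.
have mw' : measurable_fun setT (fun x => `|w x| `^ m).
  by apply: (measurableT_comp (measurable_powR _)); exact: measurableT_comp.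
apply: (@le_lt_trans _ _ (\int[mu]_x (`|H x| `^ (m / (m - 1)) + `|w x| `^ m)%:E)%E).
  apply: ge0_le_integral_nm => x; rewrite lee_fin// normrM.
  have := @young_scaled _ m `|H x| `|w x| 1 m1 (normr_ge0 _) (normr_ge0 _) ltr01.
  by rewrite invr1 powR1 !mul1r.
rewrite ge0_integralDr//; exact: lte_add_pinfty.
Qed.

(** [(a + b)^m <= (2 max(a, b))^m]. *)
Lemma powRD_le (m a b : R) : 0 <= m -> 0 <= a -> 0 <= b ->
  (a + b) `^ m <= 2 `^ m * (a `^ m + b `^ m).
Proof.
move=> m0 a0 b0; wlog ab : a b a0 b0 / a <= b.
  move=> W; have [ab|ba] := leP a b; first exact: W.
  by rewrite addrC (addrC (a `^ m)); apply: W => //; exact: ltW.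
rewrite (@le_trans _ _ ((2 * b) `^ m))//.
  by rewrite ge0_ler_powR ?nnegrE ?addr_ge0 ?mulr_ge0//; lra.
by rewrite powRM// ler_wpM2l ?powR_ge0// lerDr powR_ge0.
Qed.

Lemma L1_vanishM_Lp2 (m : R) (H w0 : T -> R) (w : nat -> T -> R) : 1 < m ->
  measurable_fun setT H -> measurable_fun setT w0 ->
  (\int[mu]_x (`|H x| `^ (m / (m - 1)))%:E < +oo)%E ->
  (\int[mu]_x (`|w0 x| `^ m)%:E < +oo)%E ->
  (forall n, \int[mu]_x (`|w n x| `^ m)%:E <= \int[mu]_x (`|w0 x| `^ m)%:E)%E ->
  (forall n, measurable_fun setT (w n)) ->
  L1_vanish (fun n x => w n x - w0 x) -> L1_vanish (fun n x => H x * (w n x - w0 x)).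
Proof.
move=> m1 mH mw0 Hi w0i wi mw wv; have m0 : 0 <= m by lra.
have pm (h : T -> R) : measurable_fun setT h -> measurable_fun setT (fun x => `|h x| `^ m).
  by move=> mh; apply: (measurableT_comp (measurable_powR _)); exact: measurableT_comp.
set I := (\int[mu]_x (`|w0 x| `^ m)%:E)%E in w0i wi.
have I0 : (0 <= I)%E by apply: integral_ge0 => x _; rewrite lee_fin powR_ge0.
have If : I \is a fin_num by rewrite ge0_fin_numE.
apply: (@L1_vanishM_Lp m (2 `^ m * (fine I + fine I))) => //.
  by rewrite mulr_ge0 ?powR_ge0// addr_ge0 ?fine_ge0.
move=> n; rewrite EFinM EFinD fineK//.
apply: (@le_trans _ _ (\int[mu]_x (2 `^ m * (`|w n x| `^ m + `|w0 x| `^ m))%:E)%E).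
  apply: ge0_le_integral_nm => x; rewrite lee_fin ?powR_ge0//.
  rewrite (le_trans _ (powRD_le m0 (normr_ge0 _) (normr_ge0 _)))//.
  by rewrite ge0_ler_powR ?nnegrE ?addr_ge0// ler_normB.
have pw (h : T -> R) x : 0 <= `|h x| `^ m by exact: powR_ge0.
have mn := pm _ (mw n); have mn0 := pm _ mw0.
have mS : measurable_fun setT (fun x => `|w n x| `^ m + `|w0 x| `^ m) by exact: measurable_funD.
have pS x : 0 <= `|w n x| `^ m + `|w0 x| `^ m by rewrite addr_ge0.
rewrite ge0_integralZ ?powR_ge0// ge0_integralDr//.
by rewrite lee_wpmul2l ?lee_fin ?powR_ge0// leeD.
Qed.

End L1_vanishing.

Section supp.
Context (R : realType) (N : nat).
Local Notation V := ('rV[R]_N * R)%type.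
Local Notation mu := (@lebesgue_xt R N).

Lemma hasgrad_supp (ph : V -> R) dph (K : set V) : closed K -> hasgrad ph dph ->
  (forall z, ~ K z -> ph z = 0) -> forall z k, ~ K z -> dph z k = 0.
Proof.
move=> cK hg h0 z k Kz; rewrite -(hasgrad_dir z k hg).
rewrite (@near_eq_derive _ _ _ ph (cst 0)) ?derive_cst//.
have : nbhs z (~` K) by apply: open_nbhs_nbhs; split => //; exact: closed_openC.
by apply: filterS => y; exact: h0.
Qed.

Lemma continuous_bounded_closed_box (th : V -> R) (M : R) : continuous th ->
  exists B, forall y, `|y| <= M -> `|th y| <= B.
Proof.
move=> ct; have /compact_bounded[B [_ hB]] : compact (th @` (closed_box M)).
  by apply: continuous_compact; [exact: continuous_subspaceT|exact: closed_box_compact].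
exists (`|B| + 1) => y yM; apply: hB; last by exists y.
by rewrite (le_lt_trans (ler_norm B))// ltrDl.
Qed.

Lemma continuous_bounded_test (th : V -> R) (M : R) : continuous th -> bounded_test M th.
Proof.
by move=> ct; split; [exact: continuous_measurable_xt|exact: continuous_bounded_closed_box].
Qed.

Lemma continuous_supp_bounded (th : V -> R) (M : R) : continuous th ->
  (forall y, M < `|y| -> th y = 0) -> exists2 B, 0 <= B & forall y, `|th y| <= B.
Proof.
move=> ct hM; have [B hB] := continuous_bounded_closed_box M ct.
exists `|B| => // y; have [yM|/hM ->] := leP `|y| M; last by rewrite normr0.
by rewrite (le_trans (hB _ yM))// ler_norm.
Qed.

Lemma continuous_supp_integrable (th : V -> R) (M : R) : continuous th ->
  (forall y, M < `|y| -> th y = 0) -> mu.-integrable setT (EFin \o th).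
Proof.
move=> ct hM; have [B B0 hB] := continuous_supp_bounded ct hM.
apply/integrableP; split; first by apply/measurable_EFinP; exact: continuous_measurable_xt.
apply: (@le_lt_trans _ _ (\int[mu]_(y in (closed_box M : set V)) B%:E)%E); last first.
  rewrite integral_cst_xt; last exact: measurable_closed_box.
  by rewrite lte_mul_pinfty ?lee_fin//; exact: closed_box_fin.
rewrite [leRHS]integral_mkcond; apply: ge0_le_integral_nm => y //.
rewrite patchE; case: ifPn => [_|]; first by rewrite /= lee_fin.
by rewrite notin_setE /closed_box/= => /negP; rewrite -ltNge => /hM ->; rewrite normr0.
Qed.

End supp.

(** * Testing the inequality with a function of the solution *)

Lemma integrable_sumr d (X : measurableType d) (R : realType) (mu : {measure set X -> \bar R})
  (I : Type) (s : seq I) (h : I -> X -> R) :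
  (forall i, mu.-integrable setT (EFin \o h i)) ->
  mu.-integrable setT (EFin \o (fun z => \sum_(i <- s) h i z)) /\
  Rintegral mu setT (fun z => \sum_(i <- s) h i z) = \sum_(i <- s) Rintegral mu setT (h i).
Proof.
move=> hi; elim: s => [|i s [IH1 IH2]].
  rewrite (_ : (fun z => _) = cst 0); last by apply/funext => z; rewrite big_nil.
  by split; [exact: integrable0|rewrite /Rintegral integral0 big_nil].
rewrite (_ : (fun z => _) = (fun z => h i z + \sum_(j <- s) h j z)); last first.
  by apply/funext => z; rewrite big_cons.
split; first by have := integrableD measurableT (hi i) IH1; apply: eq_integrable => // z _.
by rewrite RintegralD// IH2 big_cons.
Qed.

Section chain.
Context (R : realType) (N : nat).
Local Notation V := ('rV[R]_N * R)%type.
Local Notation mu := (@lebesgue_xt R N).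

Variables (m M ka r0 L : R).
Hypotheses (m1 : 1 < m) (M0 : 0 <= M) (r00 : 0 < r0) (L0 : 0 <= L).

(** For [ka > 0], compact subsets of the open upper half-space, which they exhaust. *)
Definition slab : set V := [set z | `|z| <= M /\ ka <= z.2].

Lemma closed_slab : closed slab.
Proof.
have -> : slab = closed_box M `&` (snd @^-1` [set t : R | ka <= t]) by [].
apply: closedI.
  by apply: compact_closed; [exact: norm_hausdorff|exact: closed_box_compact].
by apply: preimage_closed; [move=> z _; exact: cvg_snd|exact: closed_ge].
Qed.

Variables (f : V -> R) (d_ : option 'I_N -> V -> R) (F : 'I_N -> V -> R).
Hypothesis mf : measurable_fun setT f.
Hypothesis md : forall k, measurable_fun setT (d_ k).
Hypothesis mF : forall i, measurable_fun setT (F i).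
Hypothesis f0 : forall z, 0 <= f z.
Hypothesis fK : forall z, ~ slab z -> f z = 0.
Hypothesis dK : forall k z, ~ slab z -> d_ k z = 0.
Hypothesis FK : forall i z, ~ slab z -> F i z = 0.
Hypothesis fi : (\int[mu]_z `|f z|%:E < +oo)%E.
Hypothesis di : forall k, (\int[mu]_z `|d_ k z|%:E < +oo)%E.
Hypothesis dm : forall i, (\int[mu]_z (`|d_ (Some i) z| `^ m)%:E < +oo)%E.
Hypothesis Fi : forall i, (\int[mu]_z `|F i z|%:E < +oo)%E.
Hypothesis Fm : forall i, (\int[mu]_z (`|F i z| `^ (m / (m - 1)))%:E < +oo)%E.

Hypothesis weakd : forall (ph : V -> R) dph k, hasgrad ph dph ->
  (forall z, ~ slab z -> ph z = 0) -> pairing f (dph^~ k) = - pairing (d_ k) ph.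
Hypothesis ineq : forall (ph : V -> R) dph, hasgrad ph dph -> (forall z, 0 <= ph z) ->
  (forall z, ~ slab z -> ph z = 0) ->
  0 <= - pairing f (dph^~ None) + \sum_i pairing (F i) (dph^~ (Some i)).

Variables (psi : V -> R) (dpsi : V -> option 'I_N -> R).
Hypothesis hpsi : hasgrad psi dpsi.
Hypothesis psi0 : forall z, 0 <= psi z.
Hypothesis psiK : forall z, psi z != 0 -> `|z| <= M - r0 /\ ka + r0 <= z.2.

Variables (G g dg : R -> R).
Hypothesis mG : measurable_fun setT G.
Hypothesis mg : measurable_fun setT g.
Hypothesis mdg : measurable_fun setT dg.
Hypothesis Gder : forall a : R, 0 <= a -> is_derive a 1 G (g a).
Hypothesis gder : forall a : R, 0 <= a -> is_derive a 1 g (dg a).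
Hypothesis dgc : forall a : R, 0 <= a -> {for a, continuous dg}.
Hypothesis G00 : G 0 = 0.
Hypothesis g01 : forall a : R, 0 <= a -> 0 <= g a <= 1.
Hypothesis dgL : forall a : R, 0 <= a -> `|dg a| <= L.
Hypothesis Glip : forall a b : R, 0 <= a -> 0 <= b -> `|G a - G b| <= `|a - b|.
Hypothesis glip : forall a b : R, 0 <= a -> 0 <= b -> `|g a - g b| <= L * `|a - b|.
Hypothesis dglip : forall a b : R, 0 <= a -> 0 <= b -> `|dg a - dg b| <= L * `|a - b|.

Let MK (h : V -> R) : (forall z, ~ slab z -> h z = 0) -> forall y, M < `|y| -> h y = 0.
Proof. by move=> hK y My; apply: hK => -[yM _]; move: (lt_le_trans My yM); rewrite ltxx. Qed.

Let psiS z : ~ slab z -> psi z = 0.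
Proof.
move=> zK; apply/eqP; apply: contra_notT zK => /psiK[z1 z2]; split.
  by rewrite (le_trans z1)// gerBl ltW.
by rewrite (le_trans _ z2)// lerDl ltW.
Qed.

Let dpsiS z k : ~ slab z -> dpsi z k = 0.
Proof. exact: hasgrad_supp closed_slab hpsi psiS z k. Qed.

Let dn (n : nat) : R := r0 / n.+1%:R.
Let dn0 n : 0 < dn n. Proof. by rewrite divr_gt0. Qed.
Let dnr n : dn n <= r0. Proof. by rewrite ler_pdivrMr// ler_peMr ?(ltW r00)// ler1n. Qed.

Let fn n := mollify (dn n) f.
Let Df n z k := (kern_mass N (dn n))^-1 * - pairing f (fun y => dkern (dn n) k (y - z)).

Let fn_grad n : hasgrad (fn n) (Df n).
Proof. exact: mollify_hasgrad (MK fK) M0 _. Qed.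

Let fn0 n z : 0 <= fn n z.
Proof. exact: mollify_ge0. Qed.

(** On the support of [psi] the kernel around [z] is supported in the slab, so the
definition of the weak derivative applies to it. *)
Let Df_mollify n z k : psi z != 0 -> Df n z k = mollify (dn n) (d_ k) z.
Proof.
move=> /psiK[z1 z2]; rewrite /Df /mollify; congr (_ * _).
rewrite (weakd k (hasgrad_kern (dn n) z)) ?opprK// => y yK.
apply/eqP; apply: contra_notT yK => /(kern_supp (ltW (dn0 n))) yz.
have {}yz : `|y - z| <= r0 by rewrite (le_trans yz).
split.
  by have := ler_normD (y - z) z; rewrite subrK; lra.
have := ler_coord2 (y - z) => /=; rewrite ler_norml => /andP[]; lra.
Qed.

Let Phi n z := g (fn n z) * psi z.
Let dPhi n z k := g (fn n z) * dpsi z k + psi z * (dg (fn n z) * Df n z k).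
Let Phi_grad n : hasgrad (Phi n) (dPhi n).
Proof.
apply: hasgradM hpsi; apply: hasgrad_comp (fn_grad n) _ _ => z.
  exact: gder.
exact: dgc.
Qed.

Let dH n z k := G (fn n z) * dpsi z k + psi z * (g (fn n z) * Df n z k).
Let H_grad n : hasgrad (fun z => G (fn n z) * psi z) (dH n).
Proof.
apply: hasgradM hpsi; apply: hasgrad_comp (fn_grad n) _ _ => z; first exact: Gder.
apply: differentiable_continuous; apply/derivable1_diffP.
by have [] := gder (fn0 n z).
Qed.

Let PhiS n z : ~ slab z -> Phi n z = 0.
Proof. by move=> /psiS; rewrite /Phi => ->; rewrite mulr0. Qed.

Let HS n z : ~ slab z -> G (fn n z) * psi z = 0.
Proof. by move=> /psiS ->; rewrite mulr0. Qed.

Let dHS n z k : ~ slab z -> dH n z k = 0.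
Proof. exact: hasgrad_supp closed_slab (H_grad n) (@HS n) z k. Qed.

(** The integrand obtained from the weak inequality by inserting the test function
[g(f) psi] and integrating the time term [f_t g(f) psi] by parts as
[- G(f) psi_t], where [G' = g]; [d_] stands for the weak gradient of [f]. *)
Definition chain_lim z := - (G (f z) * dpsi z None) +
  \sum_i (F i z * (g (f z) * dpsi z (Some i)) + F i z * d_ (Some i) z * (psi z * dg (f z))).

(** The integrand of the weak inequality for [g(f_n) psi], with [f_n] a
mollification of [f], minus the time derivative of [G(f_n) psi], whose integral
is 0. *)
Let an n z := d_ None z * Phi n z + \sum_i F i z * dPhi n z (Some i) - dH n z None.

Let cPhi n : continuous (Phi n). Proof. exact: hasgrad_continuous (Phi_grad n). Qed.

Let cgrad (h : V -> R) dh k : hasgrad h dh -> continuous (dh^~ k).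
Proof. by move=> [_ ch]; exact: ch. Qed.

Let i1 n : mu.-integrable setT (EFin \o (fun z => d_ None z * Phi n z)).
Proof. exact: (pairing_integrable (md None) (di None) (MK (dK None)) (continuous_bounded_test M (@cPhi n))). Qed.

Let i2 n i : mu.-integrable setT (EFin \o (fun z => F i z * dPhi n z (Some i))).
Proof.
apply: (pairing_integrable (mF i) (Fi i) (MK (FK i))); apply: continuous_bounded_test.
exact: cgrad (Phi_grad n).
Qed.

Let i3 n : mu.-integrable setT (EFin \o (fun z => dH n z None)).
Proof.
apply: (@continuous_supp_integrable _ _ _ M); first exact: cgrad (H_grad n).
by apply: MK => z; exact: dHS.
Qed.

Let an_int n : mu.-integrable setT (EFin \o an n).
Proof.
have [h1 _] := integrable_sumr (index_enum _) (i2 n).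
have := integrableB measurableT (integrableD measurableT (i1 n) h1) (i3 n).
by apply: eq_integrable => // z _.
Qed.

Let an_ge0 n : 0 <= Rintegral mu setT (an n).
Proof.
have [h1 h2] := integrable_sumr (index_enum _) (i2 n).
have h3 := integrableD measurableT (i1 n) h1.
rewrite /an RintegralB//.
rewrite RintegralD//.
rewrite h2 [X in _ - X](_ : _ = 0) ?subr0; last first.
  rewrite /Rintegral (integral_dt_eq0 (M := M) (H_grad n))//.
  - by apply: MK => z; exact: HS.
  - by apply: MK => z; exact: dHS.
  - exact: i3.
have := ineq (Phi_grad n); rewrite (weakd None (Phi_grad n)); last exact: PhiS.
rewrite opprK; apply; last exact: PhiS.
by move=> z; rewrite mulr_ge0//; have /andP[] := g01 (fn0 n z).
Qed.

Let Cex : exists2 C, 0 <= C & (forall z, `|psi z| <= C) /\ forall k z, `|dpsi z k| <= C.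
Proof.
have [C0 C00 hC0] := continuous_supp_bounded (hasgrad_continuous hpsi) (MK psiS).
have hk k : exists B, 0 <= B /\ forall z, `|dpsi z k| <= B.
  have [B B0 hB] := @continuous_supp_bounded _ _ (dpsi^~ k) M (cgrad hpsi)
    (MK (fun z => @dpsiS z k)).
  by exists B.
have [B hB] := choice hk.
exists (C0 + \sum_k B k).
  by rewrite addr_ge0// sumr_ge0// => k _; have [] := hB k.
split=> [z|k z].
  by rewrite (le_trans (hC0 z))// lerDl sumr_ge0// => k _; have [] := hB k.
rewrite (bigD1 k)//= addrCA (le_trans (proj2 (hB k) z))// lerDl addr_ge0//.
by rewrite sumr_ge0// => j _; have [] := hB j.
Qed.

Let vmoll (h : V -> R) : measurable_fun setT h -> (\int[mu]_z `|h z|%:E < +oo)%E ->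
  (forall z, ~ slab z -> h z = 0) ->
  L1_vanish mu (fun n z => mollify (dn n) h z - h z).
Proof.
move=> mh hi hK; split.
  move=> n; apply: measurable_funB => //.
  exact: (measurable_mollify mh hi (MK hK) M0 _).
move=> e e0; have [dl dl0 H] := mollify_L1 mh hi (MK hK) e0.
near=> n; apply: H; rewrite dn0/=.
rewrite /dn ler_pdivrMr// mulrC -ler_pdivrMr//.
near: n; exists (Num.truncn (r0 / dl)).+1 => // n /= xn.
by rewrite (le_trans (ltW (truncnS_gt _)))// ler_nat (leq_trans xn).
Unshelve. all: by end_near. Qed.

Let mfn n : measurable_fun setT (fn n).
Proof. exact: (measurable_mollify mf fi (MK fK) M0 _). Qed.

Let mpsi : measurable_fun setT psi.
Proof. by apply: continuous_measurable_xt; exact: hasgrad_continuous hpsi. Qed.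

Let mdpsi k : measurable_fun setT (dpsi^~ k).
Proof. by apply: continuous_measurable_xt; exact: cgrad hpsi. Qed.

Let mcomp (h : R -> R) (w : V -> R) : measurable_fun setT h -> measurable_fun setT w ->
  measurable_fun setT (fun z => h (w z)).
Proof. by move=> mh mw; exact: (measurableT_comp mh mw). Qed.

Let vlip (h : R -> R) (C : R) : measurable_fun setT h -> 0 <= C ->
  (forall a b : R, 0 <= a -> 0 <= b -> `|h a - h b| <= C * `|a - b|) ->
  L1_vanish mu (fun n z => h (fn n z) - h (f z)).
Proof.
move=> mh C0 hC.
apply: (@L1_vanish_le _ _ _ _ _ (fun n z => (fn n z - f z) * C)).
- by move=> n; apply: measurable_funB; apply: mcomp.
- by move=> n z; rewrite normrM (ger0_norm C0) mulrC; exact: hC (fn0 n z) (f0 z).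
by apply: (@L1_vanishMb _ _ _ _ _ (fun _ _ => C) `|C|) => //; exact: vmoll.
Qed.

Let Fd_int i : (\int[mu]_z `|F i z * d_ (Some i) z|%:E < +oo)%E.
Proof. exact: (integrable_Lp_prod m1 (mF i) (md (Some i)) (Fm i) (dm i)). Qed.

Lemma chain_lim_integrable : mu.-integrable setT (EFin \o chain_lim).
Proof.
have [C C0 [C1 C2]] := Cex.
have bnd (H b : V -> R) (B : R) : measurable_fun setT H -> measurable_fun setT b ->
    (\int[mu]_z `|H z|%:E < +oo)%E -> (forall z, `|b z| <= B) ->
    mu.-integrable setT (EFin \o (fun z => H z * b z)).
  move=> mH mb Hi bB.
  have HI : mu.-integrable setT (EFin \o H) by apply/integrableP; split => //; exact/measurable_EFinP.
  have := integrableZl measurableT B HI; apply: le_integrable => //.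
    by apply/measurable_EFinP; exact: measurable_funM.
  move=> z _; rewrite /= lee_fin !normrM mulrC ler_wpM2r//.
  by rewrite (le_trans (bB z))// ler_norm.
have j1 : mu.-integrable setT (EFin \o (fun z => G (f z) * dpsi z None)).
  apply: (bnd _ _ C) => //; first exact: mcomp.
  apply: le_lt_trans fi; apply: ge0_le_integral_nm => z; rewrite lee_fin//.
  by have := Glip (f0 z) (lexx 0); rewrite G00 !subr0.
have j2 i : mu.-integrable setT (EFin \o (fun z => F i z * (g (f z) * dpsi z (Some i))
    + F i z * d_ (Some i) z * (psi z * dg (f z)))).
  have k1 : mu.-integrable setT (EFin \o (fun z => F i z * (g (f z) * dpsi z (Some i)))).
    apply: (bnd _ _ C) => //; first by apply: measurable_funM => //; exact: mcomp.
    move=> z; rewrite normrM -[leRHS]mul1r ler_pM//.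
    by have /andP[? ?] := g01 (f0 z); rewrite ger0_norm.
  have k2 : mu.-integrable setT (EFin \o (fun z => F i z * d_ (Some i) z * (psi z * dg (f z)))).
    apply: (bnd (fun z => F i z * d_ (Some i) z) _ (C * L)) => //.
    - exact: measurable_funM.
    - by apply: measurable_funM => //; exact: mcomp.
    - by move=> z; rewrite normrM ler_pM// dgL.
  by have := integrableD measurableT k1 k2; apply: eq_integrable => // z _.
have [h1 _] := integrable_sumr (index_enum _) j2.
have := integrableD measurableT (integrableN j1) h1.
by apply: eq_integrable => // z _.
Qed.

Let an_cvg : L1_vanish mu (fun n z => an n z - chain_lim z).
Proof.
have [C C0 [C1 C2]] := Cex.
have gb n z : `|g (fn n z)| <= 1.
  by have /andP[? ?] := g01 (fn0 n z); rewrite ger0_norm.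
have dgb n z : `|dg (fn n z)| <= L by exact: dgL.
(* Each of the five differences has a factor that tends to 0 in L^1: a
   mollification error, or a Lipschitz function of it. *)
pose t1 n z := (mollify (dn n) (d_ None) z - d_ None z) * - (g (fn n z) * psi z).
pose t2 n z := (G (fn n z) - G (f z)) * - dpsi z None.
pose t3 i n z := F i z * (g (fn n z) - g (f z)) * dpsi z (Some i).
pose t4 i n z := F i z * (mollify (dn n) (d_ (Some i)) z - d_ (Some i) z) * (psi z * dg (fn n z)).
pose t5 i n z := F i z * d_ (Some i) z * (dg (fn n z) - dg (f z)) * psi z.
have E : (fun n z => an n z - chain_lim z) =
    (fun n z => t1 n z + t2 n z + \sum_i (t3 i n z + t4 i n z + t5 i n z)).
  apply/funext => n; apply/funext => z.
  have pD k : psi z * Df n z k = psi z * mollify (dn n) (d_ k) z.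
    by have [->|/(Df_mollify n k) ->//] := eqVneq (psi z) 0; rewrite !mul0r.
  rewrite (_ : an n z - chain_lim z = d_ None z * Phi n z - dH n z None + G (f z) * dpsi z None +
    (\sum_i F i z * dPhi n z (Some i) - \sum_i (F i z * (g (f z) * dpsi z (Some i))
    + F i z * d_ (Some i) z * (psi z * dg (f z))))); last by rewrite /an /chain_lim; ring.
  congr (_ + _).
    rewrite /t1 /t2 /Phi /dH (_ : psi z * (g (fn n z) * Df n z None) = g (fn n z) * (psi z * Df n z None)); last ring.
    by rewrite pD; ring.
  rewrite -sumrB; apply: eq_bigr => i _; rewrite /dPhi /t3 /t4 /t5.
  rewrite (_ : psi z * (dg (fn n z) * Df n z (Some i)) = dg (fn n z) * (psi z * Df n z (Some i))); last ring.
  by rewrite pD; ring.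
rewrite E; apply: L1_vanishD; first apply: L1_vanishD.
- apply: (@L1_vanishMb _ _ _ _ _ _ C); last by apply: vmoll => //; exact: dK.
    by move=> n; apply: measurableT_comp => //; apply: measurable_funM => //; exact: mcomp.
  by move=> n z; rewrite normrN normrM -[leRHS]mul1r ler_pM.
- apply: (@L1_vanishMb _ _ _ _ _ _ C).
  + by move=> n; exact: measurableT_comp.
  + by move=> n z; rewrite normrN.
  by apply: (@vlip _ 1) => // a b a0 b0; rewrite mul1r Glip.
apply: L1_vanish_sum => i; apply: L1_vanishD; first apply: L1_vanishD.
- apply: (@L1_vanishMb _ _ _ _ _ _ C) => //.
  apply: (@L1_vanishM_bounded _ _ _ _ _ _ 2) => //; last exact: (@vlip _ L).
  move=> n z; have /andP[? ?] := g01 (f0 z); have /andP[? ?] := g01 (fn0 n z).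
  by rewrite ler_norml; apply/andP; split; lra.
- apply: (@L1_vanishMb _ _ _ _ _ _ (C * L)).
  + by move=> n; apply: measurable_funM => //; exact: mcomp.
  + by move=> n z; rewrite normrM ler_pM.
  apply: (@L1_vanishM_Lp2 _ _ _ _ m) => //.
  + move=> n; exact: (mollify_Lp (md (Some i)) (di (Some i)) (MK (dK (Some i))) (dn0 n) m1).
  + by move=> n; exact: (measurable_mollify (md (Some i)) (di (Some i)) (MK (dK (Some i))) M0 _).
  + by apply: vmoll => //; exact: dK.
apply: (@L1_vanishMb _ _ _ _ _ _ C) => //.
apply: (@L1_vanishM_bounded _ _ _ _ (fun z => F i z * d_ (Some i) z) _ (2 * L)) => //.
- exact: measurable_funM.
- by rewrite mulr_ge0.
- move=> n z; rewrite (le_trans (ler_normB _ _))// mulr2n mulrDl !mul1r lerD// dgL//.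
- exact: (@vlip _ L).
Qed.

(** The C^1 function [g(f_n) psi], with [f_n] a mollification of [f], is admissible
in the weak inequality and the corresponding integrands converge in L^1. *)
Lemma chain_test : 0 <= Rintegral mu setT chain_lim.
Proof.
have ic := chain_lim_integrable.
apply/ler_addgt0Pr => e e0; have [_ /(_ e e0)[n _ /(_ n (leqnn n)) hn]] := an_cvg.
have idf : mu.-integrable setT (EFin \o (fun z => an n z - chain_lim z)).
  by have := integrableB measurableT (an_int n) ic; apply: eq_integrable => // z _.
suff : Rintegral mu setT (an n) - Rintegral mu setT chain_lim <= e.
  by rewrite lerBlDl; exact: le_trans (an_ge0 n).
rewrite -(RintegralB measurableT (an_int n) ic).
apply: le_trans (ler_norm _) _.
apply: le_trans (le_normr_Rintegral measurableT idf) _.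
rewrite -lee_fin /Rintegral fineK//.
rewrite ge0_fin_numE; first exact: le_lt_trans hn (ltry _).
by apply: integral_ge0 => z _; rewrite lee_fin.
Qed.

End chain.

(** * Cut-off functions *)

Section pospow.
Context (R : realType).

(** At 0 the function is bounded by a square, hence has derivative 0. *)
Lemma is_derive_pospow (l : nat) (s : R) : (1 < l)%N ->
  is_derive s 1 (fun x => pos_part x ^+ l) (l%:R * pos_part s ^+ l.-1).
Proof.
move=> l1; have [s0|s0|s0] := ltgtP s 0.
- have -> : l%:R * pos_part s ^+ l.-1 = 0.
    by rewrite /pos_part max_r ?expr0n ?(ltW s0)//; case: l l1 => [|[|l]]//=; rewrite mulr0.
  refine (near_eq_is_derive _ (is_derive_cst (0 : R) s 1)).
  near=> x; rewrite /pos_part max_r ?expr0n; last first.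
    by apply: ltW; near: x; exact: lt_nbhsl.
  by case: l l1.
- have -> : pos_part s = s by rewrite /pos_part max_l// ltW.
  have H : is_derive s 1 (fun x => x ^+ l) (l%:R * s ^+ l.-1).
    apply: DeriveDef; first exact: exprn_derivable.
    by rewrite exp_derive [LHS]mulr1.
  refine (near_eq_is_derive _ H).
  by near=> x; rewrite /pos_part max_l//; apply: ltW; near: x; exact: lt_nbhsr.
rewrite s0 /pos_part max_r// (_ : l%:R * _ = 0); last first.
  by case: l l1 => [|[|l]]//= _; rewrite expr0n mulr0.
have d0 : is_diff (0 : R) (fun x => pos_part x ^+ l) (fun _ => 0 : R).
  apply: (@is_diff_sqr_remainder _ _ _ _ _ 1 1) => //.
  - by move=> a u v; rewrite mulr0 addr0.
  - by move=> h; rewrite normr0 mul1r.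
  move=> h h1; rewrite mul1r.
  have p0 : `|pos_part h| <= `|h|.
    by have := pos_lip 0 h; rewrite add0r [X in _ - X]maxxx subr0.
  have E : pos_part h ^+ l = pos_part (h + 0) ^+ l - pos_part 0 ^+ l - 0.
    rewrite addr0 subr0 /pos_part [X in _ - X](_ : _ = 0) ?subr0//.
    by rewrite max_r// expr0n; case: l l1.
  apply: (@le_trans _ _ `|pos_part h ^+ l|); first by rewrite E.
  rewrite normrX (le_trans (lerXn2r l _ _ p0)) ?nnegrE//.
  by rewrite ler_wiXn2l// ltW.
have [e1 e2] := d0; apply: DeriveDef; first exact/derivable1_diffP.
by rewrite deriveE// e2.
Unshelve. all: by end_near. Qed.

Lemma continuous_pospow (l : nat) : continuous (fun x : R => pos_part x ^+ l).
Proof.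
move=> x; apply: (@continuous_comp _ _ _ (fun x : R => pos_part x) (fun y => y ^+ l)).
  by apply: (@continuous_max _ _ id (cst 0)); [exact: cvg_id|exact: cvg_cst].
exact: exprn_continuous.
Qed.

Lemma continuous_dpospow (l : nat) : continuous (fun x : R => l%:R * pos_part x ^+ l.-1).
Proof. by move=> x; apply: cvgMl_tmp; exact: continuous_pospow. Qed.

Lemma pos_le1 (s : R) : s <= 1 -> pos_part s <= 1.
Proof. by move=> s1; rewrite /pos_part ge_max s1 ler01. Qed.

End pospow.

Section cutoff.
Context (R : realType) (N : nat).
Local Notation V := ('rV[R]_N * R)%type.

Lemma hasgrad_cst (c : R) : hasgrad (fun _ : V => c) (fun _ _ => 0).
Proof.
split=> [z|k z]; last exact: cvg_cst.
apply: (@is_diff_sqr_remainder _ _ _ _ _ 1 1) => //.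
- exact: lincomb_linear.
- by move=> h; rewrite /lincomb big1 ?normr0 ?mul1r// => k _; rewrite mulr0.
- by move=> h _; rewrite subrr /lincomb big1 ?subrr ?normr0 ?mul1r ?sqr_ge0// => k _; rewrite mulr0.
Qed.

Lemma hasgrad_xt_coord (k : option 'I_N) : hasgrad (xt_coord k : V -> R) (fun _ j => (j == k)%:R).
Proof.
have E (h : V) : lincomb (fun j => (j == k)%:R) h = xt_coord k h.
  rewrite /lincomb (bigD1 k)//= eqxx mulr1 big1 ?addr0// => j /negbTE ->.
  by rewrite mulr0.
split=> [z|j z]; last exact: cvg_cst.
apply: (@is_diff_sqr_remainder _ _ _ _ _ 1 1) => //.
- exact: lincomb_linear.
- by move=> h; rewrite E mul1r; exact: ler_xt_coord.
- by move=> h _; rewrite E xt_coordD addrK subrr normr0 mul1r sqr_ge0.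
Qed.

Lemma eq_hasgrad (F F' : V -> R) G G' : hasgrad F G -> F =1 F' -> (forall z k, G z k = G' z k) ->
  hasgrad F' G'.
Proof.
move=> h /funext <- e; rewrite (_ : G' = G)//.
by apply/funext => z; apply/funext => k; rewrite e.
Qed.

Lemma hasgradD (F1 F2 : V -> R) G1 G2 : hasgrad F1 G1 -> hasgrad F2 G2 ->
  hasgrad (fun z => F1 z + F2 z) (fun z k => G1 z k + G2 z k).
Proof.
move=> [d1 c1] [d2 c2]; split=> [z|k z]; last by apply: cvgD; [exact: c1|exact: c2].
have := is_diffD (d1 z) (d2 z).
rewrite (_ : lincomb (G1 z) + lincomb (G2 z) = lincomb (fun k => G1 z k + G2 z k))//.
apply/funext => v; rewrite -[LHS]/(lincomb (G1 z) v + lincomb (G2 z) v) /lincomb -big_split/=.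
by apply: eq_bigr => k _; rewrite mulrDr.
Qed.

Lemma hasgrad_sum (I : Type) (s : seq I) (F : I -> V -> R) G :
  (forall i, hasgrad (F i) (G i)) ->
  hasgrad (fun z => \sum_(i <- s) F i z) (fun z k => \sum_(i <- s) G i z k).
Proof.
move=> h; elim: s => [|i s IH].
  by apply: (eq_hasgrad (hasgrad_cst 0)) => [z|z k]; rewrite big_nil.
by apply: (eq_hasgrad (hasgradD (h i) IH)) => [z|z k]; rewrite big_cons.
Qed.

Definition space_sq (z : V) : R := \sum_(i < N) z.1 0 i ^+ 2.

Lemma space_sq_ge0 z : 0 <= space_sq z.
Proof. by apply: sumr_ge0 => i _; exact: sqr_ge0. Qed.

Lemma coord_space_sq (z : V) i : z.1 0 i ^+ 2 <= space_sq z.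
Proof.
by rewrite /space_sq (bigD1 i)//= lerDl; apply: sumr_ge0 => j _; exact: sqr_ge0.
Qed.

Lemma hasgrad_space_sq : hasgrad space_sq (fun z k => if k is Some i then 2 * z.1 0 i else 0).
Proof.
have h i := hasgradM (hasgrad_xt_coord (Some i)) (hasgrad_xt_coord (Some i)).
apply: (eq_hasgrad (hasgrad_sum (index_enum _) h)) => [z|z k].
  by apply: eq_bigr => i _; rewrite expr2.
case: k => [i|]; last by apply: big1 => i _; rewrite /= mulr0 addr0.
rewrite (bigD1 i)//= eqxx mulr1 big1 ?addr0; first by rewrite mulr2n mulrDl mul1r.
move=> j ji; rewrite (_ : (Some i == Some j) = false) ?mulr0 ?addr0//.
by apply/negbTE; apply: contra ji => /eqP[->].
Qed.

Variables (rr T : R) (l : nat).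
Hypotheses (rr0 : 0 < rr) (T0 : 0 < T) (l1 : (1 < l)%N).

Definition space_cut (z : V) : R := pos_part (1 - space_sq z / (4 * rr ^+ 2)).
Definition time_cut (z : V) : R := pos_part (1 - z.2 ^+ 2 / T ^+ 2).
(** The function eta of the introduction; [cutoff] is its power [l]. *)
Definition cutoff_base (z : V) : R := space_cut z * time_cut z.
Definition cutoff (z : V) : R := cutoff_base z ^+ l.
Definition dcutoff (z : V) (k : option 'I_N) : R :=
  if k is Some i then
    - (l%:R * space_cut z ^+ l.-1 * (2 * z.1 0 i / (4 * rr ^+ 2)) * time_cut z ^+ l)
  else - (space_cut z ^+ l * (l%:R * time_cut z ^+ l.-1 * (2 * z.2 / T ^+ 2))).

Lemma space_cut01 z : 0 <= space_cut z <= 1.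
Proof.
rewrite pos_ge0 pos_le1// gerBl divr_ge0 ?space_sq_ge0//.
by rewrite mulr_ge0// sqr_ge0.
Qed.

Lemma time_cut01 z : 0 <= time_cut z <= 1.
Proof. by rewrite pos_ge0 pos_le1// gerBl divr_ge0 ?sqr_ge0. Qed.

Lemma cutoff_base_ge0 z : 0 <= cutoff_base z.
Proof. by have /andP[? _] := space_cut01 z; have /andP[? _] := time_cut01 z; rewrite mulr_ge0. Qed.

Lemma cutoff_base_le1 z : cutoff_base z <= 1.
Proof.
have /andP[? ?] := space_cut01 z; have /andP[? ?] := time_cut01 z.
by rewrite /cutoff_base mulr_ile1.
Qed.

Lemma cutoff_ge0 z : 0 <= cutoff z. Proof. by rewrite exprn_ge0// cutoff_base_ge0. Qed.
Lemma cutoff_le1 z : cutoff z <= 1. Proof. by rewrite exprn_ile1// ?cutoff_base_ge0// cutoff_base_le1. Qed.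

Lemma space_cut_supp z i : space_cut z != 0 -> `|z.1 0 i| <= 2 * rr.
Proof.
move=> c0; rewrite -ler_sqr ?nnegrE ?mulr_ge0 ?(ltW rr0)// real_normK ?num_real//.
rewrite (le_trans (coord_space_sq z i))// leNgt; apply: contra c0 => h.
rewrite /space_cut /pos_part max_r// subr_le0 ler_pdivlMr ?mul1r ?mulr_gt0 ?exprn_gt0//.
by apply: ltW; move: h; rewrite exprMn; rewrite (_ : 2 ^+ 2 = 4)//; rewrite -natrX.
Qed.

Lemma time_cut_supp z : time_cut z != 0 -> `|z.2| <= T.
Proof.
move=> c0; rewrite -ler_sqr ?nnegrE ?(ltW T0)// real_normK ?num_real//.
rewrite leNgt; apply: contra c0 => h.
by rewrite /time_cut /pos_part max_r// subr_le0 ler_pdivlMr ?mul1r ?exprn_gt0// ltW.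
Qed.

Lemma cutoff_base_supp z : cutoff_base z != 0 -> (forall i, `|z.1 0 i| <= 2 * rr) /\ `|z.2| <= T.
Proof.
rewrite /cutoff_base mulf_eq0 negb_or => /andP[h1 h2].
by split; [move=> i; exact: space_cut_supp|exact: time_cut_supp].
Qed.

Lemma cutoff_supp z : cutoff z != 0 -> (forall i, `|z.1 0 i| <= 2 * rr) /\ `|z.2| <= T.
Proof.
move=> p0; apply: cutoff_base_supp; apply: contraNneq p0 => e0.
by rewrite /cutoff e0 expr0n gtn_eqF// ltnW.
Qed.

Lemma cutoff_closed_box z : cutoff z != 0 -> `|z| <= 2 * rr + T.
Proof.
move=> /cutoff_supp[zx zt]; apply: ler_norm_xt => [|i|].
- by rewrite addr_ge0 ?mulr_ge0 ?ltW.
- by rewrite (le_trans (zx i))// lerDl ltW.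
- by rewrite (le_trans zt)// lerDr mulr_ge0// ltW.
Qed.

Lemma hasgrad_cutoff : hasgrad cutoff dcutoff.
Proof.
have h1 : hasgrad (fun z => 1 - space_sq z / (4 * rr ^+ 2))
    (fun z k => if k is Some i then - (2 * z.1 0 i / (4 * rr ^+ 2)) else 0).
  apply: (eq_hasgrad (hasgradD (hasgrad_cst 1)
    (hasgradM (hasgrad_cst (- (4 * rr ^+ 2)^-1)) hasgrad_space_sq))) => [z|z [i|]].
  - by rewrite mulNr mulrC.
  - by rewrite mulr0 add0r addr0 mulNr mulrC.
  - by rewrite !mulr0 add0r addr0.
have h2 : hasgrad (fun z : V => 1 - z.2 ^+ 2 / T ^+ 2)
    (fun z k => if k is Some i then 0 else - (2 * z.2 / T ^+ 2)).
  have hc := hasgrad_xt_coord None.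
  apply: (eq_hasgrad (hasgradD (hasgrad_cst 1)
    (hasgradM (hasgrad_cst (- (T ^+ 2)^-1)) (hasgradM hc hc)))) => [z|z [i|]].
  - by rewrite /= mulNr mulrC expr2.
  - by rewrite /= !mulr0 !addr0 mulr0 addr0.
  - by rewrite /= mulr1 mulr0 addr0 add0r; ring.
have g1 := hasgrad_comp h1 (fun z => is_derive_pospow _ l1) (fun z => @continuous_dpospow R l _).
have g2 := hasgrad_comp h2 (fun z => is_derive_pospow _ l1) (fun z => @continuous_dpospow R l _).
apply: (eq_hasgrad (hasgradM g1 g2)) => [z|z [i|]].
- by rewrite /cutoff /cutoff_base exprMn.
- by rewrite /dcutoff /space_cut /time_cut; ring.
- by rewrite /dcutoff /space_cut /time_cut; ring.
Qed.

Lemma norm_prod_cut (a b d x y : R) : 0 <= a -> 0 <= b -> 0 <= d -> 0 <= y ->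
  `|a * b * (2 * x / y) * d| = a * b * d * (2 * `|x| / y).
Proof.
move=> a0 b0 d0 y0; rewrite !normrM normfV (ger0_norm a0) (ger0_norm b0) (ger0_norm d0).
by rewrite (ger0_norm y0) (ger0_norm (ler0n _ 2)); ring.
Qed.

(** [|x_i| <= 2 rr] on the support, and [space_cut^(l-1) time_cut^l <= eta^(l-1)]. *)
Lemma dcutoff_x z i : `|dcutoff z (Some i)| <= l%:R / rr * cutoff_base z ^+ l.-1.
Proof.
have /andP[c0 c1] := space_cut01 z; have /andP[d0 d1] := time_cut01 z.
rewrite /dcutoff normrN.
have [E|E] := eqVneq (space_cut z) 0.
  rewrite E expr0n (_ : (_ == _) = false); last by case: l l1 => [|[|?]].
  rewrite mulr0 !mul0r normr0 mulr_ge0//; first by rewrite divr_ge0// ltW.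
  by rewrite exprn_ge0// cutoff_base_ge0.
rewrite norm_prod_cut ?exprn_ge0 ?mulr_ge0 ?exprn_ge0 ?(ltW rr0)//.
have H : 2 * `|z.1 0 i| * (4 * rr ^+ 2)^-1 <= rr^-1.
  rewrite ler_pdivrMr ?mulr_gt0 ?exprn_gt0//.
  rewrite (_ : rr^-1 * (4 * rr ^+ 2) = 4 * rr); last by field; rewrite gt_eqF.
  by have := space_cut_supp i E; lra.
rewrite -(mulrA l%:R).
rewrite (_ : l%:R / rr * _ = (l%:R * cutoff_base z ^+ l.-1) * rr^-1); last ring.
apply: (ler_pM _ _ _ H); [by rewrite !mulr_ge0 ?exprn_ge0|by apply: divr_ge0; apply: mulr_ge0 => //; exact: sqr_ge0|].
rewrite ler_wpM2l// /cutoff_base exprMn ler_wpM2l ?exprn_ge0//.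
by rewrite ler_wiXn2l// leq_pred.
Qed.

Lemma dcutoff_t z : `|dcutoff z None| <= 2 * l%:R / T * cutoff_base z ^+ l.-1.
Proof.
have /andP[c0 c1] := space_cut01 z; have /andP[d0 d1] := time_cut01 z.
rewrite /dcutoff normrN.
have [E|E] := eqVneq (time_cut z) 0.
  rewrite E expr0n (_ : (_ == _) = false); last by case: l l1 => [|[|?]].
  rewrite mulr0 !mul0r mulr0 normr0 mulr_ge0//; first by rewrite divr_ge0 ?mulr_ge0// ltW.
  by rewrite exprn_ge0// cutoff_base_ge0.
rewrite (_ : _ * _ = l%:R * space_cut z ^+ l * (2 * z.2 / T ^+ 2) * time_cut z ^+ l.-1); last ring.
rewrite norm_prod_cut ?exprn_ge0 ?(ltW T0)//.
have H : 2 * `|z.2| * (T ^+ 2)^-1 <= 2 / T.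
  rewrite ler_pdivrMr ?exprn_gt0//.
  rewrite (_ : 2 / T * T ^+ 2 = 2 * T); last by field; rewrite gt_eqF.
  by have := time_cut_supp E; lra.
rewrite -(mulrA l%:R).
rewrite (_ : 2 * l%:R / T * _ = (l%:R * cutoff_base z ^+ l.-1) * (2 / T)); last ring.
apply: (ler_pM _ _ _ H); [by rewrite !mulr_ge0 ?exprn_ge0|by apply: divr_ge0; [exact: mulr_ge0|exact: sqr_ge0]|].
rewrite ler_wpM2l// /cutoff_base exprMn ler_wpM2r ?exprn_ge0//.
by rewrite ler_wiXn2l// leq_pred.
Qed.

(** A C^1 increasing function, 0 on the negative axis and tending to 1 at infinity. *)
Definition ramp (s : R) : R := pos_part s ^+ 2 / (1 + pos_part s ^+ 2).
Definition dramp (s : R) : R := 2 * pos_part s / (1 + pos_part s ^+ 2) ^+ 2.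

Lemma is_derive_ramp (s : R) : is_derive s 1 ramp (dramp s).
Proof.
have p := @is_derive_pospow R 2 s erefl.
have q : is_derive s 1 (fun x : R => 1 + pos_part x ^+ 2) (0 + 2 * pos_part s ^+ 1).
  exact: is_deriveD.
have n0 : 1 + pos_part s ^+ 2 != 0 by rewrite gt_eqF// ltr_pwDl// sqr_ge0.
have v := @is_deriveV R (fun x : R => 1 + pos_part x ^+ 2) s _ 1 n0 q.
have := is_deriveM p v.
rewrite (_ : _ + _ = dramp s)//.
rewrite /dramp /GRing.scale/= expr1 add0r; field.
by rewrite gt_eqF// ltr_pwDl// sqr_ge0.
Qed.

Lemma continuous_dramp : continuous dramp.
Proof.
move=> s; have n0 : (1 + pos_part s ^+ 2) ^+ 2 != 0.
  by rewrite expf_neq0// gt_eqF// ltr_pwDl// sqr_ge0.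
apply: cvgM.
  by apply: cvgMl_tmp; have := @continuous_pospow R 1 s; under eq_fun do rewrite expr1.
apply: cvgV => //.
apply: (@continuous_comp _ _ _ (fun s : R => 1 + pos_part s ^+ 2) (fun y => y ^+ 2)).
  by apply: cvgD; [exact: cvg_cst|exact: continuous_pospow].
exact: exprn_continuous.
Qed.

Lemma ramp01 s : 0 <= ramp s <= 1.
Proof.
have p0 := sqr_ge0 (pos_part s); rewrite /ramp divr_ge0//=; last lra.
by rewrite ler_pdivrMr ?mul1r; lra.
Qed.

Lemma dramp_ge0 s : 0 <= dramp s.
Proof. by apply: divr_ge0; [apply: mulr_ge0 => //; exact: pos_ge0|exact: sqr_ge0]. Qed.

Lemma ramp_supp s : ramp s != 0 -> 0 <= s.
Proof.
rewrite leNgt; apply: contra => s0.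
by rewrite /ramp /pos_part max_r ?(ltW s0)// expr0n mul0r.
Qed.

(** Increasing to 1 on [t > 0] and vanishing for [t <= 1 / (n + 1)]: it keeps the
support of the test function away from the initial time. *)
Definition time_ramp (n : nat) (z : V) : R := ramp (n.+1%:R * z.2 - 1).
Definition dtime_ramp (n : nat) (z : V) (k : option 'I_N) : R :=
  if k is Some i then 0 else dramp (n.+1%:R * z.2 - 1) * n.+1%:R.

Lemma hasgrad_time_ramp n : hasgrad (time_ramp n) (dtime_ramp n).
Proof.
have h : hasgrad (fun z : V => n.+1%:R * z.2 - 1) (fun z k => if k is Some i then 0 else n.+1%:R).
  apply: (eq_hasgrad (hasgradD (hasgradM (hasgrad_cst n.+1%:R) (hasgrad_xt_coord None)) (hasgrad_cst (-1)))) => [z|z [i|]] //=.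
    by rewrite !mulr0 !addr0.
  by rewrite mulr1 mulr0 !addr0.
have g := hasgrad_comp h (fun z => is_derive_ramp _) (fun z => @continuous_dramp _).
by apply: (eq_hasgrad g) => [z|z [i|]] //=; rewrite mulr0.
Qed.

Lemma time_ramp_ge n (z : V) : 0 < z.2 -> 1 - 2 / z.2 * harmonic n <= time_ramp n z.
Proof.
move=> z0; rewrite /time_ramp /ramp /harmonic/=.
have n0 : 0 < n.+1%:R * z.2 by rewrite mulr_gt0.
have -> : 2 / z.2 * n.+1%:R^-1 = 2 / (n.+1%:R * z.2) by rewrite -mulrA -invfM [z.2 * _]mulrC.
move: (n.+1%:R * z.2) n0 => b b0.
have [b1|b1] := leP b 1.
  apply: (@le_trans _ _ 0); last by rewrite divr_ge0 ?addr_ge0 ?sqr_ge0.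
  by rewrite subr_le0 ler_pdivlMr// mul1r; lra.
have -> : pos_part (b - 1) = b - 1 by rewrite /pos_part max_l//; lra.
have E : 0 < 1 + (b - 1) ^+ 2 by rewrite ltr_pwDl// sqr_ge0.
rewrite lerBlDr (_ : (b - 1) ^+ 2 / _ = 1 - (1 + (b - 1) ^+ 2)^-1); last by field; rewrite gt_eqF.
rewrite -addrA lerDl addrC subr_ge0 ler_pdivlMr// [_^-1 * _]mulrC ler_pdivrMr//.
rewrite -subr_ge0 (_ : _ - _ = 2 * (b - 5 / 4) ^+ 2 + 7 / 8); last by field.
by apply: addr_ge0; [rewrite mulr_ge0 ?sqr_ge0|].
Qed.

Lemma time_ramp_cvg (z : V) : 0 < z.2 -> (fun n => time_ramp n z) @ \oo --> (1 : R).
Proof.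
move=> z0; have h1 : (fun _ : nat => 1 : R) @ \oo --> (1 : R) by exact: cvg_cst.
have h0 : (fun n => 1 - 2 / z.2 * harmonic n) @ \oo --> (1 : R).
  rewrite -[X in _ --> X]subr0; apply: cvgB; first exact: cvg_cst.
  by rewrite -(mulr0 (2 / z.2)); apply: cvgMl_tmp; exact: cvg_harmonic.
apply: (squeeze_cvgr _ h0 h1).
by near=> n; rewrite time_ramp_ge//=; have /andP[] := ramp01 (n.+1%:R * z.2 - 1).
Unshelve. all: by end_near. Qed.

End cutoff.

(** * Damping functions and Young's inequality *)

Section power.
Context (R : realType) (ep : R).
Hypothesis ep0 : 0 < ep.

Definition shifted_powR (r a : R) : R := (1 + a / ep) `^ r.

Lemma shbase_ge1 (a : R) : 0 <= a -> 1 <= 1 + a / ep.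
Proof. by move=> a0; rewrite lerDl divr_ge0// ltW. Qed.

Lemma shifted_powR_ge0 (r a : R) : 0 <= shifted_powR r a. Proof. exact: powR_ge0. Qed.

Lemma shifted_powR_gt0 (r a : R) : 0 <= a -> 0 < shifted_powR r a.
Proof. by move=> a0; rewrite powR_gt0// (lt_le_trans ltr01)// shbase_ge1. Qed.

Lemma shifted_powR_le1 (r a : R) : 0 <= a -> r <= 0 -> shifted_powR r a <= 1.
Proof. by move=> a0 r0; rewrite -(powRr0 (1 + a / ep)) ler_powR// shbase_ge1. Qed.

Lemma shifted_powR_ge1 (r a : R) : 0 <= a -> 0 <= r -> 1 <= shifted_powR r a.
Proof. by move=> a0 r0; rewrite -(powRr0 (1 + a / ep)) ler_powR// shbase_ge1. Qed.

Lemma measurable_shifted_powR r : measurable_fun setT (shifted_powR r).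
Proof.
apply: (measurableT_comp (measurable_powR r)).
by apply: measurable_funD => //; apply: measurable_funM.
Qed.

Lemma is_derive_shifted_powR (r a : R) : 0 <= a -> is_derive a 1 (shifted_powR r) (r / ep * shifted_powR (r - 1) a).
Proof.
move=> a0; have b0 : 0 < 1 + a / ep by rewrite (lt_le_trans ltr01)// shbase_ge1.
have h : is_derive a 1 (fun x : R => 1 + x / ep) (0 + ep^-1).
  apply: is_deriveD.
  have := @is_deriveZ R R R id ep^-1 a 1 1 (is_derive_id a 1).
  rewrite (_ : (ep^-1 \*: id) = (fun x : R => x / ep)); last first.
    by apply/funext => x /=; rewrite [LHS]mulrC.
  by rewrite [_ *: _]mulr1.
have := @is_derive1_comp R (fun x => x `^ r) (fun x : R => 1 + x / ep) a _ _ (is_derive1_powR r b0) h.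
rewrite (_ : _ * (0 + ep^-1) = r / ep * shifted_powR (r - 1) a)//.
by rewrite add0r /shifted_powR mulrAC.
Qed.

(** Mean value theorem on the half-line. *)
Lemma lipschitz_nneg (h dh : R -> R) (L : R) :
  (forall a : R, 0 <= a -> is_derive a 1 h (dh a)) ->
  (forall a : R, 0 <= a -> `|dh a| <= L) -> forall a b : R, 0 <= a -> 0 <= b -> `|h a - h b| <= L * `|a - b|.
Proof.
move=> hd hL; wlog ab : / forall a b : R, 0 <= a -> 0 <= b -> b <= a -> `|h a - h b| <= L * `|a - b|.
  apply=> a b a0 b0 ba.
  have cd x : x \in `]b, a[ -> is_derive x 1 h (dh x).
    by rewrite in_itv/= => /andP[bx _]; apply: hd; rewrite (le_trans b0)// ltW.
  have cc : {within `[b, a], continuous h}.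
    apply: derivable_within_continuous => x; rewrite in_itv/= => /andP[bx _].
    by have [] := hd x (le_trans b0 bx).
  have [x] := MVT_segment ba cd cc.
  rewrite in_itv/= => /andP[bx _] ->; rewrite normrM ler_wpM2r//.
  by apply: hL; exact: le_trans bx.
move=> a b a0 b0; have [ba|/ltW ba] := leP b a; first exact: ab.
by rewrite distrC [X in _ * X]distrC; exact: ab.
Qed.

End power.

Section gfun.
Context (R : realType) (al ep : R).
Hypotheses (ep0 : 0 < ep) (al0 : 0 < al) (al1 : al < 1).

(** The test multiplier (1 + u / ep)^(-al); [damp_rate] is minus its derivative and
[damp_prim] its primitive vanishing at 0, which is where [al < 1] is used. *)
Definition damp := shifted_powR ep (- al).
Definition damp_rate a := al / ep * shifted_powR ep (- al - 1) a.
Definition ddamp a := - damp_rate a.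
Definition damp_prim a := ep / (1 - al) * (shifted_powR ep (1 - al) a - 1).
Definition damp_bound := al / ep + al / ep * ((al + 1) / ep).

Lemma damp_rate_ge0 (a : R) : 0 <= damp_rate a.
Proof. by rewrite mulr_ge0 ?shifted_powR_ge0// divr_ge0// ltW. Qed.
Lemma damp_rate_gt0 (a : R) : 0 <= a -> 0 < damp_rate a.
Proof. by move=> a0; rewrite mulr_gt0 ?shifted_powR_gt0// divr_gt0. Qed.

Lemma measurable_damp_rate : measurable_fun setT damp_rate.
Proof. by apply: measurable_funM => //; exact: measurable_shifted_powR. Qed.
Lemma measurable_damp : measurable_fun setT damp.
Proof. exact: measurable_shifted_powR. Qed.
Lemma measurable_ddamp : measurable_fun setT ddamp.
Proof. exact: measurableT_comp measurable_damp_rate. Qed.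
Lemma measurable_damp_prim : measurable_fun setT damp_prim.
Proof. by apply: measurable_funM => //; apply: measurable_funB; [exact: measurable_shifted_powR|exact: measurable_cst]. Qed.

Lemma damp_der (a : R) : 0 <= a -> is_derive a 1 damp (ddamp a).
Proof. by move=> a0; have := is_derive_shifted_powR ep0 (- al) a0; rewrite 2!mulNr. Qed.

Lemma damp_prim_der (a : R) : 0 <= a -> is_derive a 1 damp_prim (damp a).
Proof.
move=> a0; have h := is_derive_shifted_powR ep0 (1 - al) a0.
have h1 : is_derive a 1 (fun x => shifted_powR ep (1 - al) x - 1) ((1 - al) / ep * shifted_powR ep (1 - al - 1) a - 0).
  exact: is_deriveB.
have := @is_deriveZ R R R _ (ep / (1 - al)) a 1 _ h1.
rewrite (_ : _ *: (_ - 0) = damp a)//.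
rewrite subr0 /GRing.scale/= /damp addrAC subrr add0r; field.
by rewrite gt_eqF//= subr_eq0 gt_eqF.
Qed.

Lemma ddamp_der (a : R) : 0 <= a -> is_derive a 1 ddamp (al / ep * ((al + 1) / ep) * shifted_powR ep (- al - 2) a).
Proof.
move=> a0; have h := is_derive_shifted_powR ep0 (- al - 1) a0.
have := @is_deriveZ R R R _ (- (al / ep)) a 1 _ h.
rewrite (_ : _ \*: _ = ddamp); last by apply/funext => x; exact: mulNr.
rewrite (_ : _ *: _ = al / ep * ((al + 1) / ep) * shifted_powR ep (- al - 2) a)//.
rewrite /GRing.scale/= (_ : - al - 1 - 1 = - al - 2); last ring.
by field; rewrite gt_eqF.
Qed.

Lemma ddamp_cont (a : R) : 0 <= a -> {for a, continuous ddamp}.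
Proof.
by move=> a0; apply: differentiable_continuous; apply/derivable1_diffP; have [] := ddamp_der a0.
Qed.

Lemma damp_prim0 : damp_prim 0 = 0.
Proof. by rewrite /damp_prim /shifted_powR mul0r addr0 powR1 subrr mulr0. Qed.

Lemma damp01 (a : R) : 0 <= a -> 0 <= damp a <= 1.
Proof. by move=> a0; rewrite shifted_powR_ge0 shifted_powR_le1// oppr_le0 ltW. Qed.

Let r1 : 0 <= al / ep. Proof. by rewrite divr_ge0// ltW. Qed.
Let r2 : 0 <= (al + 1) / ep. Proof. by rewrite divr_ge0 ?addr_ge0 ?ltW. Qed.

Lemma damp_bound_ge0 : 0 <= damp_bound.
Proof. exact: addr_ge0 r1 (mulr_ge0 r1 r2). Qed.

Lemma ddamp_le (a : R) : 0 <= a -> `|ddamp a| <= damp_bound.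
Proof.
move=> a0; rewrite normrN ger0_norm ?damp_rate_ge0// (@le_trans _ _ (al / ep))//.
  rewrite -[leRHS]mulr1 ler_wpM2l//.
  by rewrite shifted_powR_le1// subr_le0 (le_trans _ ler01)// oppr_le0 ltW.
by rewrite lerDl mulr_ge0.
Qed.

Lemma damp_prim_lip (a b : R) : 0 <= a -> 0 <= b -> `|damp_prim a - damp_prim b| <= `|a - b|.
Proof.
move=> a0 b0; rewrite -[leRHS]mul1r; apply: (lipschitz_nneg damp_prim_der) => // x x0.
by have /andP[? ?] := damp01 x0; rewrite ger0_norm.
Qed.

Lemma damp_lip (a b : R) : 0 <= a -> 0 <= b -> `|damp a - damp b| <= damp_bound * `|a - b|.
Proof. by move=> a0 b0; apply: (lipschitz_nneg damp_der) => // x; exact: ddamp_le. Qed.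

Lemma ddamp_lip (a b : R) : 0 <= a -> 0 <= b -> `|ddamp a - ddamp b| <= damp_bound * `|a - b|.
Proof.
move=> a0 b0; apply: (lipschitz_nneg ddamp_der) => // x x0.
have c0 : 0 <= al / ep * ((al + 1) / ep) by exact: (mulr_ge0 r1 r2).
rewrite ger0_norm; last by rewrite mulr_ge0 // shifted_powR_ge0.
apply: (@le_trans _ _ (al / ep * ((al + 1) / ep))); last by rewrite /damp_bound lerDr.
  by rewrite -[leRHS]mulr1 ler_wpM2l// shifted_powR_le1// subr_le0 (le_trans _ (ler0n _ 2))// oppr_le0 ltW.

Qed.

Lemma damp_prim_ge0 (a : R) : 0 <= a -> 0 <= damp_prim a.
Proof.
move=> a0; apply: mulr_ge0; first by rewrite divr_ge0 ?subr_ge0 ?ltW.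
by rewrite subr_ge0 shifted_powR_ge1// subr_ge0 ltW.
Qed.

Lemma damp_prim_le (a : R) : 0 <= a -> damp_prim a <= a.
Proof.
move=> a0; have := damp_prim_lip a0 (lexx 0); rewrite damp_prim0 !subr0 (ger0_norm a0).
exact: le_trans (ler_norm _).
Qed.

End gfun.

Section young.
Context (R : realType).

(** Young's inequality for the product of [e (ga et^l)^(1/m')] and
[et^(l-1) / r (ga et^l)^(-1/m')]; the power of [et] in the second term is
[(l - 1) m - l (m - 1) = l - m]. *)
Lemma young_cut (m tau e ga et r : R) (l : nat) : 1 < m -> m < l%:R -> 0 <= e -> 0 < ga ->
  0 <= et -> 0 < r -> 0 < tau ->
  e * et ^+ l.-1 / r <= (tau^-1) `^ (m / (m - 1)) * (ga * e `^ (m / (m - 1)) * et ^+ l)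
    + tau `^ m * (ga `^ (1 - m) * r `^ (- m) * et `^ (l%:R - m)).
Proof.
move=> m1 ml e0 ga0 et0 r0 tau0.
have l0 : (0 < l)%N by rewrite -(ltr_nat R) (lt_trans _ ml)// (lt_trans ltr01).
have m10 : 0 < m - 1 by rewrite subr_gt0.
have m0 : 0 < m by lra.
move: et0; rewrite le_eqVlt => /orP[/eqP <-|et0].
  rewrite expr0n; case: l ml l0 => [//|[|l]] ml _.
    by move: (lt_trans m1 ml); rewrite ltxx.
  by rewrite mulr0 mul0r expr0n/= !mulr0 add0r !mulr_ge0// powR_ge0.
set M := m / (m - 1).
have M0 : 0 < M by rewrite divr_gt0.
set y := (ga * et ^+ l) `^ M^-1.
have ge0 : 0 < ga * et ^+ l by rewrite mulr_gt0// exprn_gt0.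
have y0 : 0 < y by rewrite powR_gt0.
have := young_scaled m1 (mulr_ge0 e0 (ltW y0))
  (divr_ge0 (divr_ge0 (exprn_ge0 l.-1 (ltW et0)) (ltW r0)) (ltW y0)) tau0.
rewrite -/M (_ : e * y * _ = e * et ^+ l.-1 / r); last first.
  by field; rewrite !gt_eqF.
move=> /le_trans; apply; apply: lerD.
  have e1 : 0 <= e * y by rewrite mulr_ge0// ltW.
  have e2 : 0 <= tau^-1 by rewrite invr_ge0 ltW.
  rewrite powRM// powRM// ?(ltW y0)// /y -powRrM mulVf ?gt_eqF// powRr1 ?(ltW ge0)//.
  by rewrite (mulrCA (e `^ M)) (mulrA ga).
rewrite ler_wpM2l ?powR_ge0// le_eqVlt; apply/orP; left; apply/eqP.
have f1 : 0 <= et ^+ l.-1 by rewrite exprn_ge0// ltW.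
have f2 : 0 <= r^-1 by rewrite invr_ge0 ltW.
have f3 : 0 <= y^-1 by rewrite invr_ge0 ltW.
have f4 : 0 <= et ^+ l.-1 / r by rewrite mulr_ge0.
rewrite powRM// powRM//.
have -> : (r^-1) `^ m = r `^ (- m) by rewrite -powR_inv1 ?(ltW r0)// -powRrM mulN1r.
have -> : y^-1 `^ m = ga `^ (1 - m) * et `^ (l%:R * (1 - m)).
  rewrite -powR_inv1 ?(ltW y0)// -powRrM mulN1r /y -powRrM.
  rewrite (_ : M^-1 * - m = 1 - m); last by rewrite /M; field; rewrite !gt_eqF.
  by rewrite powRM ?exprn_ge0 ?(ltW et0) ?(ltW ga0)// -powR_mulrn ?(ltW et0)// powRrM.
have -> : (et ^+ l.-1) `^ m = et `^ (l.-1%:R * m) by rewrite powRrM powR_mulrn// ltW.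
rewrite (_ : l%:R - m = l.-1%:R * m + l%:R * (1 - m)); last first.
  by rewrite -[in RHS](prednK l0) -(prednK l0) /= -natr1; ring.
rewrite [et `^ (_ + _)]powRD ?(gt_eqF et0) ?implybT//.
by ring.
Qed.

(** Above [de^(1/(th-1))] the term [de X] dominates, below it the left-hand side is
bounded. *)
Lemma powR_absorb (th de : R) : 0 < th -> th < 1 -> 0 < de ->
  exists2 C : R, 0 <= C & forall X, 0 <= X -> X `^ th <= de * X + C.
Proof.
move=> th0 th1 de0.
(* The point where [X^th = de X]. *)
pose X0 := de `^ (th - 1)^-1.
exists (X0 `^ th) => [|X X0']; first exact: powR_ge0.
have [h|h] := leP X X0.
  by rewrite ler_wpDl ?mulr_ge0 ?(ltW de0)// ge0_ler_powR ?nnegrE ?powR_ge0// ltW.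
have Xp : 0 < X by rewrite (le_lt_trans _ h)// powR_ge0.
rewrite ler_wpDr ?powR_ge0//.
have -> : X `^ th = X `^ (th - 1) * X.
  by rewrite -[X in _ * X](powRr1 X0') -powRD ?subrK// gt_eqF// implybT.
rewrite ler_wpM2r//.
have -> : de = X0 `^ (th - 1) by rewrite /X0 -powRrM mulVf ?powRr1 ?(ltW de0)// lt_eqF// subr_lt0.
have X0p : 0 < X0 by rewrite powR_gt0.
rewrite -(opprB 1 th) !powRN lef_pV2 ?posrE ?powR_gt0//.
by rewrite ge0_ler_powR ?nnegrE ?(ltW X0p) ?(ltW h)// subr_ge0 ltW.
Qed.

End young.

(** * Energy estimate *)

Section enorm_upper.
Context (R : realType) (N : nat).

Lemma ler_enorm (x : 'rV[R]_N) i : `|x 0 i| <= enorm x.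
Proof.
rewrite -sqrtr_sqr ler_sqrt; last by apply: sumr_ge0 => j _; exact: sqr_ge0.
rewrite /dotv (bigD1 i)//= -expr2 lerDl.
by apply: sumr_ge0 => j _; exact: sqr_ge0.
Qed.

Lemma measurable_enorm : measurable_fun setT (enorm : 'rV[R]_N -> R).
Proof.
apply: (measurableT_comp (continuous_measurable_fun (@sqrt_continuous R))).
by apply: measurable_sum => i; apply: measurable_funM; exact: measurable_coord.
Qed.

Lemma measurable_upper : measurable (upper : set ('rV[R]_N * R)).
Proof.
have -> : upper = (fun z : 'rV[R]_N * R => z.2) @^-1` `]0, +oo[%classic.
  by apply/funext => z; rewrite /upper /preimage/= in_itv/= andbT.
by rewrite -[X in measurable X]setTI; exact: measurable_coord2.
Qed.

End enorm_upper.

Section energy.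
Context (R : realType) (N : nat).
Local Notation V := ('rV[R]_N * R)%type.
Local Notation mu := (@lebesgue_xt R N).

Variables (m c0 : R).
Hypotheses (m1 : 1 < m) (c00 : 0 < c0).
Let m' := m / (m - 1).

Lemma conj_exp_gt1 : 1 < m'.
Proof. by rewrite /m' ltr_pdivlMr ?subr_gt0// mul1r gtrBl. Qed.

Definition flux_norm (F : 'I_N -> V -> R) (z : V) : R := enorm (\row_i F i z).

Lemma flux_norm_ge0 F z : 0 <= flux_norm F z. Proof. exact: sqrtr_ge0. Qed.

Lemma ler_flux_norm F z i : `|F i z| <= flux_norm F z.
Proof. by have := ler_enorm (\row_i F i z) i; rewrite mxE. Qed.

Lemma measurable_flux_norm F : (forall i, measurable_fun setT (F i)) -> measurable_fun setT (flux_norm F).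
Proof.
move=> mF; apply: (measurableT_comp (@measurable_enorm R N)).
apply: measurable_fun_matrix => i j; rewrite (_ : (fun z => _) = F j)//.
by apply/funext => z; rewrite mxE.
Qed.

Definition slab_trunc (M ka : R) (h : V -> R) (z : V) : R := h z * \1_(slab M ka) z.

Lemma slab_trunc_in M ka h z : slab M ka z -> slab_trunc M ka h z = h z.
Proof. by move=> zK; rewrite /slab_trunc indicE mem_set// mulr1. Qed.

Lemma slab_trunc_out M ka h z : ~ slab M ka z -> slab_trunc M ka h z = 0.
Proof. by move=> zK; rewrite /slab_trunc indicE memNset// mulr0. Qed.

Lemma measurable_slab M ka : measurable (slab M ka : set V).
Proof. by apply: measurable_closed_xt; exact: closed_slab. Qed.

Lemma measurable_slab_trunc M ka h : measurable_fun setT h -> measurable_fun setT (slab_trunc M ka h).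
Proof. by move=> mh; apply: measurable_funM => //; apply: measurable_indic; exact: measurable_slab. Qed.

Lemma integral_slab_trunc M ka (h : V -> R) (a : R -> R) : a 0 = 0 ->
  (\int[mu]_z (a (slab_trunc M ka h z))%:E = \int[mu]_(z in slab M ka) (a (h z))%:E)%E.
Proof.
move=> a0; rewrite [RHS]integral_mkcond; apply: eq_integral => z _; rewrite patchE.
by case: ifPn => [/set_mem/slab_trunc_in ->//|/negP zK]; rewrite slab_trunc_out ?a0// => /mem_set.
Qed.

Lemma pairing_trunc M ka (h th : V -> R) : (forall z, ~ slab M ka z -> th z = 0) ->
  pairing (slab_trunc M ka h) th = pairing h th.
Proof.
move=> th0; rewrite /pairing; congr Rintegral; apply/funext => z.
have [zK|zK] := pselect (slab M ka z); first by rewrite slab_trunc_in.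
by rewrite th0// !mulr0.
Qed.

Variables (f : V -> R) (d_ : option 'I_N -> V -> R) (F : 'I_N -> V -> R).
Hypothesis mf : measurable_fun setT f.
Hypothesis md : forall k, measurable_fun setT (d_ k).
Hypothesis mF : forall i, measurable_fun setT (F i).
Hypothesis f0 : forall z, 0 <= f z.
Hypothesis Fup : forall i z, z.2 <= 0 -> F i z = 0.
Hypothesis fi : forall M ka, 0 < ka -> (\int[mu]_(z in slab M ka) `|f z|%:E < +oo)%E.
Hypothesis di : forall M ka k, 0 < ka -> (\int[mu]_(z in slab M ka) `|d_ k z|%:E < +oo)%E.
Hypothesis dm : forall M ka i, 0 < ka ->
  (\int[mu]_(z in slab M ka) (`|d_ (Some i) z| `^ m)%:E < +oo)%E.
Hypothesis Fi : forall M ka i, 0 < ka -> (\int[mu]_(z in slab M ka) `|F i z|%:E < +oo)%E.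
Hypothesis Fm : forall M ka i, 0 < ka ->
  (\int[mu]_(z in slab M ka) (`|F i z| `^ m')%:E < +oo)%E.
Hypothesis weakd : forall M ka (ph : V -> R) dph k, 0 < ka -> hasgrad ph dph ->
  (forall z, ~ slab M ka z -> ph z = 0) -> pairing f (dph^~ k) = - pairing (d_ k) ph.
Hypothesis ineq : forall M ka (ph : V -> R) dph, 0 < ka -> hasgrad ph dph ->
  (forall z, 0 <= ph z) -> (forall z, ~ slab M ka z -> ph z = 0) ->
  0 <= - pairing f (dph^~ None) + \sum_i pairing (F i) (dph^~ (Some i)).
Hypothesis coer : {ae mu, forall z, upper z ->
  c0 * flux_norm F z `^ m' <= \sum_i F i z * d_ (Some i) z}.

Variables (al ep rr T : R) (l : nat).
Hypotheses (al0 : 0 < al) (al1 : al < 1) (ep0 : 0 < ep) (rr0 : 0 < rr) (T0 : 0 < T).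
Hypotheses (l1 : (1 < l)%N) (lm : m < l%:R).

(** The density of the quantity called B in the introduction. *)
Definition cutoff_error (z : V) : R := f z / T * cutoff_base rr T z ^+ l.-1 +
  damp_rate al ep (f z) `^ (1 - m) * rr `^ (- m) * cutoff_base rr T z `^ (l%:R - m).

(** The density of the weighted energy of the flux. *)
Definition flux_density (z : V) : R := damp_rate al ep (f z) * flux_norm F z `^ m' * cutoff rr T l z.

Lemma cutoff_error_ge0 z : 0 <= cutoff_error z.
Proof.
have e0 : 0 <= cutoff_base rr T z by exact: cutoff_base_ge0.
apply: addr_ge0; last by rewrite !mulr_ge0 ?powR_ge0.
by apply: mulr_ge0; [rewrite divr_ge0// ltW|exact: exprn_ge0].
Qed.

Lemma flux_density_ge0 z : 0 <= flux_density z.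
Proof.
apply: mulr_ge0; last exact: cutoff_ge0.
by apply: mulr_ge0; [exact: damp_rate_ge0|exact: powR_ge0].
Qed.

Lemma measurable_cutoff_base : measurable_fun setT (cutoff_base rr T : V -> R).
Proof.
have mp : measurable_fun setT (@pos_part R).
  apply: continuous_measurable_fun; rewrite (_ : @pos_part R = fun x => pos_part x ^+ 1)//.
  exact: continuous_pospow.
apply: measurable_funM; apply: (measurableT_comp mp); apply: measurable_funB => //.
  apply: measurable_funM => //; apply: continuous_measurable_xt.
  exact: hasgrad_continuous (@hasgrad_space_sq R N).
by apply: measurable_funM => //; apply: measurable_funX; exact: measurable_coord2.
Qed.

Lemma measurable_cutoff_error : measurable_fun setT cutoff_error.
Proof.
have me := measurable_cutoff_base.
apply: measurable_funD; first by apply: measurable_funM; [exact: measurable_funM|exact: measurable_funX].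
apply: measurable_funM; last exact: measurableT_comp (measurable_powR _) me.
apply: measurable_funM => //; apply: (measurableT_comp (measurable_powR (1 - m))).
exact: measurableT_comp (measurable_damp_rate _ _) mf.
Qed.

Lemma measurable_flux_density : measurable_fun setT flux_density.
Proof.
apply: measurable_funM; last exact: measurable_funX measurable_cutoff_base.
apply: measurable_funM; first exact: measurableT_comp (measurable_damp_rate _ _) mf.
by apply: (measurableT_comp (measurable_powR m')); exact: measurable_flux_norm.
Qed.

Lemma young_dcutoff (tau : R) z : 0 < tau -> \sum_i `|F i z| * `|dcutoff rr T l z (Some i)| <=
  (N * l)%:R * (tau^-1) `^ m' * flux_density z + (N * l)%:R * tau `^ m * cutoff_error z.
Proof.
move=> tau0.
have h := young_cut m1 lm (flux_norm_ge0 F z) (damp_rate_gt0 ep0 al0 (f0 z)) (cutoff_base_ge0 rr T z) rr0 tau0.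
have E i : `|F i z| * `|dcutoff rr T l z (Some i)| <= l%:R * (flux_norm F z * cutoff_base rr T z ^+ l.-1 / rr).
  apply: (@le_trans _ _ (flux_norm F z * (l%:R / rr * cutoff_base rr T z ^+ l.-1))).
    by rewrite ler_pM ?ler_flux_norm// dcutoff_x.
  by rewrite le_eqVlt; apply/orP; left; apply/eqP; ring.
apply: (le_trans (ler_sum _ (fun i _ => E i))).
move: h; set X := _ / rr; move=> h.
rewrite sumr_const card_ord -[leLHS]mulr_natl (mulrA N%:R) -natrM -!(mulrA (N * l)%:R) -mulrDr.
rewrite ler_wpM2l// (le_trans h)// lerD// ler_wpM2l ?powR_ge0//.
have e0 : 0 <= cutoff_base rr T z by exact: cutoff_base_ge0.
by rewrite lerDr mulr_ge0 ?exprn_ge0// divr_ge0// ltW.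
Qed.

Let hn n (z : V) : R := c0 / 2 * (time_ramp n z * flux_density z).

(** With this parameter Young's inequality absorbs half of the coercive term. *)
Let tau : R := ((c0 / 2) / (N * l).+1%:R) `^ (- (m')^-1).
Definition energy_const : R := 2 * l%:R + (N * l)%:R * tau `^ m.

Lemma energy_const_gt0 : 0 < energy_const.
Proof.
have l0 : 0 < (l%:R : R) by rewrite ltr0n; case: l l1.
by rewrite ltr_pwDl ?mulr_gt0// mulr_ge0 ?powR_ge0.
Qed.

Let tau0 : 0 < tau.
Proof. by rewrite powR_gt0// !divr_gt0. Qed.

Let tauE : (N * l)%:R * (tau^-1) `^ m' <= c0 / 2.
Proof.
have m'0 : m' != 0 by rewrite gt_eqF// (lt_trans ltr01) ?conj_exp_gt1.
pose c := (c0 / 2) / (N * l).+1%:R; have c_ge0 : 0 <= c by rewrite !divr_ge0// ltW.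
rewrite /tau -/c powRN invrK -powRrM mulVf// powRr1//.
rewrite /c mulrCA ger_pMr ?divr_gt0// ler_pdivrMr// mul1r ler_nat.
exact: leqnSn.
Qed.

Let M := 2 * rr + T + 1.
Let ka n : R := (2 * n.+1%:R)^-1.
Let psi n (z : V) := time_ramp n z * cutoff rr T l z.
Let dpsi n (z : V) k := time_ramp n z * dcutoff rr T l z k + cutoff rr T l z * dtime_ramp n z k.
Let cl n := chain_lim (slab_trunc M (ka n) f) (fun k => slab_trunc M (ka n) (d_ k)) (fun i => slab_trunc M (ka n) (F i))
  (psi n) (dpsi n) (damp_prim al ep) (damp al ep) (ddamp al ep).

Let ka0 n : 0 < ka n. Proof. by rewrite invr_gt0 mulr_gt0. Qed.

Let ka1 n : ka n <= 1.
Proof. by rewrite invf_le1 ?mulr_gt0// -natrM ler1n. Qed.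

Let time_ramp01 n (z : V) : 0 <= time_ramp n z <= 1. Proof. exact: ramp01. Qed.

Let psiK n z : psi n z != 0 -> `|z| <= M - ka n /\ ka n + ka n <= z.2.
Proof.
rewrite /psi mulf_eq0 negb_or => /andP[c0' p0].
split.
  apply: (le_trans (cutoff_closed_box rr0 T0 l1 p0)).
  by rewrite /M -addrA lerDl subr_ge0.
have := ramp_supp c0'; rewrite subr_ge0 mulrC -ler_pdivrMr// mul1r.
by apply: le_trans; rewrite /ka invfM -mulrDl -(mulr2n 2^-1) -[_ *+ 2]mulr_natl divff// mul1r.
Qed.

Let psiS n z : ~ slab M (ka n) z -> psi n z = 0.
Proof.
move=> zK; apply/eqP; apply: contra_notT zK => /psiK[z1 z2]; split.
  by rewrite (le_trans z1)// gerBl ltW.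
by rewrite (le_trans _ z2)// lerDl ltW.
Qed.

Let hpsi n : hasgrad (psi n) (dpsi n).
Proof. exact: hasgradM (hasgrad_time_ramp R N n) (hasgrad_cutoff N rr T l1). Qed.

Let psi0 n z : 0 <= psi n z.
Proof. by have /andP[? _] := time_ramp01 n z; rewrite mulr_ge0// cutoff_ge0. Qed.

Let hn_slab n z : ~ slab M (ka n) z -> hn n z = 0 /\ cl n z = 0.
Proof.
move=> zK; split.
  have E : time_ramp n z * flux_density z = psi n z * (damp_rate al ep (f z) * flux_norm F z `^ m') by rewrite /flux_density /psi; ring.
  by rewrite /hn E psiS// !(mul0r, mulr0).
rewrite /cl /chain_lim (slab_trunc_out f zK) damp_prim0 mul0r oppr0 add0r big1// => i _.
by rewrite (slab_trunc_out (F i) zK) !mul0r addr0.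
Qed.

(** In [chain_lim] the coercive term carries the factor [- c0], the term with
the gradient of the cut-off is absorbed by half of it, and the derivative of [time_ramp] has a
favourable sign. *)
Let hn_bound n z : slab M (ka n) z ->
  c0 * flux_norm F z `^ m' <= \sum_i F i z * d_ (Some i) z -> hn n z + cl n z <= energy_const * cutoff_error z.
Proof.
move=> zK cz; have /andP[ch0 ch1] := time_ramp01 n z.
have fz := f0 z; have ga0 : 0 <= damp_rate al ep (f z) by exact: damp_rate_ge0.
have ph0 : 0 <= cutoff rr T l z by exact: cutoff_ge0.
have e0 : 0 <= cutoff_base rr T z by exact: cutoff_base_ge0.
have /andP[g0 g1] := damp01 ep0 al0 fz.
rewrite /cl /chain_lim (slab_trunc_in _ zK).
under eq_bigr => i _ do rewrite !(slab_trunc_in _ zK).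
rewrite big_split/=.
have A1 : - (damp_prim al ep (f z) * dpsi n z None) <= 2 * l%:R * cutoff_error z.
  rewrite /dpsi mulrDr opprD -[leRHS]addr0 lerD//; last first.
    rewrite oppr_le0 mulr_ge0 ?damp_prim_ge0// mulr_ge0//= mulr_ge0//.
    exact: dramp_ge0.
  apply: (@le_trans _ _ (f z * (2 * l%:R / T * cutoff_base rr T z ^+ l.-1))).
    apply: le_trans (ler_norm _) _; rewrite normrN (normrM (damp_prim _ _ _)) ler_pM//.
      by rewrite ger0_norm ?damp_prim_ge0// damp_prim_le.
    rewrite (normrM (time_ramp n z)) (ger0_norm ch0) -[leRHS]mul1r ler_pM//.
    exact: dcutoff_t.
  have -> : f z * (2 * l%:R / T * cutoff_base rr T z ^+ l.-1) =
    2 * l%:R * (f z / T * cutoff_base rr T z ^+ l.-1) by ring.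
  by rewrite ler_wpM2l ?mulr_ge0// lerDl !mulr_ge0 ?powR_ge0.
have A2 : \sum_i F i z * (damp al ep (f z) * dpsi n z (Some i)) <=
    time_ramp n z * (c0 / 2 * flux_density z) + (N * l)%:R * tau `^ m * cutoff_error z.
  apply: (@le_trans _ _ (time_ramp n z * \sum_i `|F i z| * `|dcutoff rr T l z (Some i)|)).
    rewrite mulr_sumr; apply: ler_sum => i _.
    rewrite /dpsi/= mulr0 addr0; apply: le_trans (ler_norm _) _.
    rewrite (normrM (F i z)) (normrM (damp _ _ _)) (normrM (time_ramp n z)) (ger0_norm ch0) (ger0_norm g0).
    rewrite [leRHS]mulrCA ler_wpM2l// -[leRHS]mul1r.
    by rewrite ler_wpM2r// mulr_ge0.
  apply: (@le_trans _ _ (time_ramp n z * ((N * l)%:R * (tau^-1) `^ m' * flux_density z + (N * l)%:R * tau `^ m * cutoff_error z))).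
    by rewrite ler_wpM2l// young_dcutoff.
  rewrite mulrDr lerD//.
    by rewrite ler_wpM2l// ler_wpM2r ?flux_density_ge0.
  by rewrite ler_piMl// mulr_ge0 ?cutoff_error_ge0// mulr_ge0// powR_ge0.
have A3 : \sum_i F i z * d_ (Some i) z * (psi n z * ddamp al ep (f z)) <= - (c0 * (time_ramp n z * flux_density z)).
  rewrite -mulr_suml /ddamp mulrN mulrN lerN2.
  have -> : c0 * (time_ramp n z * flux_density z) = c0 * flux_norm F z `^ m' * (psi n z * damp_rate al ep (f z)).
    by rewrite /flux_density /psi; ring.
  by rewrite ler_wpM2r// mulr_ge0.
rewrite /hn /energy_const mulrDl.
have : c0 / 2 * (time_ramp n z * flux_density z) + - (c0 * (time_ramp n z * flux_density z)) + time_ramp n z * (c0 / 2 * flux_density z) = 0.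
  by field.
lra.
Qed.

Let hn_le n : {ae mu, forall z, hn n z + cl n z <= energy_const * (cutoff_error z * \1_upper z)}.
Proof.
apply: filterS coer => z cz; have [zK|zK] := pselect (slab M (ka n) z).
  have zu : upper z by case: zK => _; exact: lt_le_trans.
  rewrite indicE mem_set// mulr1; apply: hn_bound => //; exact: cz.
have [-> ->] := hn_slab zK.
by rewrite addr0 !mulr_ge0// ?cutoff_error_ge0// ltW// energy_const_gt0.
Qed.

Let trfin n (h : V -> R) (a : R -> R) : a 0 = 0 ->
  (\int[mu]_(z in slab M (ka n)) (a (h z))%:E < +oo)%E ->
  (\int[mu]_z (a (slab_trunc M (ka n) h z))%:E < +oo)%E.
Proof. by move=> a0; rewrite integral_slab_trunc. Qed.

Let powR0' (a : R) : 1 < a -> `|0 : R| `^ a = 0.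
Proof. by move=> a1; rewrite normr0 powR0// gt_eqF// (lt_trans ltr01). Qed.

Let cl_int n : mu.-integrable setT (EFin \o cl n).
Proof.
apply: (chain_lim_integrable (m := m) (M := M) (ka := ka n) (r0 := ka n) (L := damp_bound al ep)).
- exact: m1.
- exact: ka0.
- exact: measurable_slab_trunc.
- by move=> k; exact: measurable_slab_trunc.
- by move=> i; exact: measurable_slab_trunc.
- by move=> z; rewrite mulr_ge0.
- by apply: (@trfin _ _ Num.norm); [exact: normr0|exact: fi].
- by move=> i; apply: (@trfin _ _ (fun x => `|x| `^ m)); [exact: powR0'|exact: dm].
- by move=> i; apply: (@trfin _ _ Num.norm); [exact: normr0|exact: Fi].
- by move=> i; apply: (@trfin _ _ (fun x => `|x| `^ m')); [apply: powR0'; exact: conj_exp_gt1|exact: Fm].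
- exact: hpsi.
- exact: psiK.
- exact: measurable_damp_prim.
- exact: measurable_damp.
- exact: measurable_ddamp.
- exact: damp_prim0.
- exact: damp01.
- exact: ddamp_le.
- exact: damp_prim_lip.
Qed.

Let cl_ge0 n : 0 <= Rintegral mu setT (cl n).
Proof.
apply: (@chain_test _ _ m M (ka n) (ka n) (damp_bound al ep)).
- exact: m1.
- by rewrite addr_ge0// addr_ge0 ?mulr_ge0// ltW.
- exact: ka0.
- exact: damp_bound_ge0.
- exact: measurable_slab_trunc.
- by move=> k; exact: measurable_slab_trunc.
- by move=> i; exact: measurable_slab_trunc.
- by move=> z; rewrite mulr_ge0.
- by move=> z; exact: slab_trunc_out.
- by move=> k z; exact: slab_trunc_out.
- by move=> i z; exact: slab_trunc_out.
- by apply: (@trfin _ _ Num.norm); [exact: normr0|exact: fi].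
- by move=> k; apply: (@trfin _ _ Num.norm); [exact: normr0|exact: di].
- by move=> i; apply: (@trfin _ _ (fun x => `|x| `^ m)); [exact: powR0'|exact: dm].
- by move=> i; apply: (@trfin _ _ Num.norm); [exact: normr0|exact: Fi].
- by move=> i; apply: (@trfin _ _ (fun x => `|x| `^ m')); [apply: powR0'; exact: conj_exp_gt1|exact: Fm].
- move=> ph dph k hg phK; rewrite !pairing_trunc//; first exact: weakd hg phK.
  move=> z zK; exact: hasgrad_supp (@closed_slab R N M (ka n)) hg phK z k zK.
- move=> ph dph hg ph0 phK.
  have dphK k z : ~ slab M (ka n) z -> dph z k = 0.
    by move=> zK; exact: hasgrad_supp (@closed_slab R N M (ka n)) hg phK z k zK.
  rewrite pairing_trunc//; last exact: dphK.
  under eq_bigr => i _ do rewrite (pairing_trunc _ (dphK _)).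
  exact: ineq hg ph0 phK.
- exact: hpsi.
- exact: psi0.
- exact: psiK.
- exact: measurable_damp_prim.
- exact: measurable_damp.
- exact: measurable_ddamp.
- exact: damp_prim_der.
- exact: damp_der.
- exact: ddamp_cont.
- exact: damp_prim0.
- exact: damp01.
- exact: ddamp_le.
- exact: damp_prim_lip.
- exact: damp_lip.
- exact: ddamp_lip.
Qed.

Let mhn n : measurable_fun setT (hn n).
Proof.
apply: measurable_funM => //; apply: measurable_funM; last exact: measurable_flux_density.
apply: continuous_measurable_xt; exact: hasgrad_continuous (hasgrad_time_ramp R N n).
Qed.

Let hn_ge0 n z : 0 <= hn n z.
Proof.
have /andP[ch0 _] := time_ramp01 n z.
by apply: mulr_ge0; [rewrite divr_ge0// ltW|rewrite mulr_ge0// flux_density_ge0].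
Qed.

Let mup := @measurable_upper R N.

Lemma energy_n n : (\int[mu]_z (hn n z)%:E <= energy_const%:E * \int[mu]_(z in upper) (cutoff_error z)%:E)%E.
Proof.
pose b1 z := energy_const * (cutoff_error z * \1_upper z).
have mb1 : measurable_fun setT b1.
  by apply: measurable_funM => //; apply: measurable_funM; [exact: measurable_cutoff_error|exact: measurable_indic].
have b10 z : 0 <= b1 z by rewrite !mulr_ge0 ?cutoff_error_ge0// ltW// energy_const_gt0.
have -> : (energy_const%:E * \int[mu]_(z in upper) (cutoff_error z)%:E = \int[mu]_z (b1 z)%:E)%E.
  rewrite integral_mkcond -ge0_integralZl_EFin ?(ltW energy_const_gt0)//.
  - apply: eq_integral => z _; rewrite patchE /b1 indicE.
    by case: ifPn => _; rewrite ?mulr1 ?mulr0 ?mule0.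
  - by move=> z _; rewrite patchE; case: ifPn => // _; rewrite lee_fin cutoff_error_ge0.
  - apply/(measurable_restrictT _ mup); apply: measurable_funTS; apply/measurable_EFinP.
    exact: measurable_cutoff_error.
have [->|bfin] := eqVneq (\int[mu]_z (b1 z)%:E)%E +oo%E; first exact: leey.
have ib1 : mu.-integrable setT (EFin \o b1).
  apply/integrableP; split; first exact/measurable_EFinP.
  rewrite ltey; under eq_integral => z _ do rewrite /= ger0_norm//.
  exact: bfin.
have h1 : (\int[mu]_z (hn n z)%:E <= \int[mu]_z ((b1 z)%:E - (cl n z)%:E))%E.
  apply: ae_ge0_le_integral_nm => [z _|]; first by rewrite lee_fin.
  by apply: filterS (hn_le n) => z hz _; rewrite -EFinB lee_fin lerBrDr.
apply: (le_trans h1); rewrite (integralB_EFin measurableT ib1 (cl_int n)).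
have fc : (\int[mu]_z (cl n z)%:E)%E \is a fin_num by exact: integrable_fin_num (cl_int n).
rewrite -(fineK fc); rewrite leeBlDr// leeDl// lee_fin.
exact: cl_ge0.
Qed.

(** [energy_n] and Fatou's lemma, as [time_ramp n] tends to 1 on the upper
half-space. *)
Lemma energy : ((c0 / 2)%:E * \int[mu]_(z in upper) (flux_density z)%:E <=
  energy_const%:E * \int[mu]_(z in upper) (cutoff_error z)%:E)%E.
Proof.
have c2 : 0 <= c0 / 2 by rewrite divr_ge0// ltW.
have -> : ((c0 / 2)%:E * \int[mu]_(z in upper) (flux_density z)%:E =
    \int[mu]_(z in upper) limn_einf (fun n => (hn n z)%:E))%E.
  rewrite -ge0_integralZl_EFin//; first last.
  - by apply: measurable_funTS; apply/measurable_EFinP; exact: measurable_flux_density.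
  - by move=> z _; rewrite lee_fin flux_density_ge0.
  apply: eq_integral => z /set_mem zu.
  have hc : (fun n => (hn n z)%:E) @ \oo --> ((c0 / 2)%:E * (flux_density z)%:E)%E.
    apply: cvg_EFin; first by near=> n.
    rewrite -[X in _ --> X]/(c0 / 2 * flux_density z); apply: cvgMl_tmp.
    rewrite -[X in _ --> X]mul1r; apply: cvgMr_tmp; exact: time_ramp_cvg.
  rewrite is_cvg_limn_einfE; first exact/esym/cvg_lim.
  by apply/cvg_ex; eexists; exact: hc.
have mh n : measurable_fun upper (EFin \o hn n).
  by apply: measurable_funTS; exact/measurable_EFinP.
have hn0 n z : upper z -> (0 <= (EFin \o hn n) z)%E by move=> _; rewrite lee_fin.
apply: le_trans; first exact: (fatou _ mup mh hn0).
rewrite limn_einf_lim; apply: lime_le; first exact: is_cvg_einfs.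
near=> n; apply: (@le_trans _ _ (\int[mu]_(z in upper) (hn n z)%:E)%E).
  by apply: ereal_inf_lbound; exists n => //=.
apply: le_trans (energy_n n); apply: ge0_subset_integral => //.
- exact/measurable_EFinP.
- by move=> z _; rewrite lee_fin.
Unshelve. all: by end_near. Qed.

End energy.

(** * Borel representatives and uniqueness of weak derivatives *)

Section borel.
Context (R : realType) (N : nat).
Local Notation V := ('rV[R]_N * R)%type.
Local Notation mu := (@lebesgue_xt R N).

Lemma borel_rep (h : V -> R) : lebesgue_measurable mu upper (EFin \o h) ->
  exists g : V -> R, [/\ measurable_fun setT g, forall z, z.2 <= 0 -> g z = 0 &
    {ae mu, forall z, upper z -> h z = g z}].
Proof.
move=> [g mg hg]; exists (fun z => fine ((g \_ upper) z)); split.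
- apply: (measurableT_comp (fine_measurable measurableT)).
  exact/(measurable_restrictT _ (@measurable_upper R N)).
- by move=> z z0; rewrite patchE memNset// /upper/= => /lt_geF; rewrite z0.
- by apply: filterS hg => z hz zu; rewrite patchE mem_set// -hz.
Qed.

Lemma slab_compact (M ka : R) : compact (slab M ka : set V).
Proof.
apply: (@subclosed_compact _ _ (closed_box M)); first exact: closed_slab.
  exact: closed_box_compact.
by move=> z [].
Qed.

Lemma slab_upper (M ka : R) : 0 < ka -> slab M ka `<=` (upper : set V).
Proof. by move=> ka0 z [_]; exact: lt_le_trans. Qed.

Lemma Lloc_slab (s : R) (h g : V -> R) M ka : Lloc s upper (EFin \o h) ->
  {ae mu, forall z, upper z -> h z = g z} -> 0 < ka ->
  (\int[mu]_(z in slab M ka) (`|g z| `^ s)%:E < +oo)%E.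
Proof.
move=> [_ hL] hg ka0.
have := hL _ (@slab_compact M ka) (slab_upper ka0); apply: le_lt_trans.
rewrite le_eqVlt; apply/orP; left; apply/eqP; apply: ae_eq_integral_nm.
apply: filterS hg => z hz zK; rewrite /= hz ?poweR_EFin//.
exact: slab_upper zK.
Qed.

(** [a <= 1 + a^s], and slabs have finite measure. *)
Lemma L1_slab (s : R) (g : V -> R) M ka : 1 <= s -> measurable_fun setT g ->
  (\int[mu]_(z in slab M ka) (`|g z| `^ s)%:E < +oo)%E ->
  (\int[mu]_(z in slab M ka) `|g z|%:E < +oo)%E.
Proof.
move=> s1 mg; have mS := @measurable_slab R N M ka.
have mgs : measurable_fun (slab M ka) (fun z => (`|g z| `^ s)%:E).
  apply: measurable_funTS; apply/measurable_EFinP.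
  by apply: (measurableT_comp (measurable_powR s)); exact: measurableT_comp mg.
move=> hfin; apply: (@le_lt_trans _ _ (\int[mu]_(z in slab M ka) (1 + `|g z| `^ s)%:E)%E).
  apply: ae_ge0_le_integral_nm => [z _|]; first by rewrite lee_fin.
  apply: aeW => z _; rewrite lee_fin; have [g1|/ltW g1] := leP `|g z| 1.
    by rewrite ler_wpDr// powR_ge0.
  by rewrite ler_wpDl// -[leLHS]powRr1// ler_powR.
under eq_integral => z _ do rewrite EFinD.
rewrite ge0_integralD//.
apply: lte_add_pinfty => //; rewrite integral_cst_xt// mul1e.
apply: le_lt_trans (closed_box_fin N M); apply: le_measure; rewrite ?inE//.
  by apply: measurable_closed_xt; apply: compact_closed; [exact: norm_hausdorff|exact: closed_box_compact].
by move=> z [].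
Qed.

Lemma integral_upper_borel (a b c : V -> R) : {ae mu, forall z, upper z -> a z = b z} ->
  (forall z, z.2 <= 0 -> b z = 0) -> forall h : R -> R, h 0 = 0 ->
  (\int[mu]_(z in upper) (h (a z * c z))%:E = \int[mu]_z (h (b z * c z))%:E)%E.
Proof.
move=> ab b0 h h0; rewrite [RHS](_ : _ = \int[mu]_(z in upper) (h (b z * c z))%:E)%E.
  by apply: ae_eq_integral_nm; apply: filterS ab => z hz zu; rewrite hz.
rewrite [RHS]integral_mkcond; apply: eq_integral => z _; rewrite patchE.
by case: ifPn => // /negP zu; rewrite b0 ?mul0r ?h0// leNgt; apply/negP => zu'; apply/zu/mem_set.
Qed.

Lemma weakd_borel k (u g f D : V -> R) M ka (ph : V -> R) dph :
  weak_derivative upper (xt_dir k) u g ->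
  {ae mu, forall z, upper z -> u z = f z} -> {ae mu, forall z, upper z -> g z = D z} ->
  (forall z, z.2 <= 0 -> f z = 0) -> (forall z, z.2 <= 0 -> D z = 0) ->
  0 < ka -> hasgrad ph dph -> (forall z, ~ slab M ka z -> ph z = 0) ->
  pairing f (dph^~ k) = - pairing D ph.
Proof.
move=> [_ hw] uf gD f0 D0 ka0 hg phK.
have hC : C1c upper ph.
  split; first exact: hasgrad_C1 hg.
  by exists (slab M ka); split; [exact: slab_compact|exact: slab_upper|].
have := hw _ hC; rewrite (integral_upper_borel _ gD D0 (h := id))//.
under eq_integral => z _ do rewrite (hasgrad_dir z k hg).
by rewrite (integral_upper_borel _ uf f0 (h := id))// /pairing /Rintegral => ->; rewrite fineN.
Qed.

(** The mollifications of a function orthogonal to all test functions vanish, and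
they converge to the function in L^1 of each slab. *)
Lemma locally_null (e : V -> R) : measurable_fun setT e ->
  (forall M ka, 0 < ka -> (\int[mu]_(z in slab M ka) `|e z|%:E < +oo)%E) ->
  (forall M ka (ph : V -> R) dph, 0 < ka -> hasgrad ph dph ->
     (forall z, ~ slab M ka z -> ph z = 0) -> pairing e ph = 0) ->
  {ae mu, forall z, upper z -> e z = 0}.
Proof.
move=> me ei e0.
have aux (a b c : R) : - a <= b - c -> 2 * a <= c -> a <= b by lra.
have H (n : nat) : {ae mu, forall z, slab n%:R (2 / n.+1%:R) z -> e z = 0}.
  have n0 : 0 < n.+1%:R^-1 :> R by rewrite invr_gt0.
  have n1 : n.+1%:R^-1 <= 1 :> R by rewrite invf_le1// ler1n.
  (* A kernel of radius at most [1 / (n + 1)] centred in the slab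
     [|z| <= n], [z.2 >= 2 / (n + 1)] is supported in this larger slab. *)
  pose t := slab_trunc n.+1%:R n.+1%:R^-1 e.
  have mt : measurable_fun setT t by exact: measurable_slab_trunc.
  have tout y : n.+1%:R < `|y| -> t y = 0.
    by move=> yn; rewrite /t slab_trunc_out// => -[]; rewrite leNgt yn.
  have ti : (\int[mu]_z `|t z|%:E < +oo)%E.
    by rewrite (@integral_slab_trunc _ _ _ _ _ Num.norm) ?normr0//; exact: ei.
  have mS := @measurable_slab R N n%:R (2 / n.+1%:R).
  have key z d : slab n%:R (2 / n.+1%:R) z -> 0 < d <= n.+1%:R^-1 -> mollify d t z - t z = - e z.
    move=> [z1 z2] /andP[d0 dn].
    rewrite {2}/t slab_trunc_in; last first.
      by split; [rewrite (le_trans z1)// ler_nat|rewrite (le_trans _ z2)// ler_peMl// ler1n].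
    rewrite /mollify (_ : pairing t _ = 0) ?mulr0 ?sub0r//.
    have kK y : ~ slab n.+1%:R n.+1%:R^-1 y -> kern d (y - z) = 0.
      move=> yK; apply/eqP; apply: contra_notT yK => /(kern_supp (ltW d0)) yz.
      have {}yz : `|y - z| <= n.+1%:R^-1 by rewrite (le_trans yz).
      split.
        rewrite -(subrK z y) (le_trans (ler_normD _ _))// -natr1 addrC lerD//.
        exact: le_trans n1.
      have := le_trans (ler_coord2 (y - z)) yz; rewrite ler_norml => /andP[h _].
      exact: aux h z2.
    by rewrite pairing_trunc//; apply: (e0 n.+1%:R n.+1%:R^-1 _ _ n0 (hasgrad_kern d z)).
  have I0 : (\int[mu]_(z in slab n%:R (2 / n.+1%:R)) `|(e z)%:E| = 0)%E.
    apply/eqP; rewrite eq_le; apply/andP; split; last by apply: integral_ge0 => z _; rewrite abse_ge0.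
    apply/lee_addgt0Pr => ee ee0; rewrite add0e.
    have [dl dl0 hdl] := mollify_L1 mt ti tout ee0.
    pose d := Num.min dl n.+1%:R^-1.
    have d0 : 0 < d by rewrite lt_min dl0.
    have := hdl d; rewrite d0 ge_min lexx /= => /(_ isT); apply: le_trans.
    rewrite integral_mkcond; apply: ae_ge0_le_integral_nm => [z _|].
      by rewrite patchE; case: ifP => // _; rewrite abse_ge0.
    apply: aeW => z _; rewrite patchE; case: ifPn => [/set_mem zS|_]; last by rewrite lee_fin.
    by rewrite key ?normrN// d0 ge_min lexx orbT.
  have me' : measurable_fun (slab n%:R (2 / n.+1%:R)) (EFin \o e).
    by apply: measurable_funTS; exact/measurable_EFinP.
  have [+ _] := ae_eq_integral_abs mu mS me' => /(_ I0).
  by apply: filterS => z hz /hz[].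
have := ae_foralln H; apply: filterS => z hz zu.
pose n := Num.truncn (`|z| + 2 / z.2).
have zn : `|z| + 2 / z.2 < n.+1%:R by exact: truncnS_gt.
have z20 : 0 < 2 / z.2 by rewrite divr_gt0.
apply: (hz n.+1); split.
  by apply: le_trans (ltW zn); rewrite lerDl ltW.
rewrite ler_pdivrMr// mulrC -ler_pdivrMr//.
apply: le_trans (_ : n.+1%:R <= _); last by rewrite ler_nat.
by apply: le_trans (ltW zn); rewrite lerDr.
Qed.

End borel.

Lemma negligible_point (R : realType) (N : nat) (x : 'rV[R]_N) : (0 < N)%N ->
  (lebesgue_rV N).-negligible [set x].
Proof.
case: N x => // n x _.
pose A := (fun y : 'rV[R]_n.+1 => y 0 0) @^-1` [set x 0 0].
have mA : measurable A by rewrite -[A]setTI; exact: measurable_coord.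
exists A; split => //; last by move=> y ->.
transitivity ((lebesgue_measure \x lebesgue_rV n)%E (@consrV R n @^-1` A)) => //.
rewrite (_ : _ @^-1` _ = [set x 0 0] `*` setT); last first.
  by apply/seteqP; split => -[t y]; rewrite /A /preimage/= consrV0 => // -[].
by rewrite product_measure1E//= lebesgue_measure_set1 mul0e.
Qed.

(** * The weak inequality tested with a cut-off *)

Section clean.
Context (R : realType) (N : nat).
Local Notation V := ('rV[R]_N * R)%type.
Local Notation mu := (@lebesgue_xt R N).

Variables (p q m c0 : R) (A : 'rV[R]_N -> R -> 'rV[R]_N -> 'rV[R]_N) (K u0 : 'rV[R]_N -> R).
Variables (u : V -> R).
Hypotheses (hN : (0 < N)%N) (m1 : 1 < m) (c00 : 0 < c0).
Hypothesis hco : forall x w xi, 0 <= w ->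
  c0 * enorm (A x w xi) `^ (m / (m - 1)) <= dotv (A x w xi) xi.
Hypothesis Kpos : forall x, x != 0 -> 0 < K x.
Hypothesis u00 : {ae lebesgue_rV N, forall x, 0 <= u0 x}.

(** The value [K 0], of any sign, only matters on a null set since [N > 0]. *)
Lemma conv_ge0 (f : V -> R) (z : V) : (forall y, 0 <= f y) -> (0 <= Defs.conv K f z)%E.
Proof.
move=> f0; rewrite /Defs.conv.
rewrite (@ae_eq_integral_nm _ _ _ _ _ _ (fun y : 'rV[R]_N => (`|K (z.1 - y)| * f (y, z.2))%:E)).
  by apply: integral_ge0 => y _; rewrite lee_fin mulr_ge0.
have [B [mB B0 hB]] := negligible_point z.1 hN.
exists B; split => // y /= hy; apply: hB => /=; apply: contra_notP hy => yz _.
by rewrite ger0_norm// ltW// Kpos// subr_eq0; apply/eqP => e; apply: yz.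
Qed.

Lemma source_ge0 (z : V) : (0 <= source p q K u z)%E.
Proof. by rewrite mule_ge0 ?lee_fin ?powR_ge0// conv_ge0// => y; exact: powR_ge0. Qed.

Hypothesis hu : weak_solution m p q A K u0 u.

(** Borel representatives [rep_u], [rep_d], [rep_F] of the solution, of its weak
derivatives [weak_d] and of its flux. The weak gradient [weak_Du] entering the
flux is a priori another choice than [weak_d]: only the latter is known to be
locally in L^m. *)
Record clean_data := {
  rep_u : V -> R;
  rep_d : option 'I_N -> V -> R;
  rep_F : 'I_N -> V -> R;
  weak_d : option 'I_N -> V -> R;
  weak_Du : V -> 'rV[R]_N;
  measurable_rep_u : measurable_fun setT rep_u;
  measurable_rep_d : forall k, measurable_fun setT (rep_d k);
  measurable_rep_F : forall i, measurable_fun setT (rep_F i);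
  rep_u_ge0 : forall z, 0 <= rep_u z;
  rep_u_out : forall z, z.2 <= 0 -> rep_u z = 0;
  rep_d_out : forall k z, z.2 <= 0 -> rep_d k z = 0;
  rep_F_out : forall k z, z.2 <= 0 -> rep_F k z = 0;
  rep_uE : {ae mu, forall z, upper z -> u z = rep_u z};
  rep_dE : forall k, {ae mu, forall z, upper z -> weak_d k z = rep_d k z};
  rep_FE : forall i, {ae mu, forall z, upper z -> flux A u weak_Du z 0 i = rep_F i z};
  weak_dP : forall k, weak_derivative upper (xt_dir k) u (weak_d k);
  weak_d_Lm : forall k, Lloc m upper (EFin \o weak_d k);
  weak_DuP : weak_grad_x upper u weak_Du;
  flux_Lm : forall i, Lloc (m / (m - 1)) upper (fun z => (flux A u weak_Du z 0 i)%:E);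
  weak_ineq : forall ph, C1c setT ph -> (forall z, 0 <= ph z) ->
      [/\ (\int[lebesgue_xt]_(z in upper) `|u z * 'D_dir_t ph z|%:E < +oo)%E,
          (\int[lebesgue_xt]_(z in upper)
             `|dotv (flux A u weak_Du z) (grad_x ph z)|%:E < +oo)%E &
          ((\int[lebesgue_xt]_(z in upper) (source p q K u z * (ph z)%:E)) <=
           (- (\int[lebesgue_rV N]_x (u0 x * ph (x, 0))%:E))
           + (- (\int[lebesgue_xt]_(z in upper) (u z * 'D_dir_t ph z)%:E))
           + (\int[lebesgue_xt]_(z in upper)
                (dotv (flux A u weak_Du z) (grad_x ph z))%:E))%E] }.

Lemma clean_exists : inhabited clean_data.
Proof.
have [[hum [hdx hdt]] [hu0 [Du hDu [hF hS hI]]]] := hu.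
have [f1 [mf1 f1out f1E]] := borel_rep hum.1.
have hg (k : option 'I_N) : exists g : V -> R, weak_derivative upper (xt_dir k) u g /\ Lloc m upper (EFin \o g).
  case: k => [i|]; last by have [g h1 h2] := hdt; exists g.
  by have [g h1 h2] := hdx i; exists g.
have [g /all_and2[gw gm]] := choice hg.
have [d /all_and3[md dout dE]] := choice (fun k => borel_rep (gm k).1).
have [F /all_and3[mF Fout FE]] := choice (fun i => @borel_rep R N (fun z => flux A u Du z 0 i) (hF i).1).
constructor; exists (fun z => Num.max (f1 z) 0) d F g Du => //.
- exact: measurable_maxr.
- by move=> z; rewrite le_max lexx orbT.
- by move=> z z0; rewrite f1out// maxxx.
- by apply: filterS2 f1E hu0 => z h1 h2 zu; rewrite -h1// max_l// h2.
Qed.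

Variable D : clean_data.

Let cu_slab M ka : 0 < ka -> (\int[mu]_(z in slab M ka) `|rep_u D z|%:E < +oo)%E.
Proof.
move=> ka0; have [[hum _] _] := hu; apply: (L1_slab (s := m)); first exact: ltW.
  exact: measurable_rep_u.
exact: Lloc_slab hum (rep_uE D) ka0.
Qed.

Let cd_slab M ka k : 0 < ka -> (\int[mu]_(z in slab M ka) (`|rep_d D k z| `^ m)%:E < +oo)%E.
Proof. exact: Lloc_slab (weak_d_Lm D k) (rep_dE D k). Qed.

Let cd_slab1 M ka k : 0 < ka -> (\int[mu]_(z in slab M ka) `|rep_d D k z|%:E < +oo)%E.
Proof. by move=> ka0; apply: (L1_slab (s := m)); [exact: ltW|exact: measurable_rep_d|exact: cd_slab]. Qed.

Let cF_slab M ka i : 0 < ka -> (\int[mu]_(z in slab M ka) (`|rep_F D i z| `^ (m / (m - 1)))%:E < +oo)%E.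
Proof. exact: Lloc_slab (flux_Lm D i) (rep_FE D i). Qed.

Let cF_slab1 M ka i : 0 < ka -> (\int[mu]_(z in slab M ka) `|rep_F D i z|%:E < +oo)%E.
Proof.
move=> ka0; apply: (L1_slab (s := m / (m - 1))); [|exact: measurable_rep_F|exact: cF_slab].
by apply: ltW; exact: conj_exp_gt1.
Qed.

Let cweakd M ka (ph : V -> R) dph k : 0 < ka -> hasgrad ph dph ->
  (forall z, ~ slab M ka z -> ph z = 0) -> pairing (rep_u D) (dph^~ k) = - pairing (rep_d D k) ph.
Proof.
exact: weakd_borel (weak_dP D k) (rep_uE D) (rep_dE D k) (@rep_u_out D) (@rep_d_out D k).
Qed.

Let pairing_int (h ph : V -> R) M ka : measurable_fun setT h ->
  (\int[mu]_(z in slab M ka) `|h z|%:E < +oo)%E -> continuous ph ->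
  (forall z, ~ slab M ka z -> ph z = 0) ->
  mu.-integrable setT (EFin \o (fun z => h z * ph z)).
Proof.
move=> mh hfin cph phK.
have hi : (\int[mu]_z `|slab_trunc M ka h z|%:E < +oo)%E.
  by rewrite (@integral_slab_trunc _ _ _ _ _ Num.norm) ?normr0.
have ho y : M < `|y| -> slab_trunc M ka h y = 0.
  by move=> yn; rewrite slab_trunc_out// => -[]; rewrite leNgt yn.
have := pairing_integrable (measurable_slab_trunc M ka mh) hi ho (continuous_bounded_test M cph).
apply: eq_integrable => // z _ /=; congr EFin.
have [zK|zK] := pselect (slab M ka z); first by rewrite slab_trunc_in.
by rewrite phK// !mulr0.
Qed.

(** Uniqueness of the weak derivative, through [locally_null]. *)
Let Du_cd i : {ae mu, forall z, upper z -> weak_Du D z 0 i = rep_d D (Some i) z}.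
Proof.
have [hL hw] := weak_DuP D i.
have [e [me eout eE]] := borel_rep hL.1.
have es M ka : 0 < ka -> (\int[mu]_(z in slab M ka) `|e z|%:E < +oo)%E.
  move=> ka0; have := Lloc_slab M hL eE ka0.
  by under eq_integral do rewrite powRr1//.
have H : {ae mu, forall z, upper z -> e z - rep_d D (Some i) z = 0}.
  apply: locally_null.
  - by apply: measurable_funB => //; exact: measurable_rep_d.
  - move=> M ka ka0.
    have mS : measurable (slab M ka : set V) by exact: measurable_slab.
    have m1' : measurable_fun (slab M ka) (fun z => `|e z|%:E).
      by apply: measurable_funTS; apply/measurable_EFinP; exact: measurableT_comp.
    have m2' : measurable_fun (slab M ka) (fun z => `|rep_d D (Some i) z|%:E).
      apply: measurable_funTS; apply/measurable_EFinP; apply: measurableT_comp => //.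
      exact: measurable_rep_d.
    apply: (@le_lt_trans _ _ (\int[mu]_(z in slab M ka) (`|e z|%:E + `|rep_d D (Some i) z|%:E))%E).
      apply: ae_ge0_le_integral_nm => [z _|]; first by rewrite lee_fin.
      by apply: aeW => z _; rewrite -EFinD lee_fin ler_normB.
    by rewrite ge0_integralD//; apply: lte_add_pinfty; [exact: es|exact: cd_slab1].
  - move=> M ka ph dph ka0 hg phK.
    have e1 := weakd_borel (k := Some i) (conj hL hw) (rep_uE D) eE (@rep_u_out D) eout ka0 hg phK.
    have e2 := cweakd (Some i) ka0 hg phK.
    have cph := hasgrad_continuous hg.
    have -> : pairing (fun z => e z - rep_d D (Some i) z) ph = pairing e ph - pairing (rep_d D (Some i)) ph.
      rewrite /pairing -RintegralB//.
      + by congr Rintegral; apply/funext => z; rewrite mulrBl.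
      + exact: pairing_int (es M ka ka0) cph phK.
      + exact: pairing_int (measurable_rep_d D (Some i)) (cd_slab1 M (Some i) ka0) cph phK.
    by rewrite -[pairing e ph]opprK -e1 e2 opprK subrr.
apply: filterS2 eE H => z h1 h2 zu; rewrite h1//.
by apply/eqP; rewrite -subr_eq0 h2.
Qed.

Let ccoer : {ae mu, forall z, upper z ->
  c0 * flux_norm (rep_F D) z `^ (m / (m - 1)) <= \sum_i rep_F D i z * rep_d D (Some i) z}.
Proof.
have H1 : {ae mu, forall z, forall i, upper z -> flux A u (weak_Du D) z 0 i = rep_F D i z}.
  by apply: filter_forall => i; exact: rep_FE.
have H2 : {ae mu, forall z, forall i, upper z -> weak_Du D z 0 i = rep_d D (Some i) z}.
  by apply: filter_forall => i; exact: Du_cd.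
apply: filterS3 H1 H2 (rep_uE D) => z h1 h2 h3 zu.
have E1 : \row_i rep_F D i z = flux A u (weak_Du D) z.
  by apply/rowP => i; rewrite !mxE h1.
have u_ge0 : 0 <= u z by rewrite h3// rep_u_ge0.
have := hco z.1 (weak_Du D z) u_ge0; rewrite -/(flux A u (weak_Du D) z) /flux_norm E1 => /le_trans; apply.
by rewrite le_eqVlt; apply/orP; left; apply/eqP; apply: eq_bigr => i _; rewrite h1// h2.
Qed.

Lemma weak_borel (ph : V -> R) dph : C1c setT ph -> hasgrad ph dph -> (forall z, 0 <= ph z) ->
  [/\ mu.-integrable setT (EFin \o (fun z => rep_u D z * dph z None)),
      mu.-integrable setT (EFin \o (fun z => \sum_i rep_F D i z * dph z (Some i))) &
      ((\int[mu]_(z in upper) (source p q K u z * (ph z)%:E)) <=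
           (- (\int[lebesgue_rV N]_x (u0 x * ph (x, 0))%:E))
           + (- (\int[mu]_z (rep_u D z * dph z None)%:E))
           + \int[mu]_z (\sum_i rep_F D i z * dph z (Some i))%:E)%E].
Proof.
move=> hC hg ph0; have [b1 b2 b3] := weak_ineq D hC ph0.
have eD z : 'D_dir_t ph z = dph z None by exact: (hasgrad_dir z None hg).
have eX i z : 'D_(dir_x i) ph z = dph z (Some i) by exact: (hasgrad_dir z (Some i) hg).
have md k : measurable_fun setT (dph^~ k) by apply: continuous_measurable_xt; exact: hg.2.
have H1 : {ae mu, forall z, forall i, upper z -> flux A u (weak_Du D) z 0 i = rep_F D i z}.
  by apply: filter_forall => i; exact: rep_FE.
have E1 (h : R -> R) : h 0 = 0 ->
    (\int[mu]_(z in upper) (h (u z * 'D_dir_t ph z))%:E = \int[mu]_z (h (rep_u D z * dph z None))%:E)%E.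
  under eq_integral => z _ do rewrite eD.
  exact: (integral_upper_borel _ (rep_uE D) (@rep_u_out D)).
have E2 (h : R -> R) : h 0 = 0 ->
    (\int[mu]_(z in upper) (h (dotv (flux A u (weak_Du D) z) (grad_x ph z)))%:E =
     \int[mu]_z (h (\sum_i rep_F D i z * dph z (Some i)))%:E)%E.
  move=> h0; rewrite [RHS](_ : _ = \int[mu]_(z in upper) (h (\sum_i rep_F D i z * dph z (Some i)))%:E)%E.
    apply: ae_eq_integral_nm; apply: filterS H1 => z hz zu; congr (h _)%:E.
    by apply: eq_bigr => i _; rewrite hz// mxE eX.
  rewrite [RHS]integral_mkcond; apply: eq_integral => z _; rewrite patchE.
  case: ifPn => // /negP zu; rewrite big1 ?h0// => i _.
  by rewrite rep_F_out ?mul0r// leNgt; apply/negP => zu'; apply/zu/mem_set.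
split.
- apply/integrableP; split.
    by apply/measurable_EFinP; apply: measurable_funM; [exact: measurable_rep_u|exact: md].
  by rewrite -(E1 Num.norm) ?normr0.
- apply/integrableP; split.
    apply/measurable_EFinP; apply: measurable_sum => i.
    by apply: measurable_funM; [exact: measurable_rep_F|exact: md].
  by rewrite -(E2 Num.norm) ?normr0.
by rewrite -(E1 id)// -(E2 id).
Qed.

(** A test function supported away from the initial time does not see [u0], and the
source is nonnegative. *)
Let cineq_slab M ka (ph : V -> R) dph : 0 < ka -> hasgrad ph dph ->
  (forall z, 0 <= ph z) -> (forall z, ~ slab M ka z -> ph z = 0) ->
  0 <= - pairing (rep_u D) (dph^~ None) + \sum_i pairing (rep_F D i) (dph^~ (Some i)).
Proof.
move=> ka0 hg ph0 phK.
have hC : C1c setT ph.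
  split; first exact: hasgrad_C1 hg.
  by exists (slab M ka); split => //; exact: slab_compact.
have [i1 i2 i3] := weak_borel hC hg ph0.
have dphK k z : ~ slab M ka z -> dph z k = 0.
  by move=> zK; exact: hasgrad_supp (@closed_slab R N M ka) hg phK z k zK.
have ji i : mu.-integrable setT (EFin \o (fun z => rep_F D i z * dph z (Some i))).
  apply: pairing_int (measurable_rep_F D i) (cF_slab1 M i ka0) _ (dphK (Some i)); exact: hg.2.
have [_ j2] := integrable_sumr (index_enum _) ji.
rewrite /pairing -j2 -lee_fin EFinD EFinN /Rintegral.
rewrite !fineK ?integrable_fin_num//.
have S0 : (0 <= \int[mu]_(z in upper) (source p q K u z * (ph z)%:E))%E.
  by apply: integral_ge0 => z _; rewrite mule_ge0 ?source_ge0// lee_fin.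
apply: (le_trans S0); apply: (le_trans i3).
rewrite (_ : (\int[lebesgue_rV N]_x _ = 0)%E) ?oppe0 ?add0e//.
apply: integral0_eq => x _; rewrite phK ?mulr0// => -[_ /=].
by rewrite leNgt ka0.
Qed.

(** The right-hand side of the weak inequality is bounded by Young's inequality,
and the resulting flux term by the energy estimate. The real number [r] in
between records that the source term is finite. *)
Lemma source_test (al ep rr T : R) (l : nat) :
  0 < al -> al < 1 -> 0 < ep -> 0 < rr -> 0 < T -> (1 < l)%N -> m < l%:R ->
  exists r : R, (\int[mu]_(z in upper) (source p q K u z * (cutoff rr T l z)%:E) +
      \int[lebesgue_rV N]_x (u0 x * cutoff rr T l (x, 0%R))%:E <= r%:E)%E /\
    (r%:E <= (2 * l%:R + (N * l)%:R + (N * l)%:R * (2 / c0 * energy_const N m c0 l))%:E *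
      \int[mu]_(z in upper) (cutoff_error m (rep_u D) al ep rr T l z)%:E)%E.
Proof.
move=> al0 al1 ep0 rr0 T0 l1 lm.
have hg := hasgrad_cutoff N rr T l1.
have ph0 (z : V) : 0 <= cutoff rr T l z by exact: cutoff_ge0.
have hC : C1c setT (cutoff rr T l : V -> R).
  split; first exact: hasgrad_C1 hg.
  exists (closed_box (2 * rr + T)); split => //; first exact: closed_box_compact.
  by move=> z zK; apply/eqP; apply: contra_notT zK; exact: cutoff_closed_box.
have [i1 i2 i3] := weak_borel hC hg ph0.
set X1 := Rintegral mu setT (fun z => rep_u D z * dcutoff rr T l z None).
set X2 := Rintegral mu setT (fun z => \sum_i rep_F D i z * dcutoff rr T l z (Some i)).
have S0 : (0 <= \int[mu]_(z in upper) (source p q K u z * (cutoff rr T l z)%:E))%E.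
  by apply: integral_ge0 => z _; rewrite mule_ge0 ?source_ge0// lee_fin.
have a0 : (0 <= \int[lebesgue_rV N]_x (u0 x * cutoff rr T l (x, 0%R))%:E)%E.
  rewrite -[leLHS](integral0 (lebesgue_rV N) setT).
  apply: ae_ge0_le_integral_nm => //; apply: filterS u00 => x ux _.
  by rewrite lee_fin mulr_ge0.
exists (- X1 + X2); split.
  move: i3; rewrite -(fineK (integrable_fin_num measurableT i1)) -/X1.
  rewrite -(fineK (integrable_fin_num measurableT i2)) -/X2.
  move: S0 a0; set S := (\int[mu]_(z in upper) _)%E; set a := (\int[lebesgue_rV N]_x _)%E.
  case: a => [a| |]//; last by move=> + _; rewrite /= => /le_trans h /h.
  move=> S0 a0; rewrite -EFinN -!EFinD => h.
  by rewrite -leeBrDr// -EFinB; apply: le_trans h _; rewrite lee_fin -[leLHS]addrA [leLHS]addrC.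
set c1 := 2 * l%:R + (N * l)%:R; set c2 := (N * l)%:R.
pose b1 z := cutoff_error m (rep_u D) al ep rr T l z * \1_upper z.
pose d1 z := flux_density m (rep_u D) (rep_F D) al ep rr T l z * \1_upper z.
have mup := @measurable_upper R N.
have mb1 : measurable_fun setT b1.
  apply: measurable_funM; last exact: measurable_indic.
  by apply: measurable_cutoff_error => //; exact: measurable_rep_u.
have md1 : measurable_fun setT d1.
  apply: measurable_funM; last exact: measurable_indic.
  by apply: measurable_flux_density => //; [exact: measurable_rep_u|exact: measurable_rep_F].
have b10 z : 0 <= b1 z by rewrite mulr_ge0// cutoff_error_ge0//; exact: rep_u_ge0.
have d10 z : 0 <= d1 z by rewrite mulr_ge0// flux_density_ge0//; exact: rep_u_ge0.
have c10 : 0 <= c1 by rewrite addr_ge0// mulr_ge0.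
have c20 : 0 <= c2 by exact: ler0n.
have I1 (h : V -> R) : (\int[mu]_(z in upper) (h z)%:E = \int[mu]_z (h z * \1_upper z)%:E)%E.
  rewrite integral_mkcond; apply: eq_integral => z _; rewrite patchE indicE.
  by case: ifPn => _; rewrite ?mulr1 ?mulr0.
have bound z : `|- (rep_u D z * dcutoff rr T l z None) + \sum_i rep_F D i z * dcutoff rr T l z (Some i)| <=
    c1 * b1 z + c2 * d1 z.
  rewrite /b1 /d1 indicE; have [zu|zu] := pselect (upper z); last first.
    have z0 : z.2 <= 0 by rewrite leNgt; apply/negP.
    rewrite (rep_u_out D z0) mul0r oppr0 add0r big1 ?normr0; last by move=> i _; rewrite (rep_F_out D i z0) mul0r.
    by rewrite memNset// !mulr0 addr0.
  rewrite mem_set// !mulr1; apply: le_trans (ler_normD _ _) _; rewrite normrN.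
  have y := young_dcutoff m1 (rep_F D) (rep_u_ge0 D) al0 ep0 rr0 T0 l1 lm z ltr01.
  rewrite invr1 !powR1 !mulr1 in y.
  rewrite (_ : c1 * _ + _ = 2 * l%:R * cutoff_error m (rep_u D) al ep rr T l z +
     (c2 * flux_density m (rep_u D) (rep_F D) al ep rr T l z + c2 * cutoff_error m (rep_u D) al ep rr T l z)); last first.
    by rewrite /c1 /c2; ring.
  apply: lerD; last first.
    apply: le_trans (ler_norm_sum _ _ _) _; apply: le_trans y.
    by apply: ler_sum => i _; rewrite normrM.
  rewrite normrM (ger0_norm (rep_u_ge0 D z)).
  apply: (@le_trans _ _ (rep_u D z * (2 * l%:R / T * cutoff_base rr T z ^+ l.-1))).
    by rewrite ler_wpM2l ?rep_u_ge0// dcutoff_t.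
  have -> : rep_u D z * (2 * l%:R / T * cutoff_base rr T z ^+ l.-1) =
    2 * l%:R * (rep_u D z / T * cutoff_base rr T z ^+ l.-1) by ring.
  have e0 : 0 <= cutoff_base rr T z by exact: cutoff_base_ge0.
  rewrite ler_wpM2l ?mulr_ge0// lerDl; apply: mulr_ge0; last exact: powR_ge0.
  by apply: mulr_ge0; exact: powR_ge0.
have ij : mu.-integrable setT (EFin \o (fun z => - (rep_u D z * dcutoff rr T l z None) +
    \sum_i rep_F D i z * dcutoff rr T l z (Some i))).
  by have := integrableD measurableT (integrableN i1) i2; apply: eq_integrable => // z _.
have -> : - X1 + X2 = Rintegral mu setT (fun z => - (rep_u D z * dcutoff rr T l z None) +
    \sum_i rep_F D i z * dcutoff rr T l z (Some i)).
  rewrite addrC /X1 /X2 -RintegralB//; congr Rintegral; apply/funext => z; exact: addrC.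
have en := energy m1 c00 (measurable_rep_u D) (measurable_rep_d D) (measurable_rep_F D) (rep_u_ge0 D) cu_slab cd_slab1
  (fun M ka i => cd_slab M (Some i)) cF_slab1 cF_slab cweakd cineq_slab ccoer al0 al1 ep0 rr0 T0 l1 lm.
apply: (@le_trans _ _ (\int[mu]_z (c1 * b1 z + c2 * d1 z)%:E)%E).
  apply: (@le_trans _ _ (\int[mu]_z `|- (rep_u D z * dcutoff rr T l z None) +
    \sum_i rep_F D i z * dcutoff rr T l z (Some i)|%:E)%E); last first.
    by apply: ae_ge0_le_integral_nm => [z _|]; [rewrite lee_fin|apply: aeW => z _; rewrite lee_fin].
  have /integrableP[mij _] := ij; apply: le_trans (le_abse_integral _ measurableT mij).
  by rewrite /Rintegral fineK ?lee_abs//; exact: integrable_fin_num ij.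
rewrite ge0_integralDr; last first.
  by move=> z; rewrite mulr_ge0.
  by move=> z; rewrite mulr_ge0.
  exact: measurable_funM.
  exact: measurable_funM.
have EB : (\int[mu]_z (b1 z)%:E = \int[mu]_(z in upper) (cutoff_error m (rep_u D) al ep rr T l z)%:E)%E by rewrite I1.
have ED : (\int[mu]_z (d1 z)%:E = \int[mu]_(z in upper) (flux_density m (rep_u D) (rep_F D) al ep rr T l z)%:E)%E by rewrite I1.
rewrite !ge0_integralZ// EB ED.
have nn : (0 <= \int[mu]_(z in upper) (cutoff_error m (rep_u D) al ep rr T l z)%:E)%E.
  by apply: integral_ge0 => z _; rewrite lee_fin cutoff_error_ge0//; exact: rep_u_ge0.
have c3 : 0 <= 2 / c0 * energy_const N m c0 l.
  by rewrite mulr_ge0 ?divr_ge0 ?(ltW c00)// ltW// energy_const_gt0.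
rewrite (EFinD c1) ge0_muleDl ?lee_fin//; last by rewrite mulr_ge0.
apply: leeD => //.
rewrite (EFinM c2) -muleA; apply: lee_wpmul2l; first by rewrite lee_fin.
rewrite (EFinM (2 / c0)) -muleA -[leLHS]mul1e (_ : 1%E = ((2 / c0) * (c0 / 2))%:E); last first.
  by congr EFin; field; rewrite gt_eqF.
rewrite (EFinM (2 / c0)) -muleA; apply: lee_wpmul2l => //.
by rewrite lee_fin divr_ge0// ltW.
Qed.

End clean.

(** * Lower bound for the kernel, symmetrization *)

Section kernel.
Context (R : realType) (N : nat).
Local Notation V := ('rV[R]_N * R)%type.

Lemma enorm_le (x : 'rV[R]_N) (r : R) : 0 <= r -> (forall i, `|x 0 i| <= r) -> enorm x <= N%:R * r.
Proof.
move=> r0 xr; rewrite -[leRHS]ger0_norm ?mulr_ge0// -sqrtr_sqr ler_sqrt ?sqr_ge0//.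
apply: (@le_trans _ _ (\sum_(i < N) r ^+ 2)).
  apply: ler_sum => i _; rewrite -expr2 -(real_normK (num_real (x 0 i))).
  by rewrite ler_sqr ?nnegrE.
rewrite sumr_const card_ord -[leLHS]mulr_natl exprMn ler_wpM2r ?sqr_ge0//.
by rewrite -natrX ler_nat; case: (N) => // n; rewrite expnS leq_pmulr.
Qed.

Lemma kernel_near0 (beta : R) (K : 'rV[R]_N -> R) : admissible_kernel beta K ->
  exists d k : R, [/\ 0 < d, 0 < k & forall x : 'rV[R]_N, x != 0 -> `|x| < d -> k <= K x].
Proof.
move=> [_ _ Kinf _]; move: Kinf; rewrite /limf_einf oppe_gt0 => /ereal_inf_lt[_ [W W0 <-] Wlt].
have [k k0 kW] : exists2 k : R, 0 < k & (ereal_sup ((\- (EFin \o K)) @` W) <= (- k)%:E)%E.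
  move: Wlt; case: ereal_sup => [s| |]//; last by move=> _; exists 1; rewrite ?leNye.
  by rewrite lte_fin => s0; exists (- s); rewrite ?oppr_gt0// opprK.
have /nbhs_ballP[d /= d0 dW] : nbhs (0 : 'rV[R]_N) [set x | x != 0 -> W x] by exact: W0.
exists d, k; split => // x x0 xd.
have Wx : W x by apply: dW => //; rewrite -ball_normE /ball_/= sub0r normrN.
have : ((\- (EFin \o K)) x <= (- k)%:E)%E.
  by apply: le_trans kW; apply: ereal_sup_ubound; exists x.
by rewrite lee_fin lerN2.
Qed.

(** The kernel is bounded below by a positive constant near 0 and, by compactness,
on the remaining part of the ball of radius [rho]; outside this ball the decay
assumption applies. *)
Lemma kernel_lower (beta : R) (K : 'rV[R]_N -> R) : 0 < beta -> admissible_kernel beta K ->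
  (0 < N)%N ->
  exists2 k : R, 0 < k & forall (r : R) (x : 'rV[R]_N), 1 <= r -> x != 0 -> (forall i, `|x 0 i| <= 4 * r) ->
    k * r `^ (- beta) <= K x.
Proof.
move=> b0 hK N0; have [d [k1 [d0 k10 hk1]]] := kernel_near0 hK.
have [Kc Kp _ [rho [cK [rho0 cK0 Kfar]]]] := hK.
have [k2 k20 hk2] : exists2 k2 : R, 0 < k2 & forall x : 'rV[R]_N, d <= `|x| -> enorm x <= rho -> k2 <= K x.
  pose B : set V := closed_box rho `&` [set z | d <= `|z.1|].
  have cB : compact B.
    apply: (@subclosed_compact _ _ (closed_box rho)); last by move=> z [].
    - apply: closedI; first by apply: compact_closed; [exact: norm_hausdorff|exact: closed_box_compact].
      apply: (@preimage_closed _ _ (fun z : V => `|z.1|) [set t : R | d <= t]); last exact: closed_ge.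
      move=> z _; apply: continuous_comp; [exact: cvg_fst|exact: norm_continuous].
    - exact: closed_box_compact.
  have B0 z : B z -> z.1 != 0.
    by move=> [_ /=]; rewrite -normr_gt0; exact: lt_le_trans.
  have inB x : d <= `|x| -> enorm x <= rho -> B (x, 0).
    move=> dx xrho; split => //; apply: ler_norm_xt; first exact: ltW.
      by move=> i; exact: le_trans (ler_enorm x i) xrho.
    by rewrite normr0 ltW.
  have [Bne|Bne] := pselect (B !=set0); last first.
    by exists 1 => // x dx xr; exfalso; apply: Bne; exists (x, 0); exact: inB.
  have cKB : {within B, continuous (fun z : V => K z.1)}.
    apply: continuous_in_subspaceT => z /set_mem Bz.
    by apply: continuous_comp; [exact: cvg_fst|exact: Kc (B0 _ Bz)].
  have [z0 /set_mem Bz0 hz0] := compact_EVT_min Bne cB cKB.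
  exists (K z0.1); first exact: Kp (B0 _ Bz0).
  by move=> x dx xr; apply: (hz0 (x, 0)); apply/mem_set; exact: inB.
have N0' : 0 < N%:R * 4 :> R by rewrite mulr_gt0// ltr0n.
(* [enorm x <= 4 N r] when all coordinates are at most [4 r]. *)
pose k3 := cK * (N%:R * 4) `^ (- beta).
exists (Num.min k1 (Num.min k2 k3)).
  by rewrite !lt_min k10 k20 mulr_gt0// powR_gt0.
move=> r x r1 x0 xr.
have rb : r `^ (- beta) <= 1 by rewrite -(powRr0 r) ler_powR// oppr_le0 ltW.
have rb0 := powR_ge0 r (- beta).
have [xd|dx] := ltP `|x| d.
  apply: le_trans (hk1 x x0 xd); rewrite -[leRHS]mulr1 ler_pM// ?ge_min ?lexx//.
  by rewrite !le_min !ltW//= mulr_gt0// powR_gt0.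
have [xr1|xr1] := leP (enorm x) rho.
  apply: le_trans (hk2 x dx xr1); rewrite -[leRHS]mulr1 ler_pM// ?ge_min ?lexx ?orbT//.
  by rewrite !le_min !ltW//= mulr_gt0// powR_gt0.
apply: le_trans (Kfar x xr1).
apply: (@le_trans _ _ (k3 * r `^ (- beta))).
  by rewrite ler_wpM2r// !ge_min lexx !orbT.
rewrite /k3 -mulrA ler_wpM2l ?(ltW cK0)//.
rewrite -powRM ?(ltW N0')//; last by rewrite (le_trans ler01).
have r0 : 0 < r by rewrite (lt_le_trans ltr01).
have en0 : 0 < enorm x by rewrite (lt_trans rho0).
have Nr0 : 0 < N%:R * 4 * r by rewrite mulr_gt0.
rewrite !powRN lef_pV2 ?posrE ?powR_gt0//.
rewrite ge0_ler_powR ?nnegrE ?(ltW b0) ?(ltW en0) ?(ltW Nr0)//.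
by rewrite -mulrA enorm_le// mulr_ge0// ltW.
Qed.

End kernel.

Section sections.
Context (R : realType) (N : nat).
Local Notation V := ('rV[R]_N * R)%type.
Local Notation mu := (@lebesgue_xt R N).

(** Tonelli for the indicator of a measurable null set. *)
Lemma ae_sections (P : V -> Prop) : {ae mu, forall z, P z} ->
  {ae @lebR R, forall t, {ae lebesgue_rV N, forall x, P (x, t)}}.
Proof.
move=> [B [mB B0 hB]].
pose f (z : V) : \bar R := (\1_B z)%:E.
have mf : measurable_fun setT f by apply/measurable_EFinP; exact: measurable_indic.
have f0 z : (0 <= f z)%E by rewrite lee_fin.
have I0 : (\int[@lebR R]_t fubini_G (lebesgue_rV N) f t = 0)%E.
  rewrite -(fubini_tonelli2 (m1 := lebesgue_rV N) (m2 := @lebR R) f mf f0) -lebesgue_xtE.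
  by rewrite integral_indic// setIT.
have G0 t : (0 <= fubini_G (lebesgue_rV N) f t)%E by exact: integral_ge0.
have mG : measurable_fun setT (fubini_G (lebesgue_rV N) f).
  exact: measurable_fun_fubini_tonelli_G.
have [+ _] := ae_eq_integral_abs (@lebR R) measurableT mG.
under eq_integral do rewrite gee0_abs//.
move=> /(_ I0); apply: filterS => t /(_ I) ht.
exists ((fun x => (x, t)) @^-1` B); split.
- by rewrite -[X in measurable X]setTI; exact: measurable_pair2.
- move: ht; rewrite /fubini_G /f /= => <-.
  rewrite -[RHS](_ : (\int[lebesgue_rV N]_x (\1_((fun x => (x, t)) @^-1` B) x)%:E = _)%E)//.
  rewrite integral_indic// ?setIT//.
  by rewrite -[X in measurable X]setTI; exact: measurable_pair2.
- by move=> x /= hx; exact: hB.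
Qed.

Lemma ae_lift_time (Q : R -> Prop) : {ae @lebR R, forall t, Q t} -> {ae mu, forall z, Q z.2}.
Proof.
move=> [B [mB B0 hB]]; exists (setT `*` B); split.
- exact: measurableX.
- rewrite lebesgue_xtE product_measure1E//; exact: etrans (congr1 _ B0) (mule0 _).
- by move=> z hz; split => //; exact: hB.
Qed.

End sections.

Section symmetrization.
Context d (T : measurableType d) (R : realType) (mu : {measure set T -> \bar R}).

(** [x^2 + y^2 >= 2 x y] with [x = a^(p/2) b^(q/2)] and [y = a^(q/2) b^(p/2)]. *)
Lemma powR_sym (p q a b : R) : 0 < p -> 0 < q -> 0 <= a -> 0 <= b ->
  2 * (a `^ ((p + q) / 2) * b `^ ((p + q) / 2)) <= a `^ p * b `^ q + a `^ q * b `^ p.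
Proof.
move=> p0 q0 a0 b0.
have h (x r : R) : 0 <= x -> 0 < r -> x `^ r = (x `^ (r / 2)) ^+ 2.
  by move=> x0 r0; rewrite -powR_mulrn ?powR_ge0// -powRrM mulfVK.
have h2 x : 0 <= x -> x `^ ((p + q) / 2) = x `^ (p / 2) * x `^ (q / 2).
  move=> x0; rewrite mulrDl powRD//; apply/implyP => /eqP e; exfalso.
  by have : 0 < p / 2 + q / 2 by [rewrite addr_gt0 ?divr_gt0//]; rewrite e ltxx.
rewrite (h a p)// (h b p)// (h a q)// (h b q)// !h2//.
rewrite -subr_ge0.
rewrite (_ : _ - _ = (a `^ (p / 2) * b `^ (q / 2) - a `^ (q / 2) * b `^ (p / 2)) ^+ 2); last by ring.
exact: sqr_ge0.
Qed.

Definition moment (U W : T -> R) (r : R) : \bar R := (\int[mu]_x (U x `^ r * W x)%:E)%E.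

Lemma moment_ge0 U W r : (forall x, 0 <= W x) -> (0 <= moment U W r)%E.
Proof. by move=> W0; apply: integral_ge0 => x _; rewrite lee_fin mulr_ge0// powR_ge0. Qed.

(** The product of the two moments is a double integral; adding the one with the
roles of the variables exchanged, [powR_sym] applies under the integral. *)
Lemma moment_symmetrization (p q : R) (U W : T -> R) : 0 < p -> 0 < q ->
  measurable_fun setT U -> measurable_fun setT W -> (forall x, 0 <= U x) -> (forall x, 0 <= W x) ->
  (moment U W ((p + q) / 2)%R * moment U W ((p + q) / 2)%R <= moment U W p * moment U W q)%E.
Proof.
move=> p0 q0 mU mW U0 W0; set I := moment U W; set s := ((p + q) / 2)%R.
have mr r : measurable_fun setT (fun x => U x `^ r * W x).
  by apply: measurable_funM => //; exact: measurableT_comp (measurable_powR r) mU.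
have mre r : measurable_fun setT (fun x => (U x `^ r * W x)%:E) by exact/measurable_EFinP.
have r0 r x : 0 <= U x `^ r * W x by rewrite mulr_ge0 ?powR_ge0.
have I0 r : (0 <= I r)%E by exact: moment_ge0.
have key : (2%:E * (I s * I s) <= I p * I q + I q * I p)%E.
  rewrite -!(ge0_integralZr _ measurableT (mre _))//; try (by move=> x _; rewrite lee_fin).
  rewrite -ge0_integralD//; last first.
  - by apply: emeasurable_funM.
  - by move=> x _; rewrite mule_ge0// lee_fin.
  - by apply: emeasurable_funM.
  - by move=> x _; rewrite mule_ge0// lee_fin.
  rewrite -ge0_integralZl_EFin//; last first.
  - by apply: emeasurable_funM.
  - by move=> x _; rewrite mule_ge0// lee_fin.
  apply: ge0_le_integral_nm => x; first by rewrite mule_ge0// mule_ge0// lee_fin.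
  rewrite muleA -EFinM /I -!ge0_integralZ//; last first.
  - by rewrite mulr_ge0.
  rewrite -ge0_integralDr//; last first.
  - by move=> y; rewrite mulr_ge0.
  - by move=> y; rewrite mulr_ge0.
  - exact: measurable_funM.
  - exact: measurable_funM.
  apply: ge0_le_integral_nm => y; rewrite lee_fin; first by rewrite !mulr_ge0// powR_ge0.
  have := ler_wpM2r (mulr_ge0 (W0 x) (W0 y)) (powR_sym p0 q0 (U0 x) (U0 y)).
  rewrite -/s -subr_ge0 => h; rewrite -subr_ge0; apply: (le_trans h).
  by rewrite le_eqVlt; apply/orP; left; apply/eqP; ring.
move: key; rewrite [X in (_ <= _ + X)%E]muleC -mule2n -mule_natl.
by rewrite lee_pmul2l.
Qed.

End symmetrization.

(** * Lower bound for the source term *)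

Section source_lower.
Context (R : realType) (N : nat).
Local Notation V := ('rV[R]_N * R)%type.
Local Notation mu := (@lebesgue_xt R N).
Local Notation lebN := (@lebesgue_rV R N).

Variables (p q rr T : R) (l : nat) (f : V -> R).
Hypotheses (hN : (0 < N)%N) (p0 : 0 < p) (q0 : 0 < q) (rr0 : 0 < rr) (T0 : 0 < T) (l1 : (1 < l)%N).
Hypothesis mf : measurable_fun setT f.
Hypothesis f0 : forall z, 0 <= f z.
Hypothesis fout : forall z, z.2 <= 0 -> f z = 0.

Let ph := cutoff rr T l : V -> R.
Let s := (p + q) / 2.

Definition slice_moment (r t : R) : \bar R := moment lebN (fun x => f (x, t)) (fun x => ph (x, t)) r.

Let ph0 z : 0 <= ph z. Proof. exact: cutoff_ge0. Qed.

Let mph : measurable_fun setT ph.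
Proof.
by apply: continuous_measurable_xt; exact: hasgrad_continuous (hasgrad_cutoff N rr T l1).
Qed.

Let s0 : 0 < s. Proof. by rewrite divr_gt0// addr_gt0. Qed.

Let mw r : measurable_fun setT (fun z => f z `^ r * ph z).
Proof. by apply: measurable_funM => //; exact: measurableT_comp (measurable_powR r) mf. Qed.

Let wE r (z : V) : \bar R := (f z `^ r * ph z)%:E.

Let mwE r : measurable_fun setT (wE r).
Proof. exact/measurable_EFinP. Qed.

Let wE0 r z : (0 <= wE r z)%E. Proof. by rewrite lee_fin mulr_ge0// powR_ge0. Qed.

Lemma slice_moment_ge0 r t : (0 <= slice_moment r t)%E. Proof. exact: moment_ge0. Qed.

Lemma measurable_slice_moment r : measurable_fun setT (slice_moment r).
Proof. exact: (measurable_fun_fubini_tonelli_G (m1 := lebN) _ (mwE r) (wE0 r)). Qed.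

Let mam_slice_moment r r' : measurable_fun setT (fun t => slice_moment r t * slice_moment r' t)%E.
Proof. by apply: emeasurable_funM; exact: measurable_slice_moment. Qed.

Let ph_supp z : ph z != 0 -> (forall i, `|z.1 0 i| <= 2 * rr) /\ `|z.2| <= T.
Proof. exact: cutoff_supp. Qed.

(** On the support of the cut-off the points [x], [y] satisfy
[|x_i - y_i| <= 4 rr], so the kernel can be replaced by its lower bound [kap];
for almost every time the source then contains the product of two moments. *)
Lemma source_lower (K : 'rV[R]_N -> R) (u : V -> R) (kap : R) : 0 <= kap ->
  {ae mu, forall z, upper z -> u z = f z} -> (forall x : 'rV[R]_N, x != 0 -> 0 < K x) ->
  (forall x : 'rV[R]_N, x != 0 -> (forall i, `|x 0 i| <= 4 * rr) -> kap <= K x) ->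
  (kap%:E * \int[@lebR R]_t (slice_moment s t * slice_moment s t) <=
   \int[mu]_(z in upper) (source p q K u z * (ph z)%:E))%E.
Proof.
move=> kap0 uf Kpos Kk.
(* For almost every time, [u] and [f] agree at almost every point of space. *)
have good := ae_lift_time N (ae_sections uf).
pose h (z : V) : \bar R := (slice_moment p z.2 * wE q z)%E.
have h0 z : (0 <= h z)%E by rewrite mule_ge0// slice_moment_ge0.
have mam2 : measurable_fun setT (fun z : V => slice_moment p z.2).
  exact: measurableT_comp (measurable_slice_moment p) measurable_snd.
have mh : measurable_fun setT h by exact: emeasurable_funM.
have step1 : {ae mu, forall z, upper z -> (kap%:E * h z <= source p q K u z * (ph z)%:E)%E}.
  apply: filterS2 good uf => -[x t] /= gt uft tu.
  rewrite /h /source /wE /= (uft tu) EFinM.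
  have [->|phz] := eqVneq (ph (x, t)) 0; first by rewrite !mule0.
  rewrite !muleA; do 2 (apply: lee_wpmul2r; first by rewrite lee_fin ?powR_ge0).
  have mwt : measurable_fun setT (fun y => f (y, t) `^ p * ph (y, t)).
    exact: measurableT_comp (mw p) (measurable_pair2 t).
  have wt0 y : 0 <= f (y, t) `^ p * ph (y, t) by rewrite mulr_ge0// powR_ge0.
  rewrite /slice_moment /moment -ge0_integralZ//.
  apply: ae_ge0_le_integral_nm => [y _|]; first by rewrite lee_fin mulr_ge0.
  have yx : {ae lebN, forall y, y <> x}.
    by apply: negligibleS (negligible_point x hN) => y /contrapT.
  apply: filterS2 gt yx => y /(_ tu) uy xy _; rewrite lee_fin /= uy.
  have xy0 : x - y != 0 by rewrite subr_eq0; apply/eqP => e; exact: xy.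
  have [->|phy] := eqVneq (ph (y, t)) 0.
    by rewrite !mulr0 mulr_ge0 ?powR_ge0// ltW// Kpos.
  have Kxy : kap <= K (x - y).
    apply: Kk => // i; rewrite !mxE; apply: le_trans (ler_normB _ _) _.
    have [hx _] := ph_supp phz; have [hy _] := ph_supp phy.
    rewrite (_ : 4 * rr = 2 * rr + 2 * rr); last ring.
    by apply: lerD; [exact: hx|exact: hy].
  rewrite ler_pM// ?mulr_ge0 ?powR_ge0// ler_piMr ?powR_ge0//.
  exact: cutoff_le1.
have H0 : (\int[mu]_(z in upper) (kap%:E * h z) = kap%:E * \int[@lebR R]_t (slice_moment p t * slice_moment q t))%E.
  transitivity (\int[mu]_z (kap%:E * h z))%E.
    rewrite integral_mkcond; apply: eq_integral => z _; rewrite patchE.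
    case: ifPn => // /negP zu; rewrite /h /wE fout ?powR0 ?gt_eqF// ?mul0r ?mule0//.
    by rewrite leNgt; apply/negP => zu'; apply/zu/mem_set.
  rewrite ge0_integralZl_EFin//; congr (_ * _)%E.
  rewrite -[LHS]/(\int[mu]_z h z)%E lebesgue_xtE.
  rewrite (fubini_tonelli2 (m1 := lebN) (m2 := @lebR R) h mh h0).
  apply: eq_integral => t _; rewrite /fubini_G /h /=.
  rewrite ge0_integralZl//.
  - exact: measurableT_comp (mwE q) (measurable_pair2 t).
  - exact: slice_moment_ge0.
apply: (@le_trans _ _ (\int[mu]_(z in upper) (kap%:E * h z))%E); last first.
  by apply: ae_ge0_le_integral_nm => // z _; rewrite mule_ge0.
rewrite H0; apply: lee_wpmul2l; first by rewrite lee_fin.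
apply: ge0_le_integral_nm => t; first by rewrite mule_ge0// slice_moment_ge0.
apply: moment_symmetrization => //.
- exact: measurableT_comp mf (measurable_pair2 t).
- exact: measurableT_comp mph (measurable_pair2 t).
Qed.

(** [a <= b + a^2 / b] on the time interval ]0, T], outside of which the moment is 0. *)
Lemma time_amgm (b : R) : 0 < b ->
  (\int[mu]_(z in upper) (f z `^ s * ph z)%:E <=
   (b * T)%:E + b^-1%:E * \int[@lebR R]_t (slice_moment s t * slice_moment s t))%E.
Proof.
move=> b0.
have -> : (\int[mu]_(z in upper) (f z `^ s * ph z)%:E = \int[@lebR R]_t slice_moment s t)%E.
  transitivity (\int[mu]_z wE s z)%E.
    rewrite integral_mkcond; apply: eq_integral => z _; rewrite patchE /wE.
    case: ifPn => // /negP zu; rewrite fout ?powR0 ?gt_eqF// ?mul0r//.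
    by rewrite leNgt; apply/negP => zu'; apply/zu/mem_set.
  by rewrite lebesgue_xtE (fubini_tonelli2 (m1 := lebN) (m2 := @lebR R) _ (mwE s) (wE0 s)).
have mI : measurable (`]0, T]%classic : set R) by [].
have mI1 : measurable_fun setT (\1_(`]0, T]%classic) : R -> R) by exact: measurable_indic.
have -> : ((b * T)%:E = \int[@lebR R]_t (b * \1_(`]0%R, T]%classic) t)%:E)%E.
  rewrite ge0_integralZ ?(ltW b0)//.
  by rewrite integral_indic// setIT [X in (_ * X)%E](lebR_itv (ltW T0)) subr0 EFinM.
rewrite -ge0_integralZl_EFin//; last 2 first.
- by move=> t _; rewrite mule_ge0// slice_moment_ge0.
- by rewrite invr_ge0 ltW.
rewrite -ge0_integralD//; last 4 first.
- by move=> t _; rewrite lee_fin mulr_ge0// ltW.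
- by apply/measurable_EFinP; exact: measurable_funM.
- by move=> t _; rewrite mule_ge0 ?mule_ge0 ?slice_moment_ge0// lee_fin invr_ge0 ltW.
- by apply: emeasurable_funM => //; exact: measurable_cst.
apply: ge0_le_integral_nm => t; first exact: slice_moment_ge0.
have [tT|tT] := boolP (t \in `]0, T]%classic).
  rewrite indicE tT mulr1; have := slice_moment_ge0 s t.
  case: (slice_moment s t) => [x| |]//= x0; last first.
    by rewrite mulyy gt0_muley ?lte_fin ?invr_gt0// addey.
  rewrite -!EFinM -EFinD lee_fin -subr_ge0.
  rewrite (_ : _ - _ = b^-1 * ((x - b / 2) ^+ 2 + 3 / 4 * b ^+ 2)); last by field; rewrite gt_eqF.
  apply: mulr_ge0; first by rewrite invr_ge0 ltW.
  by apply: addr_ge0; [exact: sqr_ge0|apply: mulr_ge0; [rewrite divr_ge0|exact: sqr_ge0]].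
rewrite indicE (negbTE tT) mulr0 add0e.
rewrite (_ : slice_moment s t = 0%E) ?mule0//.
apply: integral0_eq => x _; congr EFin; have [t0|t0] := leP t 0.
  by rewrite fout// powR0 ?mul0r// gt_eqF.
apply/eqP; rewrite mulf_eq0; apply/orP; right; apply: contraNT tT => /ph_supp[_ /= tT].
by rewrite inE/= in_itv/= t0 (le_trans (ler_norm t)).
Qed.

End source_lower.

(** * Absorption and initial mass *)

Section absorption.
Context (R : realType).

Lemma powR_le1_anti (e a b : R) : 0 <= e -> e <= 1 -> 0 < a -> a <= b -> e `^ b <= e `^ a.
Proof.
move=> e0 e1 a0 ab; move: e0; rewrite le_eqVlt => /orP[/eqP <-|e0].
  by rewrite !powR0 ?gt_eqF// (lt_le_trans a0).
by rewrite ger_powR// e0.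
Qed.

(** With [X = w^s e^l] the two terms are at most [X^(1/s)] and a multiple of
[1 + X^(sig/s)]: the conditions on [l] compare the powers of [e], and
[powR_absorb] applies. *)
Lemma cutoff_error_absorb (m s sig al de : R) (l : nat) : 0 < al -> 1 < s -> 0 < sig -> sig < s -> 0 < de ->
  (1 < l)%N -> l%:R / s <= l%:R - 1 -> l%:R * (sig / s) <= l%:R - m ->
  exists2 C : R, 0 <= C & forall w e : R, 0 <= w -> 0 <= e -> e <= 1 ->
    w * e ^+ l.-1 + al `^ (1 - m) * (1 + w) `^ sig * e `^ (l%:R - m) <= de * (w `^ s * e ^+ l) + C.
Proof.
move=> al0 s1 sig0 sigs de0 l1 hl1 hl2.
have s0 : 0 < s by exact: lt_trans s1.
have ls : 0 < (l%:R : R) by rewrite ltr0n ltnW.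
set A := al `^ (1 - m) * 2 `^ sig.
have A0 : 0 < A by rewrite mulr_gt0 ?powR_gt0.
have [C1 C10 h1] : exists2 C : R, 0 <= C & forall X, 0 <= X -> X `^ (s^-1) <= de / 2 * X + C.
  by apply: powR_absorb; [rewrite invr_gt0|rewrite invf_lt1|rewrite divr_gt0].
have [C2 C20 h2] : exists2 C : R, 0 <= C & forall X, 0 <= X -> X `^ (sig / s) <= de / (2 * A) * X + C.
  by apply: powR_absorb; [rewrite divr_gt0|rewrite ltr_pdivrMr// mul1r|rewrite divr_gt0// mulr_gt0].
exists (C1 + A * (1 + C2)); first by rewrite addr_ge0// mulr_ge0 ?addr_ge0 ?(ltW A0).
move=> w e w0 e0 e1; set X := w `^ s * e ^+ l.
have X0 : 0 <= X by rewrite mulr_ge0 ?powR_ge0 ?exprn_ge0.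
have Xr r : X `^ (r / s) = w `^ r * e `^ (l%:R * (r / s)).
  rewrite /X powRM ?powR_ge0 ?exprn_ge0// -!powRrM mulrCA divff ?gt_eqF// mulr1.
  by rewrite -powR_mulrn// -powRrM.
have b1 : w * e ^+ l.-1 <= de / 2 * X + C1.
  apply: le_trans (h1 X X0); rewrite -[s^-1]mul1r Xr powRr1// ler_wpM2l// -powR_mulrn//.
  apply: powR_le1_anti => //; first by rewrite mul1r divr_gt0.
  rewrite mul1r (le_trans hl1)// -[X in X%:R - 1](prednK (ltnW l1)) -natr1 addrK.
  exact: lexx.
have b2 : al `^ (1 - m) * (1 + w) `^ sig * e `^ (l%:R - m) <= de / 2 * X + A * (1 + C2).
  apply: (@le_trans _ _ (A * (1 + X `^ (sig / s)))).
    rewrite /A -!mulrA ler_wpM2l ?powR_ge0//.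
    apply: (@le_trans _ _ (2 `^ sig * (1 + w `^ sig) * e `^ (l%:R - m))).
      rewrite ler_wpM2r ?powR_ge0//.
      by have := powRD_le (ltW sig0) (@ler01 R) w0; rewrite powR1.
    rewrite -mulrA ler_wpM2l ?powR_ge0// mulrDl mul1r Xr lerD//.
      have lm0 : 0 < l%:R - m by apply: lt_le_trans hl2; rewrite mulr_gt0// divr_gt0.
      apply: (@le_trans _ _ (1 `^ (l%:R - m))); last by rewrite powR1.
      by rewrite ge0_ler_powR ?nnegrE// ltW.
    rewrite ler_wpM2l ?powR_ge0//; apply: powR_le1_anti => //.
    by rewrite mulr_gt0// divr_gt0.
  rewrite mulrDr mulr1 (le_trans (lerD (lexx _) (ler_wpM2l (ltW A0) (h2 X X0))))//.
  rewrite le_eqVlt; apply/orP; left; apply/eqP; field.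
  by rewrite gt_eqF.
apply: (le_trans (lerD b1 b2)).
by rewrite le_eqVlt; apply/orP; left; apply/eqP; field.
Qed.

End absorption.

Section final_bounds.
Context (R : realType) (N : nat).
Local Notation V := ('rV[R]_N * R)%type.
Local Notation mu := (@lebesgue_xt R N).

(** The choice of [T] turns both terms of [cutoff_error] into multiples of [ep / T]. *)
Lemma cutoff_error_integral (m s sig al ep rr T de C : R) (l : nat) (f : V -> R) :
  0 < ep -> 0 < rr -> 0 < T -> 0 < al -> 0 <= de -> 0 <= C -> (1 < l)%N -> m < l%:R -> 1 < m ->
  sig = (al + 1) * (m - 1) -> T = rr `^ m * ep `^ (2 - m) ->
  measurable_fun setT f -> (forall z, 0 <= f z) ->
  (forall w e : R, 0 <= w -> 0 <= e -> e <= 1 ->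
    w * e ^+ l.-1 + al `^ (1 - m) * (1 + w) `^ sig * e `^ (l%:R - m) <= de * (w `^ s * e ^+ l) + C) ->
  (\int[mu]_(z in upper) (cutoff_error m f al ep rr T l z)%:E <=
   (ep / T)%:E * ((de * ep `^ (- s))%:E * \int[mu]_(z in upper) (f z `^ s * cutoff rr T l z)%:E +
     (C * (6 * rr) ^+ N * T)%:E))%E.
Proof.
move=> ep0 rr0 T0 al0 de0 C0 l1 lm m1 sigE TE mf f0 hC.
(* [Q] contains the part of the support of the cut-off in the upper half-space;
   the constant term of the absorption only has to be integrated over it. *)
pose Q : set V := half_open_box (3 * rr) `*` `]0, T]%classic.
have mQ : measurable Q by apply: measurableX => //; exact: measurable_half_open_box.
have mup := @measurable_upper R N.
have epT : 0 <= ep / T by rewrite divr_ge0// ltW.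
have epTE : ep `^ (m - 1) * rr `^ (- m) = ep / T.
  rewrite TE invfM -!powRN -{2}(powRr1 (ltW ep0)) mulrCA -powRD ?(gt_eqF ep0) ?implybT//.
  by rewrite mulrC; congr (_ * _ `^ _); ring.
have damp_rateE z : damp_rate al ep (f z) `^ (1 - m) = al `^ (1 - m) * ep `^ (m - 1) * (1 + f z / ep) `^ sig.
  have ie : 0 <= ep^-1 by rewrite invr_ge0 ltW.
  have ae : 0 <= al / ep by rewrite mulr_ge0// ltW.
  rewrite /damp_rate /shifted_powR powRM ?powR_ge0// -powRrM (powRM _ (ltW al0) ie).
  rewrite -powR_inv1 ?(ltW ep0)// -powRrM sigE.
  by congr (_ * _ `^ _ * _ `^ _); ring.
have pt z : upper z -> cutoff_error m f al ep rr T l z <=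
    ep / T * (de * ep `^ (- s) * (f z `^ s * cutoff rr T l z) + C * \1_Q z).
  move=> zu; set e := cutoff_base rr T z.
  have e0 : 0 <= e by exact: cutoff_base_ge0.
  have e1 : e <= 1 by exact: cutoff_base_le1.
  have w0 : 0 <= f z / ep by rewrite divr_ge0// ltW.
  have -> : cutoff_error m f al ep rr T l z = ep / T * (f z / ep * e ^+ l.-1 +
      al `^ (1 - m) * (1 + f z / ep) `^ sig * e `^ (l%:R - m)).
    rewrite /cutoff_error -/e mulrDr; congr (_ + _); first by field; rewrite !gt_eqF.
    rewrite damp_rateE; move: (1 + f z / ep) => B.
    have -> : ep / T = ep `^ (m - 1) * rr `^ (- m) by rewrite epTE.
    by ring.
  rewrite ler_wpM2l//.
  have phE : cutoff rr T l z = e ^+ l by [].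
  have [ez|en] := eqVneq e 0.
    rewrite phE ez !expr0n !gtn_eqF ?(ltnW l1)//; last by case: l l1 {lm hC phE} => [|[|]].
    rewrite powR0 ?gt_eqF ?subr_gt0// !mulr0 !add0r mulr_ge0//.
  have zQ : Q z.
    have [zx zt] := cutoff_base_supp rr0 T0 en; split => /=.
      move=> i; have := zx i; rewrite ler_norml => /andP[h1 h2].
      by apply/andP; split; lra.
    by rewrite in_itv/= zu (le_trans (ler_norm _) zt).
  rewrite indicE mem_set// mulr1; apply: (le_trans (hC _ _ w0 e0 e1)).
  rewrite lerD2r phE -[f z / ep]/(f z * ep^-1) powRM ?invr_ge0 ?(ltW ep0)//.
  rewrite -powR_inv1 ?(ltW ep0)// -powRrM mulN1r.
  by rewrite le_eqVlt; apply/orP; left; apply/eqP; ring.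
have mph : measurable_fun setT (cutoff rr T l : V -> R).
  by apply: continuous_measurable_xt; exact: hasgrad_continuous (hasgrad_cutoff N rr T l1).
have mfp : measurable_fun setT (fun z => f z `^ s * cutoff rr T l z).
  by apply: measurable_funM => //; exact: measurableT_comp (measurable_powR s) mf.
have fp0 z : 0 <= f z `^ s * cutoff rr T l z by rewrite mulr_ge0 ?powR_ge0// cutoff_ge0.
apply: (@le_trans _ _ (\int[mu]_(z in upper) (ep / T *
    (de * ep `^ (- s) * (f z `^ s * cutoff rr T l z) + C * \1_Q z))%:E)%E).
  apply: ae_ge0_le_integral_nm => [z _|]; last by apply: aeW => z zu; rewrite lee_fin pt.
  by rewrite lee_fin cutoff_error_ge0.
have dep : 0 <= de * ep `^ (- s) by rewrite mulr_ge0// powR_ge0.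
have mQ1 : measurable_fun setT (\1_Q : V -> R) by exact: measurable_indic.
under eq_integral => z _ do rewrite EFinM.
rewrite ge0_integralZl_EFin//; last 2 first.
- by move=> z _; rewrite lee_fin addr_ge0// mulr_ge0.
- apply/measurable_EFinP; apply: measurable_funTS; apply: measurable_funD; exact: measurable_funM.
apply: lee_wpmul2l; first by rewrite lee_fin.
under eq_integral => z _ do rewrite EFinD.
rewrite ge0_integralD//; last 4 first.
- by move=> z _; rewrite lee_fin mulr_ge0.
- by apply/measurable_EFinP; apply: measurable_funTS; exact: measurable_funM.
- by move=> z _; rewrite lee_fin mulr_ge0.
- by apply/measurable_EFinP; apply: measurable_funTS; exact: measurable_funM.
apply: leeD.
  under eq_integral => z _ do rewrite EFinM.
  rewrite ge0_integralZl_EFin//; last by apply/measurable_EFinP; apply: measurable_funTS.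
  by move=> z _; rewrite lee_fin.
apply: (@le_trans _ _ (\int[mu]_z (C * \1_Q z)%:E)%E).
  apply: ge0_subset_integral => //.
  - by apply/measurable_EFinP; exact: measurable_funM.
  - by move=> z _; rewrite lee_fin mulr_ge0.
rewrite ge0_integralZ// integral_indic// setIT.
rewrite [X in (_ * X)%E](xt_half_open_box_measure N _ _) ?(ltW T0)//; last by rewrite mulr_ge0// ltW.
rewrite -EFinM lee_fin subr0 (_ : 2 * (3 * rr) = 6 * rr); last by ring.
by rewrite mulrA.
Qed.

(** On the Euclidean ball of radius [rr] the cut-off is at least (3/4)^l at time 0. *)
Lemma initial_mass (u0 : 'rV[R]_N -> R) (rr T I0 : R) (l : nat) : 0 < rr -> 0 < T ->
  lebesgue_measurable (lebesgue_rV N) setT u0 -> {ae lebesgue_rV N, forall x, 0 <= u0 x} ->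
  (I0%:E <= \int[lebesgue_rV N]_(x in eball rr) (u0 x)%:E)%E ->
  (((3 / 4) ^+ l * I0)%:E <= \int[lebesgue_rV N]_x (u0 x * cutoff rr T l (x, 0%R))%:E)%E.
Proof.
move=> rr0 T0 [g mg ug] u00 hI.
pose g1 x := Num.max (g x) 0.
have mg1 : measurable_fun setT g1 by exact: measurable_maxr.
have g10 x : 0 <= g1 x by rewrite le_max lexx orbT.
have ug1 : {ae lebesgue_rV N, forall x, u0 x = g1 x}.
  by apply: filterS2 ug u00 => x h1 h2; rewrite /g1 -h1// max_l.
have mB : measurable (eball rr : set 'rV[R]_N).
  rewrite (_ : eball rr = enorm @^-1` `]-oo, rr[%classic).
    by rewrite -[X in measurable X]setTI; exact: measurable_enorm.
  by apply/funext => x; rewrite /eball /preimage/= in_itv.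
have c0 : 0 <= (3 / 4 : R) ^+ l by rewrite exprn_ge0// divr_ge0.
rewrite EFinM.
apply: (@le_trans _ _ (((3 / 4) ^+ l)%:E * \int[lebesgue_rV N]_(x in eball rr) (g1 x)%:E)%E).
  apply: lee_wpmul2l; first by rewrite lee_fin.
  apply: le_trans hI _; rewrite le_eqVlt; apply/orP; left; apply/eqP.
  by apply: ae_eq_integral_nm; apply: filterS ug1 => x hx _; rewrite hx.
rewrite -ge0_integralZl_EFin//; last 2 first.
- by move=> x _; rewrite lee_fin.
- by apply/measurable_EFinP; exact: measurable_funTS.
rewrite integral_mkcond; apply: ae_ge0_le_integral_nm => [x _|].
  by rewrite patchE; case: ifP => // _; rewrite mule_ge0 ?lee_fin.
apply: filterS ug1 => x hx _; rewrite patchE hx; case: ifPn => [/set_mem xB|_]; last first.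
  by rewrite lee_fin mulr_ge0// cutoff_ge0.
rewrite -EFinM lee_fin mulrC ler_wpM2l//.
rewrite /cutoff lerXn2r ?nnegrE ?divr_ge0 ?cutoff_base_ge0//.
rewrite /cutoff_base /time_cut /= expr0n/= mul0r subr0.
rewrite [pos_part 1](_ : _ = 1) ?mulr1; last by rewrite /pos_part max_l.
rewrite /space_cut /pos_part le_max; apply/orP; left.
have sx : space_sq (x, 0) <= rr ^+ 2.
  have -> : space_sq (x, 0) = enorm x ^+ 2.
    rewrite sqr_sqrtr; last by apply: sumr_ge0 => i _; exact: sqr_ge0.
    by apply: eq_bigr => i _; rewrite expr2.
  by rewrite ler_sqr ?nnegrE ?sqrtr_ge0 ?(ltW rr0)// ltW.
have r4 : 0 < 4 * rr ^+ 2 by rewrite mulr_gt0// exprn_gt0.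
rewrite lerBrDr -lerBrDl ler_pdivrMr//; apply: le_trans sx _.
by rewrite (_ : (1 - 3 / 4) * (4 * rr ^+ 2) = rr ^+ 2)//; field.
Qed.

End final_bounds.

(** * Nonexistence *)

Section assembly.
Context (R : realType).

(** The choice of [kp]: the absorbed term scales like the lower bound of the source. *)
Lemma scaling_identity (N : nat) (k m beta kp rr : R) : 0 < rr ->
  kp * (k - m + 1) = N%:R - beta + m ->
  let ep := rr `^ (- kp) in let T := rr `^ m * ep `^ (2 - m) in
  ep / T * ep `^ (- (k / 2)) * (rr ^+ N * ep `^ (k / 2))^-1 = rr `^ (- beta).
Proof.
move=> rr0 E ep T.
have epr r : ep `^ r = rr `^ (- kp * r) by rewrite /ep -powRrM.
rewrite /T !epr -powR_mulrn ?(ltW rr0)// !invfM -!powRN /ep.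
have D (a b : R) : rr `^ a * rr `^ b = rr `^ (a + b) by rewrite powRD// (gt_eqF rr0) implybT.
rewrite !D; congr (_ `^ _); rewrite (_ : - beta = N%:R - beta + m - N%:R - m); last by ring.
by rewrite -E; field.
Qed.

Lemma exponent_choice (m s sig : R) : 1 < m -> 1 < s -> 0 < sig -> sig < s ->
  exists l : nat, [/\ (1 < l)%N, m < l%:R, l%:R / s <= l%:R - 1 & l%:R * (sig / s) <= l%:R - m].
Proof.
move=> m1 s1 sig0 sigs; have s0 : 0 < s by exact: lt_trans s1.
have a0 : 0 < s - 1 by rewrite subr_gt0.
have b0 : 0 < s - sig by rewrite subr_gt0.
have t1 : 0 <= s / (s - 1) by rewrite divr_ge0// ltW.
have t2 : 0 <= m * s / (s - sig).
  by rewrite divr_ge0 ?ltW// mulr_gt0// (lt_trans ltr01).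
(* The three constraints on [l] read [l > m], [l >= s / (s - 1)] and
   [l >= m s / (s - sig)]. *)
pose X := m + s / (s - 1) + m * s / (s - sig).
exists (Num.truncn X).+1; have := truncnS_gt X; move: (Num.truncn X).+1 => l Xl.
have m0 : 0 < m by rewrite (lt_trans ltr01).
have [ml x1l x2l] : [/\ m < l%:R, s / (s - 1) <= l%:R & m * s / (s - sig) <= l%:R].
  move: t1 t2 Xl; rewrite /X; move: (s / (s - 1)) (m * s / (s - sig)) l%:R => x1 x2 x3.
  by move=> t1 t2 h; split; lra.
split => //.
- by rewrite -(ltr_nat R) (lt_trans m1).
- move: x1l; rewrite ler_pdivrMr// ler_pdivrMr// => h.
  by rewrite -subr_ge0 (_ : _ - _ = l%:R * (s - 1) - s) ?subr_ge0//; ring.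
- move: x2l; rewrite mulrA !ler_pdivrMr// => h.
  by rewrite -subr_ge0 (_ : _ - _ = l%:R * (s - sig) - m * s) ?subr_ge0//; ring.
Qed.

Lemma powR_unbounded (th C : R) : 0 < th -> \forall r \near +oo, C < r `^ th.
Proof.
move=> th0; pose D := Num.max C 0 + 1.
have D0 : 0 < D by rewrite ltr_wpDl// le_max lexx orbT.
near=> r; apply: (@lt_le_trans _ _ D); first by rewrite (le_lt_trans (_ : _ <= Num.max C 0)) ?ltrDl// le_max lexx.
have -> : D = (D `^ th^-1) `^ th by rewrite -powRrM mulVf ?gt_eqF// powRr1// ltW.
have rD : D `^ th^-1 <= r by near: r; apply: nbhs_pinfty_ge; rewrite num_real.
by rewrite ge0_ler_powR ?nnegrE ?powR_ge0 ?(ltW th0)// (le_trans _ rD)// powR_ge0.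
Unshelve. all: by end_near. Qed.

End assembly.

Theorem corollary1p4 (R : realType) (N : nat) (p q m beta nu c : R)
    (A : 'rV[R]_N -> R -> 'rV[R]_N -> 'rV[R]_N) (K u0 : 'rV[R]_N -> R)
    (hN : (1 <= N)%N) (hp : 0 < p) (hq : 0 < q)
    (hm : 1 < m) (hA : admissible_operator A) (hAm : weakly_coercive m A)
    (hK : admissible_kernel beta K)
    (hu0 : L1loc_space u0)
    (hu0_ge0 : {ae lebesgue_rV N, forall x, 0 <= u0 x})
    (hc : 0 < c)
    (hgrowth : \forall r \near +oo,
       ((c * r `^ nu)%:E <= \int[lebesgue_rV N]_(x in eball r) (u0 x)%:E)%E)
    (hnu_ge0 : 0 <= nu) (hnu_lt : nu < N%:R + beta)
    (hbeta_gt0 : 0 < beta) (hbeta_lt : beta < (m + nu) / 2)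
    (hpq_gt : 2 * Num.max 1 (m - 1) < p + q)
    (hpq_lt : p + q < m - 1 + (N%:R - beta + m) / (N%:R + beta - nu)) :
  ~ exists u : 'rV[R]_N * R -> R,
      weak_solution m p q A K u0 u /\
      ~ {ae lebesgue_xt, forall z, upper z -> u z = 0}.
Proof.
move=> [u [hu _]].
set s := (p + q) / 2.
have [s1 sm] : 1 < s /\ m - 1 < s.
  rewrite /s !ltr_pdivlMr// mul1r; split; apply: le_lt_trans hpq_gt; rewrite ?[_ * 2]mulrC ?ler_pM2l ?le_max ?lexx ?orbT//.
  by rewrite -[leLHS]mulr1 ler_pM2l// le_max lexx.
have m10 : 0 < m - 1 by rewrite subr_gt0.
have [k Ek] : exists k, k = p + q by exists (p + q).
have sk : s = k / 2 by rewrite Ek.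
have ks : k = 2 * s by rewrite Ek /s mulrC divfK.
have km : 0 < k - m + 1 by rewrite ks; lra.
have Nb : 0 < N%:R + beta - nu by rewrite subr_gt0.
pose kp := (N%:R - beta + m) / (k - m + 1).
have kpE : kp * (k - m + 1) = N%:R - beta + m by rewrite /kp divfK// gt_eqF.
have kp_lb : N%:R + beta - nu < kp.
  rewrite /kp ltr_pdivlMr// mulrC -ltr_pdivlMr// Ek.
  by move: hpq_lt; rewrite -ltrBlDl opprB addrA addrAC.
(* [al < 1] makes the primitive of the damping function positive; [al] is also
   small enough for [(al + 1) (m - 1) < s]. *)
pose al := Num.min (1 / 2) ((s / (m - 1) - 1) / 2).
have sm1 : 0 < s / (m - 1) - 1 by rewrite subr_gt0 ltr_pdivlMr// mul1r.
have al0 : 0 < al by rewrite lt_min divr_gt0//= divr_gt0.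
have al1 : al < 1 by rewrite gt_min ltr_pdivrMr// mul1r ltr1n.
pose sig := (al + 1) * (m - 1).
have sig0 : 0 < sig by rewrite mulr_gt0// addr_gt0.
have sigs : sig < s.
  rewrite /sig -ltr_pdivlMr// -ltrBrDr; apply: (@le_lt_trans _ _ ((s / (m - 1) - 1) / 2)).
    by rewrite ge_min lexx orbT.
  by rewrite ltr_pdivrMr// ltr_pMr// ltr1n.
have [l [l1 lm hl1 hl2]] := exponent_choice hm s1 sig0 sigs.
have [c0 c00 hco] := hAm.
have [_ Kpos _ _] := hK.
have [D] := clean_exists hu.
have [kap kap0 hkap] := kernel_lower hbeta_gt0 hK hN.
have [C1 C10 C1E] : exists2 C1 : R, 0 < C1 &
    C1 = 2 * l%:R + (N * l)%:R + (N * l)%:R * (2 / c0 * energy_const N m c0 l).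
  eexists; last reflexivity.
  have l0 : 0 < (l%:R : R) by rewrite ltr0n ltnW.
  have Cp : 0 < energy_const N m c0 l by exact: energy_const_gt0.
  rewrite -addrA ltr_pwDl ?mulr_gt0// addr_ge0// mulr_ge0//.
  by rewrite mulr_ge0 ?(ltW Cp)// divr_ge0// ltW.
(* With this choice the term in Y on both sides is the same and cancels. *)
pose de := kap / C1.
have de0 : 0 < de by rewrite divr_gt0.
have C1de : C1 * de = kap by rewrite /de mulrC divfK// gt_eqF.
have [Cd Cd0 hCd] := cutoff_error_absorb al0 s1 sig0 sigs de0 l1 hl1 hl2.
pose C2 := C1 * (de + Cd * 6 ^+ N).
have claim rr : 1 <= rr ->
    ((c * rr `^ nu)%:E <= \int[lebesgue_rV N]_(x in eball rr) (u0 x)%:E)%E ->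
    (3 / 4) ^+ l * (c * rr `^ nu) <= C2 * rr `^ (N%:R - kp).
  move=> rr1 hmass; have rr0 : 0 < rr by rewrite (lt_le_trans ltr01).
  pose ep := rr `^ (- kp); pose T := rr `^ m * ep `^ (2 - m).
  have ep0 : 0 < ep by rewrite powR_gt0.
  have T0 : 0 < T by rewrite mulr_gt0 ?powR_gt0.
  have [r [h1 h2]] := source_test hN hm c00 hco Kpos hu0_ge0 hu D al0 al1 ep0 rr0 T0 l1 lm.
  rewrite -C1E in h2.
  have ha := initial_mass l rr0 T0 hu0.1 hu0_ge0 hmass.
  set Yf := (\int[@lebR R]_t (slice_moment rr T l (rep_u D) s t * slice_moment rr T l (rep_u D) s t))%E.
  have hS := source_lower hN hp hq rr0 T0 l1 (measurable_rep_u D) (rep_u_ge0 D) (@rep_u_out _ _ _ _ _ _ _ _ _ D)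
    (kap := kap * rr `^ (- beta)) (mulr_ge0 (ltW kap0) (powR_ge0 _ _)) (rep_uE D) Kpos
    (fun x x0 xr => hkap rr x rr1 x0 xr).
  (* The parameter for which the two terms of [time_amgm] become
     [R^N T] and [R^(-N) Y]. *)
  pose b := rr ^+ N * ep `^ s.
  have b0 : 0 < b by rewrite mulr_gt0 ?exprn_gt0 ?powR_gt0.
  have hX := time_amgm hp hq rr0 T0 l1 (measurable_rep_u D) (@rep_u_out _ _ _ _ _ _ _ _ _ D) b0.
  have hB := cutoff_error_integral ep0 rr0 T0 al0 (ltW de0) Cd0 l1 lm hm erefl erefl (measurable_rep_u D) (rep_u_ge0 D) hCd.
  rewrite -/s -/Yf in hS hX.
  have Y0 : (0 <= Yf)%E by apply: integral_ge0 => t _; rewrite mule_ge0// slice_moment_ge0.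
  (* [h3] bounds Y by a real number, so Y is finite and can be subtracted. *)
  have h3 := le_trans (leeD hS ha) h1.
  have h4 : (r%:E <= C1%:E * ((ep / T)%:E * ((de * ep `^ (- s))%:E * ((b * T)%:E + b^-1%:E * Yf) +
      (Cd * (6 * rr) ^+ N * T)%:E)))%E.
    apply: (le_trans h2); apply: lee_wpmul2l; first by rewrite lee_fin ltW.
    apply: (le_trans hB); apply: lee_wpmul2l; first by rewrite lee_fin divr_ge0// ltW.
    apply: leeD => //; apply: lee_wpmul2l => //.
    by rewrite lee_fin mulr_ge0 ?powR_ge0// ltW.
  have kr0 : 0 < kap * rr `^ (- beta) by rewrite mulr_gt0// powR_gt0.
  move: Y0 h3 h4; case: Yf {hS hX} => [y| |]// y0.
    rewrite -!(EFinM, EFinD) !lee_fin => h3 h4.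
    have := le_trans h3 h4.
    have E2 := scaling_identity rr0 kpE; rewrite /= -/ep -/T -sk -/b in E2.
    have bE : ep `^ (- s) * b = rr ^+ N.
      by rewrite /b mulrCA -powRD ?(gt_eqF ep0) ?implybT// addNr powRr0 mulr1.
    have epN : ep * rr ^+ N = rr `^ (N%:R - kp).
      by rewrite addrC powRD ?(gt_eqF rr0) ?implybT// powR_mulrn// ltW.
    have E3 : C1 * (ep / T * (de * ep `^ (- s) * (b * T + b^-1 * y) + Cd * (6 * rr) ^+ N * T)) =
        C2 * (ep * rr ^+ N) + kap * rr `^ (- beta) * y.
      rewrite -C1de -E2 /C2 -{1}bE exprMn.
      move: (ep `^ (- s)) bE => X bE; rewrite -bE; move: b b0 {bE E2 h3 h4 epN} => b b0.
      by field; rewrite !gt_eqF.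
    rewrite E3 epN; set Z := kap * _ * y.
    by rewrite [leRHS]addrC lerD2l.
  by move=> h3; move: h3; rewrite gt0_muley ?lte_fin// addye.
have q34 : 0 < (3 / 4 : R) ^+ l by rewrite exprn_gt0// divr_gt0.
have Q0 : 0 < (3 / 4) ^+ l * c by rewrite mulr_gt0.
have th0 : 0 < nu - N%:R + kp.
  by move: kp_lb hbeta_gt0; lra.
have big := powR_unbounded (C2 / ((3 / 4) ^+ l * c)) th0.
have rr1 : \forall r \near +oo, 1 <= r :> R by apply: nbhs_pinfty_ge; rewrite num_real.
have [rr [[h1 h2] h3]] := filter_ex (filterI (filterI rr1 hgrowth) big).
have rr0 : 0 < rr by rewrite (lt_le_trans ltr01).
have := claim rr h1 h2; rewrite leNgt => /negP; apply.
move: h3; rewrite ltr_pdivrMr// => h3.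
have -> : rr `^ nu = rr `^ (nu - N%:R + kp) * rr `^ (N%:R - kp).
  rewrite -powRD ?(gt_eqF rr0) ?implybT//; congr (_ `^ _); ring.
by rewrite !mulrA ltr_pM2r ?powR_gt0// mulrC.
Qed.
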